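(* Let $G$ be a 3-connected claw-free graph. Then the following hold. (1) For every integer $k$ with $3\le k\le 5$, $G$ has a topological wheel minor $W_k$ if and only if $G$ has a vertex of degree at least $k$. (2) For any vertex $z$ of $G$ of degree $k\le 5$, $G$ has a topological wheel minor $W_k$ with $z$ as its hub. (3) For any six given distinct vertices of $G$ and any choice of five of them, $G$ has a subgraph that is a subdivision of $W_3$ (that is, of $K_4$) containing the five chosen vertices on its rim and having the remaining sixth vertex as its hub.
   Context: Graphs are finite and simple. A graph is claw-free if it contains no induced subgraph isomorphic to $K_{1,3}$. For $k\ge 3$, the wheel $W_k$ is the graph consisting of a cycle of length $k$ (the rim) together with one additional vertex (the hub) adjacent to all $k$ vertices of the cycle; thus $W_3=K_4$. A graph $G$ has a topological wheel minor $W_k$ if $G$ contains a subgraph that is a subdivision of $W_k$. In such a subdivision, the hub is the vertex corresponding to the hub of $W_k$ and the rim is the cycle arising from subdividing the rim of $W_k$. *)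

(* Defs.v *)
From mathcomp Require Import all_boot.

Set Implicit Arguments.
Unset Strict Implicit.
Unset Printing Implicit Defensive.

(* A finite simple graph is a symmetric and irreflexive [G : rel T] on a
   finite type [T] of vertices. *)

Definition degree (T : finType) (G : rel T) (x : T) : nat :=
  #|[set y | G x y]|.

Definition connected_on (T : finType) (G : rel T) (A : {set T}) : Prop :=
  {in A &, forall x y, connect [rel u v | [&& u \in A, v \in A & G u v]] x y}.

Definition k_connected (T : finType) (k : nat) (G : rel T) : Prop :=
  k < #|T| /\ forall S : {set T}, #|S| < k -> connected_on G (~: S).

Definition has_induced_copy (U T : finType) (H : rel U) (G : rel T) : Prop :=
  exists f : U -> T, injective f /\ forall u v, G (f u) (f v) = H u v.

(* K_{1,n}: the centre is [None], the leaves are the [Some i]. *)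
Definition star (n : nat) : rel (option 'I_n) :=
  fun u v => isSome u != isSome v.
Arguments star : clear implicits.

Definition claw_free (T : finType) (G : rel T) : Prop :=
  ~ has_induced_copy (star 3) G.

(* The hub is [None], the rim is the cycle through the [Some i];
   [ordS i] is i + 1 modulo k. This is the wheel W_k only for k >= 3. *)
Definition wheel (k : nat) : rel (option 'I_k) :=
  fun u v =>
    match u, v with
    | None, None => false
    | Some i, Some j => (ordS i == j) || (ordS j == i)
    | _, _ => true
    end.
Arguments wheel : clear implicits.

(* A subgraph of [G] that is a subdivision of [H]: the edge uv of [H] is
   replaced by the path [branch u], [link u v], [branch v] of [G], where
   [link u v] lists the (possibly zero) subdividing vertices of uv in order
   from u to v. The values of [link] at non-adjacent pairs are irrelevant. *)
Record subdivision_in (U T : finType) (H : rel U) (G : rel T) := Subdivision {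
  branch : U -> T;
  link : U -> U -> seq T;
  branch_inj : injective branch;
  link_path : forall u v, H u v ->
    path G (branch u) (rcons (link u v) (branch v));
  link_uniq : forall u v, H u v -> uniq (link u v);
  link_rev : forall u v, H u v -> link v u = rev (link u v);
  link_branch : forall u v w, H u v -> branch w \notin link u v;
  link_disjoint : forall u v u' v' x, H u v -> H u' v' ->
    x \in link u v -> x \in link u' v' ->
    (u' = u /\ v' = v) \/ (u' = v /\ v' = u)
}.

Definition has_topological_minor (U T : finType) (H : rel U) (G : rel T)
  : Prop := inhabited (subdivision_in H G).

Definition hub (T : finType) (G : rel T) (k : nat)
  (S : subdivision_in (wheel k) G) : T := branch S None.

Definition on_rim (T : finType) (G : rel T) (k : nat)
    (S : subdivision_in (wheel k) G) (x : T) : Prop :=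
  exists i : 'I_k,
    x = branch S (Some i) \/ x \in link S (Some i) (Some (ordS i)).

(* Main.v *)
Require Import Defs.
From mathcomp Require Import all_boot zify.

Set Implicit Arguments.
Unset Strict Implicit.
Unset Printing Implicit Defensive.

(** All three claims follow from one fact: for every vertex [z], any three to
    five other vertices lie on a cycle of G - z ([cycle_avoiding]). If these
    vertices are neighbours of [z], the cycle and the edges to [z] form a
    wheel; otherwise Menger's theorem gives a fan of three paths from [z] to
    the cycle.

    To find the cycle, complete the neighbourhood of a vertex of G - z that
    lies in a diamond. G stays 3-connected and claw-free, and a cycle of the
    completed graph can be rerouted in the old one through the same vertices.
    So G - z may be assumed diamond-free. It is then the line graph of a
    multigraph F whose nodes are the maximal cliques, and [z] is one more edge
    of F when its neighbours are covered by two cliques; otherwise they induce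
    a 5-cycle, and either an edge at [z] can be dropped or G = W_5. A cycle of
    G - z is a closed trail of F, which comes from an even subgraph that avoids
    the edge [z] and connects at most five prescribed nodes. It exists since F
    is nearly 3-edge-connected: solutions on the two sides of a nontrivial
    3-edge-cut can be glued, an edge not at a prescribed node of degree 3 can
    be deleted, and a node of degree above 3 can be split. There remain the
    cubic multigraphs in which each edge meets one of the five nodes, a finite
    list that is searched exhaustively. *)

(** * Even subgraphs of multigraphs *)

(* A multigraph is given by the two ends [h e] and [t e] of its edges [e]; which
   end comes first is irrelevant. *)

(** The avoided edge is what makes the induction close. An even subgraph uses none or two edges of a
    3-edge-cut; solving the second side while avoiding the third edge forces the same two, or none.
    In the application [z] stays in F because F then inherits the connectivity of G: a set of edges
    of F is a set of vertices of G. Cliques with two vertices can be nodes of degree 2, hence only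
    nearly 3-edge-connected, and such nodes must not be prescribed. Since x has three neighbours,
    one of its cliques has at least three vertices or is an end of the edge [z], and this one
    represents x. No quotients are formed: contraction composes the end maps with a map of nodes,
    and deletion makes a loop, so edge sets carry over between multigraphs. Undoing a completion at
    x cuts the cycle into segments with ends next to x. Claw-freeness merges two out of any three;
    for the last two the neighbourhood of x must be connected, and this is what the diamond
    provides. *)

Section Cuts.
Variables (E W : finType).
Implicit Types (h t : E -> W) (D : {set E}) (U V X : {set W}).

Definition cut h t U : {set E} := [set e | (h e \in U) (+) (t e \in U)].

Definition splits U V := (V :&: U != set0) && (V :\: U != set0).

(** Parity is asked of every cut, not of every degree: in this form it passes to contracted
    multigraphs by taking preimages of [U], and [even_set1] recovers it from degrees. *)
Definition even_set h t D := forall U, ~~ odd #|D :&: cut h t U|.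

(* [X] lies in one component of the subgraph [D]. *)
Definition links h t D X := forall U, splits U X -> D :&: cut h t U != set0.

Lemma splitsP U V :
  reflect ((exists2 x, x \in V & x \in U) /\ (exists2 y, y \in V & y \notin U))
          (splits U V).
Proof.
apply: (iffP andP) => [[/set0Pn [x] + /set0Pn [y]]|[[x xV xU] [y yV yU]]].
  by rewrite !inE => /andP [xV xU] /andP [yU yV]; split; [exists x | exists y].
split; apply/set0Pn; [exists x | exists y]; rewrite inE ?xV ?xU ?yV //.
by rewrite yU.
Qed.

Lemma splitsC U V : splits (~: U) V = splits U V.
Proof. by rewrite /splits setDE setCK -setDE andbC. Qed.

Lemma cutC h t U : cut h t (~: U) = cut h t U.
Proof. by apply/setP => e; rewrite !inE; case: (_ \in U); case: (_ \in U). Qed.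

Lemma odd_cut h t D U :
  odd #|D :&: cut h t U| =
  \big[addb/false]_(e in D) ((h e \in U) (+) (t e \in U)).
Proof.
rewrite -sum1_card (big_morph odd oddD (erefl _)) /=.
rewrite (big_mkcond (mem (D :&: _))) [RHS]big_mkcond /=.
by apply: eq_bigr => e _; rewrite !inE; case: (e \in D) => //=; case: (_ (+) _).
Qed.

(** Modulo 2, the indicator of a cut is additive under symmetric difference of node sets. *)
Lemma odd_cut_xor h t D U U1 U2 :
  (forall x, (x \in U) = (x \in U1) (+) (x \in U2)) ->
  odd #|D :&: cut h t U| =
  odd #|D :&: cut h t U1| (+) odd #|D :&: cut h t U2|.
Proof.
move=> UE; rewrite !odd_cut -big_split /=; apply: eq_bigr => e _.
by rewrite !UE; do 4 case: (_ \in _).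
Qed.

Lemma even_set1 h t D : (forall x, ~~ odd #|D :&: cut h t [set x]|) -> even_set h t D.
Proof.
move=> D1 U; have [n] := ubnP #|U|; elim: n U => // n IH U; rewrite ltnS => leUn.
have [->|[x xU]] := set_0Vmem U.
  by rewrite odd_cut big1 // => e _; rewrite !inE.
rewrite (@odd_cut_xor _ _ _ _ (U :\ x) [set x]); last first.
  by move=> y; rewrite !inE; case: eqP => [->|_]; rewrite ?xU ?addbF.
rewrite (negbTE (D1 x)) addbF; apply: IH.
by rewrite (cardsD1 x) xU add1n in leUn.
Qed.

End Cuts.

(** Contraction is composition with [g]: the edge type stays fixed, and contracted edges become
    loops, which no cut contains. *)
Lemma cut_comp (E W W' : finType) (h t : E -> W) (g : W -> W') (U : {set W'}) :
  cut (g \o h) (g \o t) U = cut h t (g @^-1: U).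
Proof. by apply/setP => e; rewrite !inE. Qed.

Lemma splits_imset (W W' : finType) (g : W -> W') (V : {set W}) (U : {set W'}) :
  splits U (g @: V) = splits (g @^-1: U) V.
Proof.
apply/splitsP/splitsP.
  case=> [[_ /imsetP [x xV ->] xU] [_ /imsetP [y yV ->] yU]].
  by split; [exists x | exists y] => //; rewrite inE.
case=> [[x xV xU] [y yV yU]]; move: xU yU; rewrite !inE => xU yU.
by split; [exists (g x) | exists (g y)] => //; apply: imset_f.
Qed.

(** * Contraction at a node of degree 2 *)

Section DegreeTwo.
Variables (E W : finType).
Implicit Types (h t : E -> W) (D : {set E}) (U V X : {set W}).

Definition good h t z X D :=
  [/\ z \notin D, even_set h t D & links h t D X].

(** Connectivity is relative to [V] because [W] keeps elements that are no longer nodes after a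
    contraction. *)
Definition three_connected h t V := forall U, splits U V -> 2 < #|cut h t U|.

(* A node of degree 2 is tolerated outside [X], since an edge at it can be
   contracted. *)
Definition nearly_three_connected h t V X := forall U, splits U V ->
  2 < #|cut h t U| \/
  #|cut h t U| = 2 /\ exists2 a, a \in V :\: X & V :&: U = [set a] \/ V :\: U = [set a].

Definition joins h t e x y := (h e == x) && (t e == y) || (h e == y) && (t e == x).

Lemma joins_cut h t e x y U :
  joins h t e x y -> (e \in cut h t U) = (x \in U) (+) (y \in U).
Proof. by rewrite inE => /orP [] /andP [/eqP -> /eqP ->] //; rewrite addbC. Qed.

Definition identify (a b : W) (x : W) := if x == a then b else x.

(** In the contraction [c] is a loop, so its membership in [D] is free; it is made to agree with the
    other edge [o] at [a]. Cuts with [a] and [b] on one side are cuts of the contraction; the others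
    differ from such a cut by the cut at [a]. *)
Lemma lift_degree2 h t (z c o : E) (a b : W) X D :
  cut h t [set a] = [set c; o] -> c != o -> joins h t c a b -> a != b -> z != c ->
  a \notin X ->
  good (identify a b \o h) (identify a b \o t) z X D -> exists D', good h t z X D'.
Proof.
move=> cuta nco cab nab nzc aX [zD evD liD].
set D' := if o \in D then c |: D else D :\ c; exists D'.
have zD' : z \notin D'.
  by rewrite /D'; case: ifP; rewrite !inE ?(negbTE nzc) (negbTE zD) ?andbF.
have memD' e : e != c -> (e \in D') = (e \in D).
  by move=> ne; rewrite /D'; case: ifP; rewrite !inE ?(negbTE ne).
have cD' : (c \in D') = (o \in D).
  by rewrite /D'; case: ifP => _; rewrite !inE eqxx.
pose U0 U := identify a b @^-1: U.
have cU0 U : c \notin cut h t (U0 U).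
  by rewrite (joins_cut _ cab) !inE /identify eqxx eq_sym (negbTE nab) addbb.
have D'U0 U : D' :&: cut h t (U0 U) = D :&: cut h t (U0 U).
  apply/setP => e; rewrite !in_setI; have [->|/memD' -> //] := eqVneq e c.
  by rewrite (negbTE (cU0 U)) !andbF.
have evU0 U : ~~ odd #|D' :&: cut h t (U0 U)|.
  by rewrite D'U0 -cut_comp evD.
have oc : o != c by rewrite eq_sym.
have eva : ~~ odd #|D' :&: cut h t [set a]|.
  rewrite cuta; have [oD|oD] := boolP (o \in D).
    rewrite (_ : _ :&: _ = [set c; o]); first by rewrite cards2 nco.
    apply/setIidPr/subsetP => e; rewrite !inE => /orP [] /eqP ->.
      by rewrite cD'.
    by rewrite memD'.
  rewrite (_ : _ :&: _ = set0) ?cards0 //; apply/setP => e; rewrite !inE.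
  have [->|ne] := eqVneq e c; first by rewrite cD' (negbTE oD).
  by rewrite memD' //=; case: eqP => [->|]; rewrite ?andbF // (negbTE oD).
have U0E U : (a \in U) = (b \in U) -> U0 U = U.
  by move=> ab; apply/setP => x; rewrite inE /identify; case: eqP => // ->.
split => // U.
  have [ab|ab] := eqVneq (a \in U) (b \in U); first by rewrite -(U0E U).
  rewrite (@odd_cut_xor _ _ _ _ _ U (U0 U) [set a]).
    by rewrite (negbTE (evU0 U)) (negbTE eva).
  move=> x; rewrite !inE /identify; case: eqP => [->|_]; last by rewrite addbF.
  by move: ab; do 2 case: (_ \in U).
move=> /splitsP [[x xX xU] [y yX yU]].
have : splits (U0 U) X.
  apply/splitsP; split; [exists x|exists y] => //; rewrite inE /identify.
    by case: eqP xX aX => // -> ->.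
  by case: eqP yX aX => // -> ->.
move=> sp0; have := liD U; rewrite cut_comp -/(U0 U).
have -> : splits U X.
  by apply/splitsP; split; [exists x|exists y].
move=> /(_ isT) /set0Pn [d]; rewrite in_setI => /andP [dD dU0].
have dc : d != c by apply: contraTneq dU0 => ->.
have dD' : d \in D' by rewrite memD'.
have [ab|ab] := eqVneq (a \in U) (b \in U).
  by apply/set0Pn; exists d; rewrite in_setI dD' -(U0E U).
(* Here [U] separates [a] from [b]. If the edge found is [o], then [c] is in [D'] and crosses [U];
   any other crossing edge misses [a], the only node on which [U] and [U0 U] differ. *)
have [da|da] := boolP (d \in cut h t [set a]).
  move: da; rewrite cuta !inE (negbTE dc) /= => /eqP do_; subst d.
  apply/set0Pn; exists c; rewrite in_setI cD' dD (joins_cut _ cab).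
  by move: ab; do 2 case: (_ \in U).
apply/set0Pn; exists d; rewrite in_setI dD'.
move: da dU0; rewrite !inE /identify.
by do 2 case: eqP => //=; case: (b \in U).
Qed.

End DegreeTwo.

(** * Gluing along an edge cut *)

Section Glue.
Variables (E W : finType).
Implicit Types (h t : E -> W) (D DA DB : {set E}) (U V X A XA XB : {set W}).

Definition shrink A (a x : W) := if x \in A then a else x.

Lemma shrink_preimset A a U :
  shrink A a @^-1: U = if a \in U then U :|: A else U :\: A.
Proof.
apply/setP => x; rewrite inE /shrink; case aU: (a \in U); rewrite !inE;
by case: (x \in A); rewrite ?aU ?orbT ?orbF ?andbT.
Qed.

(** Enlarge [U] by the contracted side. The edge of [DA] crossing the enlarged set cannot cross [A],
    since such edges have both ends in [U]; so it lies inside [A], where [D] and [DA] agree. *)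
Lemma glue_side h t A b D DA U XA y :
  b \notin A ->
  (forall e, h e \in A -> t e \in A -> (e \in D) = (e \in DA)) ->
  (forall e, e \in DA -> e \in cut h t A -> (h e \in U) && (t e \in U)) ->
  links (shrink (~: A) b \o h) (shrink (~: A) b \o t) DA XA ->
  y \in XA -> y \in A -> y \notin U -> splits (U :|: ~: A) XA ->
  D :&: cut h t U != set0.
Proof.
move=> bA DDA KU liA yX yA yU sp.
have := liA _ sp; rewrite cut_comp shrink_preimset !inE bA orbT.
move=> /set0Pn [d]; rewrite -setUA setUid in_setI => /andP [dD dU].
apply/set0Pn; exists d; rewrite in_setI.
have := KU d dD; have := DDA d; move: dU; rewrite !inE.
case hA: (h d \in A); case tA: (t d \in A); rewrite ?orbT ?orbF //=.
- by move=> -> ->; rewrite ?dD.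
- by move=> dU _ /(_ isT) /andP [hU tU]; move: dU; rewrite hU.
- by move=> dU _ /(_ isT) /andP [hU tU]; move: dU; rewrite tU.
Qed.

(** [D] follows [DA] inside [A] and [DB] elsewhere; on the cut the two agree. Evenness comes from
    splitting [U] into its parts inside and outside [A]. For [links] the bound 2 matters: a [U]
    crossed by no edge of [D] contains an even number of the chosen cut edges, hence all or none. *)
Lemma glue h t z A a b DA DB X XA XB :
  a \in A -> b \notin A ->
  even_set (shrink (~: A) b \o h) (shrink (~: A) b \o t) DA ->
  links (shrink (~: A) b \o h) (shrink (~: A) b \o t) DA XA ->
  even_set (shrink A a \o h) (shrink A a \o t) DB ->
  links (shrink A a \o h) (shrink A a \o t) DB XB ->
  DA :&: cut h t A = DB :&: cut h t A -> #|DB :&: cut h t A| <= 2 ->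
  X :&: A \subset XA -> X :\: A \subset XB ->
  (splits A X -> (b \in XA) && (a \in XB)) ->
  ((h z \in A) && (t z \in A) -> z \notin DA) ->
  (~~ ((h z \in A) && (t z \in A)) -> z \notin DB) ->
  exists D, good h t z X D.
Proof.
move=> aA bA evA liA evB liB KE K2 XAs XBs sp zA zB.
pose D := [set e | if (h e \in A) && (t e \in A) then e \in DA else e \in DB].
have memK e : e \in cut h t A -> (e \in DA) = (e \in DB).
  by move=> eC; have /setP/(_ e) := KE; rewrite !in_setI eC !andbT.
have evDA U : U \subset A -> ~~ odd #|D :&: cut h t U|.
  move=> sUA; have bU : b \notin U by apply: contra bA; apply: (subsetP sUA).
  have := evA U; rewrite cut_comp shrink_preimset (negbTE bU).
  rewrite setDE setCK (setIidPl sUA); congr (~~ odd #|pred_of_set _|).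
  apply/setP => e; rewrite !in_setI; case eU: (e \in cut h t U); rewrite ?andbF //.
  rewrite !andbT inE; case: ifP => // ins; apply: memK; rewrite inE.
  have HU x : (x \in U) ==> (x \in A) by apply/implyP/(subsetP sUA).
  move: eU ins (HU (h e)) (HU (t e)); rewrite inE.
  by do 2 case: (_ \in U); do 2 case: (_ \in A).
have evDB U : [disjoint U & A] -> ~~ odd #|D :&: cut h t U|.
  move=> dUA; have UA x : x \in U -> x \notin A.
    by move=> xU; rewrite (disjointFr dUA).
  have aU : a \notin U by apply: contraL aA; apply: UA.
  have := evB U; rewrite cut_comp shrink_preimset (negbTE aU).
  have -> : U :\: A = U by apply/setDidPl.
  congr (~~ odd #|pred_of_set _|).
  apply/setP => e; rewrite !in_setI; case eU: (e \in cut h t U); rewrite ?andbF //.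
  rewrite !andbT inE; case: ifP => // /andP [hA tA].
  have HU x : (x \in U) ==> (x \notin A) by apply/implyP/UA.
  by move: eU (HU (h e)) (HU (t e)); rewrite inE hA tA; do 2 case: (_ \in U).
have evD : even_set h t D.
  move=> U; rewrite (@odd_cut_xor _ _ _ _ _ U (U :&: A) (U :\: A)).
    rewrite (negbTE (evDA _ (subsetIr _ _))) (negbTE (evDB _ _)) //.
    by rewrite -setI_eq0 setIDAC setDIl setDv setI0.
  by move=> x; rewrite !inE; do 2 case: (x \in _).
exists D; split => //.
  by rewrite inE; case: ifP => [/zA|/negbT /zB].
(* [main] treats a [U] containing both ends of all chosen cut edges; parity brings either [U] or its
   complement into this case. *)
pose main U := splits U X ->
  (forall e, e \in DB :&: cut h t A -> (h e \in U) && (t e \in U)) ->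
  D :&: cut h t U != set0.
suff mainP U : main U.
  move=> U spU; apply/negP => /eqP D0.
  have noD e : e \in D -> (h e \in U) = (t e \in U).
    move=> eD; have /setP/(_ e) := D0; rewrite in_set0 in_setI eD inE /=.
    by do 2 case: (_ \in U).
  have KD e : e \in DB :&: cut h t A -> e \in D.
    rewrite in_setI => /andP [eB]; rewrite !inE.
    by case: ifP => // /andP [-> ->].
  have := evDA (U :&: A) (subsetIr _ _).
  have -> : D :&: cut h t (U :&: A) =
            [set e in DB :&: cut h t A | h e \in U].
    apply/setP => e; rewrite in_setI [RHS]inE.
    have [eD|eD] := boolP (e \in D); last first.
      by symmetry; apply/negbTE; apply: contra eD => /andP [/KD].
    have := noD _ eD; move: eD; rewrite !inE => eD ->.
    move: eD; case: (h e \in A); case: (t e \in A); case: (t e \in U) => /= eD'; by rewrite ?eD' ?andbF.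
  set K := DB :&: _ in KD K2 *; move=> evK.
  have [KU|/subsetPn [e eK eU]] := boolP (K \subset [set e in K | h e \in U]).
    have: main U by exact: mainP.
    move=> /(_ spU); rewrite D0 eqxx => H; suff: false by [].
    apply: H => e eK; have := subsetP KU e eK; rewrite inE eK /= => hU.
    by rewrite -(noD _ (KD _ eK)) hU.
  have K0 : [set e in K | h e \in U] = set0.
    apply/eqP; rewrite -cards_eq0.
    have : #|[set e in K | h e \in U]| < #|K|.
      apply: proper_card; apply/properP; split; last by exists e.
      by apply/subsetP => e'; rewrite inE => /andP [].
    by case: #|[set e in K | h e \in U]| evK => [|[|n]] // _ /leq_trans /(_ K2).
  have: main (~: U) by exact: mainP.
  rewrite /main splitsC => /(_ spU); rewrite cutC D0 eqxx => H; suff: false by [].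
  apply: H => e' eK'; rewrite !inE -(noD _ (KD _ eK')) andbb.
  by have /setP/(_ e') := K0; rewrite !inE in eK' *; rewrite eK' => /= ->.
move=> /splitsP [[x xX xU] [y yX yU]] KU.
have [yA|yA] := boolP (y \in A).
  apply: (@glue_side h t A b D DA U XA y) => //.
  - by move=> e hA tA; rewrite inE hA tA.
  - by move=> e eDA eC; apply: KU; rewrite in_setI eC andbT -memK.
  - by apply: (subsetP XAs); rewrite inE yX.
  apply/splitsP; split; last first.
    exists y; first by apply: (subsetP XAs); rewrite inE yX.
    by rewrite !inE negb_or yU negbK.
  have [xA|xA] := boolP (x \in A).
    by exists x; [apply: (subsetP XAs); rewrite inE xX | rewrite inE xU].
  have /sp /andP [bX _] : splits A X.
    by apply/splitsP; split; [exists y|exists x].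
  by exists b => //; rewrite !inE bA orbT.
apply: (@glue_side h t (~: A) a D DB U XB y) => //.
- by rewrite inE negbK.
- by move=> e; rewrite in_setC => /negbTE hA _; rewrite inE hA.
- by move=> e eDB; rewrite cutC => eC; apply: KU; rewrite in_setI eC eDB.
- by rewrite setCK.
- by apply: (subsetP XBs); rewrite !inE yA.
- by rewrite inE.
apply/splitsP; rewrite setCK; split; last first.
  exists y; first by apply: (subsetP XBs); rewrite !inE yA.
  by rewrite !inE negb_or yU.
have [xA|xA] := boolP (x \in A); last first.
  by exists x; [apply: (subsetP XBs); rewrite !inE xA | rewrite inE xU].
have /sp /andP [_ aX] : splits A X.
  by apply/splitsP; split; [exists x|exists y].
by exists a => //; rewrite !inE aA orbT.
Qed.

End Glue.

(** The subtraction is truncated: only degrees above 3 count. *)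
Definition excess (E W : finType) (h t : E -> W) (V : {set W}) :=
  \sum_(v in V) (#|cut h t [set v]| - 3).

(** Loops are left out because contraction and deletion keep [E] and only turn edges into loops. *)
Definition msize (E W : finType) (h t : E -> W) (V : {set W}) :=
  #|V| + #|[set e | h e != t e]|.

Definition admissible (E W : finType) (h t : E -> W) (V X : {set W}) :=
  [/\ forall e, (h e \in V) && (t e \in V), X \subset V & #|X| <= 5].

(* Induction is lexicographic on ([excess], [msize]): each reduction lowers
   [msize] except the splitting of a node of degree above 3, which lowers
   [excess]. *)
Definition solvable_below m n := forall (E W : finType) (h t : E -> W) z V X,
  admissible h t V X -> nearly_three_connected h t V X ->
  excess h t V < m \/ excess h t V = m /\ msize h t V < n ->
  exists D, good h t z X D.

(** * Reductions that lower [msize] *)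

Section Steps.
Variables (E W : finType).
Implicit Types (h t : E -> W) (D : {set E}) (U V X A : {set W}).

Lemma cut_trace h t V U U' : (forall e, (h e \in V) && (t e \in V)) ->
  V :&: U = V :&: U' -> cut h t U = cut h t U'.
Proof.
move=> hV UE; apply/setP => e; have /andP [hv tv] := hV e; rewrite !inE.
have /setP S := UE; have := S (h e); have := S (t e).
by rewrite !inE hv tv /= => -> ->.
Qed.

Lemma cut_traceC h t V U a : (forall e, (h e \in V) && (t e \in V)) ->
  V :\: U = [set a] -> cut h t U = cut h t [set a].
Proof.
move=> hV UE; rewrite -cutC; apply: (cut_trace hV).
rewrite -setDE UE; apply/setP => x; rewrite !inE andbC.
case: eqP => //= ->; have /setP/(_ a) := UE.
by rewrite !inE eqxx => /andP [].
Qed.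

Lemma imsetI_preim (W' : finType) (g : W -> W') V (U : {set W'}) :
  (g @: V) :&: U = g @: (V :&: g @^-1: U).
Proof.
apply/setP => y; rewrite inE; apply/andP/imsetP => [[/imsetP [x xV ->] xU]|[x]].
  by exists x; rewrite // !inE xV.
by rewrite !inE => /andP [xV xU] ->; rewrite imset_f.
Qed.

(** Degrees bounded by 3 or by the old degree keep [excess] from growing, so a drop of [msize]
    suffices for the induction hypothesis. *)
Lemma solve h t z V X m n V' :
  solvable_below m n -> forall h' t' : E -> W,
  admissible h' t' V' X -> nearly_three_connected h' t' V' X ->
  excess h t V <= m -> msize h t V <= n -> V' \subset V ->
  (forall v, v \in V' -> #|cut h' t' [set v]| <= maxn 3 #|cut h t [set v]|) ->
  msize h' t' V' < msize h t V ->
  exists D, good h' t' z X D.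
Proof.
move=> IH h' t' adm near exm szn sV' cv sz; apply: (IH _ _ _ _ _ V') => //.
have : excess h' t' V' <= excess h t V.
  rewrite /excess (big_setID V' (A := V)) /= (setIidPr sV').
  by apply: leq_trans (leq_addr _ _); apply: leq_sum => v /cv; lia.
by move: exm szn sz; clear; lia.
Qed.

Lemma comp_nonloops h t (W' : finType) (g : W -> W') :
  #|[set e | (g \o h) e != (g \o t) e]| <= #|[set e | h e != t e]|.
Proof.
by apply/subset_leq_card/subsetP => e; rewrite !inE; apply: contra => /= /eqP ->.
Qed.

Lemma step_degree2 h t z V X m n a :
  solvable_below m n -> admissible h t V X -> nearly_three_connected h t V X ->
  excess h t V <= m -> msize h t V <= n ->
  a \in V -> a \notin X -> #|cut h t [set a]| = 2 ->
  exists D, good h t z X D.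
Proof.
move=> IH [hV sXV X5] near exm szn aV aX cut2.
(* Of the two edges at [a] one differs from [z]; that one is contracted. *)
have [c [o [nco cE zc]]] : exists c o, [/\ c != o, cut h t [set a] = [set c; o] & z != c].
  have /eqP/cards2P [c [o [nco cE]]] := cut2.
  have [zc|zc] := eqVneq z c; last by exists c, o.
  by exists o, c; rewrite eq_sym nco cE setUC zc.
have [b cab nab] : exists2 b, joins h t c a b & a != b.
  have : c \in cut h t [set a] by rewrite cE !inE eqxx.
  rewrite !inE /joins; have [hc|hc] := eqVneq (h c) a.
    by move=> /= ta; exists (t c); rewrite ?eqxx // eq_sym.
  by move=> /= ta; exists (h c); rewrite ?eqxx ?ta ?orbT // eq_sym.
have bV : b \in V.
  by have := hV c; case/orP: cab => /andP [/eqP -> /eqP ->] /andP [].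
have gV : identify a b @: V \subset V :\ a.
  apply/subsetP => _ /imsetP [x xV ->]; rewrite !inE /identify.
  by case: (x =P a) => [_|/eqP ->]; rewrite // eq_sym nab.
have gfix x : x != a -> identify a b x = x by rewrite /identify => /negbTE ->.
have [|||||||D Dg] := @solve h t z V X m n (identify a b @: V) IH (identify a b \o h) (identify a b \o t); last first.
- by apply: (lift_degree2 cE nco cab nab zc aX Dg).
- rewrite /msize; have := subset_leq_card gV; rewrite cardsDS ?sub1set // cards1.
  have := comp_nonloops h t (identify a b).
  have : 0 < #|V| by apply/card_gt0P; exists a.
  by clear; lia.
- move=> v /(subsetP gV); rewrite !inE => /andP [va vV]; rewrite cut_comp.
  have [vb|vb] := eqVneq v b; last first.
    rewrite (_ : _ @^-1: _ = [set v]) ?leq_maxr //.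
    apply/setP => x; rewrite !inE /identify; case: (x =P a) => // ->.
    by rewrite eq_sym (negbTE vb) eq_sym (negbTE va).
  subst v; rewrite leq_max; apply/orP; right.
  (* The merged node loses [c] and gains at most [o], so its degree does not exceed that of [b]. *)
  have sub : cut h t (identify a b @^-1: [set b]) \subset o |: (cut h t [set b] :\ c).
    apply/subsetP => e eU.
    have ec : e != c.
      apply: contraTneq eU => ->.
      by rewrite (joins_cut _ cab) !inE /identify !eqxx; case: (b == a); rewrite eqxx.
    have [ea|ea] := boolP (e \in cut h t [set a]).
      by move: ea; rewrite cE !inE (negbTE ec) => /= ->.
    rewrite !inE ec /=; apply/orP; right; move: ea eU; rewrite !inE /identify.
    by case: (h e =P a) => _; case: (t e =P a) => _ //=; rewrite addbb.
  apply: leq_trans (subset_leq_card sub) _; rewrite cardsU1.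
  have : c \in cut h t [set b].
    by rewrite (joins_cut _ cab) !inE eqxx (negbTE nab).
  by move=> cb; rewrite (cardsD1 c (cut h t [set b])) cb; case: (o \in _).
- by apply: subset_trans gV (subsetDl _ _).
- by [].
- by [].
- move=> U; rewrite splits_imset cut_comp => spU.
  have [|[-> [a' a'VX sing]]] := near _ spU; [by left | right; split=> //].
  have Uab : (a \in identify a b @^-1: U) = (b \in identify a b @^-1: U).
    by rewrite !inE /identify eqxx; case: eqP => // ->.
  have a'a : a' != a.
    apply: contraNneq nab => a'a; subst a'; move: Uab sing.
    set P := _ @^-1: _ => Uab [] /setP s.
      have := s b; have := s a.
      by rewrite !in_setI bV aV !in_set1 eqxx -Uab /= => -> /esym; rewrite eq_sym.
    have := s b; have := s a.
    by rewrite !in_setD bV aV !in_set1 eqxx -Uab /= => -> /esym; rewrite eq_sym.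
  exists a'; last first.
    case: sing => s; [left | right].
      by rewrite imsetI_preim s imset_set1 gfix.
    by rewrite setDE imsetI_preim preimsetC -setDE s imset_set1 gfix.
  move: a'VX; rewrite !inE => /andP [-> a'V]; rewrite -(gfix a' a'a).
  by rewrite imset_f.
split => //.
  by move=> e; have /andP [he te] := hV e; rewrite /= !imset_f.
apply/subsetP => x xX; rewrite -(gfix x); last by apply: contraNneq aX => <-.
by rewrite imset_f // (subsetP sXV).
Qed.

Definition internally_four h t V := forall U, splits U V -> #|cut h t U| = 3 ->
  exists2 a, a \in V & V :&: U = [set a] \/ V :\: U = [set a].

Lemma cut_disjoint0 h t V U : (forall e, (h e \in V) && (t e \in V)) ->
  V :&: U = set0 -> cut h t U = set0.
Proof.
move=> hV U0; rewrite (cut_trace (U' := set0) hV) ?setI0 //.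
by apply/setP => e; rewrite !inE.
Qed.

Lemma three_nearly h t V X : three_connected h t V -> nearly_three_connected h t V X.
Proof. by move=> H U /H; left. Qed.

Lemma shrink_three h t V A a :
  three_connected h t V ->
  three_connected (shrink A a \o h) (shrink A a \o t) (shrink A a @: V).
Proof. by move=> H U; rewrite splits_imset cut_comp; apply: H. Qed.

(** The contracted side becomes a node of degree 3, which adds nothing to [excess], and its two or
    more nodes become one, which lowers [msize]. *)
Lemma solve_shrink h t z' V X X' m n A a :
  solvable_below m n -> admissible h t V X -> three_connected h t V ->
  excess h t V <= m -> msize h t V <= n ->
  a \in A -> a \in V -> #|cut h t A| = 3 -> 1 < #|V :&: A| ->
  #|X'| <= 5 -> X' \subset a |: (V :\: A) ->
  exists D, good (shrink A a \o h) (shrink A a \o t) z' X' D.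
Proof.
move=> IH [hV sXV X5] tri exm szn aA aV cA A2 X'5 sX'.
have gV : shrink A a @: V \subset a |: (V :\: A).
  apply/subsetP => _ /imsetP [x xV ->]; rewrite !inE /shrink.
  by case: ifP => [|/negbT ->]; rewrite ?eqxx // xV orbT.
have sV : a |: (V :\: A) \subset V by rewrite subUset sub1set aV subsetDl.
apply: (@solve h t z' V X' m n (shrink A a @: V) IH) => //.
- split => //; first by move=> e; have /andP [he te] := hV e; rewrite /= !imset_f.
  apply: subset_trans sX' _; apply/subsetP => x; rewrite !inE.
  case/orP => [/eqP ->|/andP [xA xV]].
    by apply/imsetP; exists a; rewrite // /shrink aA.
  by apply/imsetP; exists x; rewrite // /shrink (negbTE xA).
- by apply: three_nearly; apply: shrink_three.
- exact: subset_trans gV sV.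
- move=> v /(subsetP gV) vV; rewrite cut_comp shrink_preimset in_set1.
  have [<-|nav] := eqVneq a v.
    have -> : a |: A = A by apply/setP => x; rewrite !inE; case: eqP => // ->.
    by rewrite cA leq_maxl.
  rewrite (_ : [set v] :\: A = [set v]) ?leq_maxr //.
  apply/setDidPl; rewrite disjoints1.
  by move: vV; rewrite !inE eq_sym (negbTE nav) => /andP [].
rewrite /msize; have := subset_leq_card gV.
have := comp_nonloops h t (shrink A a).
rewrite cardsU1 !inE aA /= [#|V :\: A|]cardsD.
have : #|V :&: A| <= #|V| by apply: subset_leq_card; rewrite subsetIl.
by lia.
Qed.

(** The multigraph with [U] contracted is solved first, avoiding [z]. By parity the solution uses
    none or two of the three cut edges. If two, the other side is solved avoiding the third edge
    [e3], which leaves it the same two or none. A side whose solution misses the cut contains all of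
    [X], and then the empty set serves on the other side. *)
Lemma step_cut h t z V X m n U :
  solvable_below m n -> admissible h t V X -> three_connected h t V ->
  excess h t V <= m -> msize h t V <= n ->
  #|cut h t U| = 3 -> 1 < #|V :&: U| -> 1 < #|V :\: U| ->
  exists D, good h t z X D.
Proof.
move=> IH adm tri exm szn.
(* Up to complement [z] does not lie inside [U], so avoiding it is left to the side solved first. *)
wlog zU : U / ~~ ((h z \in U) && (t z \in U)).
  move=> wl c3 v1 v2; have [zU|zU] := boolP ((h z \in U) && (t z \in U)); last first.
    exact: wl zU c3 v1 v2.
  apply: (wl (~: U)); rewrite ?cutC //; last by rewrite setDE setCK.
    by rewrite !inE; case/andP: zU => ->.
  by rewrite -setDE.
move=> c3 VU VU'.
have [a] : exists a, a \in V :&: U by apply/card_gt0P; lia.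
rewrite inE => /andP [aV aU].
have [b] : exists b, b \in V :\: U by apply/card_gt0P; lia.
rewrite inE => /andP [bU bV].
have sXV : X \subset V by case: adm.
have X5 : #|X| <= 5 by case: adm.
(* The contracted node [a] is prescribed when [X] meets [U]; it replaces at least one node there, so
   five remains the bound. If nothing of [X] is left outside [U], the node [b] is prescribed, which
   makes [U] split [XB] and forces the solution to cross. *)
pose XB := (X :\: U) :|: ([set x in [set a] | X :&: U != set0] :|:
                          [set x in [set b] | X :\: U == set0]).
pose XA := (X :&: U) :|: ([set x in [set b] | X :\: U != set0] :|:
                          [set x in [set a] | X :&: U == set0]).
have X5E : #|X :&: U| + #|X :\: U| <= 5 by rewrite cardsID.
have cond1 (x : W) (c : bool) : #|[set y in [set x] | c]| = c.
  case: c; last by apply: eq_card0 => y; rewrite !inE andbF.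
  by rewrite -[RHS](cards1 x); apply: eq_card => y; rewrite !inE andbT.
have XB5 : #|XB| <= 5.
  rewrite /XB; apply: leq_trans (leq_card_setU _ _) _.
  apply: leq_trans (leq_add (leqnn _) (leq_card_setU _ _)) _; rewrite !cond1.
  by rewrite -!cards_eq0; move: X5E; case: #|_| => [|?]; case: #|_| => [|?] /=; clear; lia.
have XA5 : #|XA| <= 5.
  rewrite /XA; apply: leq_trans (leq_card_setU _ _) _.
  apply: leq_trans (leq_add (leqnn _) (leq_card_setU _ _)) _; rewrite !cond1.
  by rewrite -!cards_eq0; move: X5E; case: #|_| => [|?]; case: #|_| => [|?] /=; clear; lia.
have sXB : XB \subset a |: (V :\: U).
  apply/subsetP => x; rewrite !inE => /or3P [/andP [xU xX]|/andP [-> _] //|/andP [/eqP -> _]].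
    by rewrite xU (subsetP sXV) ?orbT.
  by rewrite bU bV orbT.
have sXA : XA \subset b |: (V :\: ~: U).
  apply/subsetP => x; rewrite !inE negbK => /or3P [/andP [xX xU]|/andP [-> _] //|/andP [/eqP -> _]].
    by rewrite xU (subsetP sXV) ?orbT.
  by rewrite aU aV orbT.
have [DB [zDB evB liB]] := @solve_shrink h t z V X XB m n U a IH adm tri exm szn aU aV c3 VU XB5 sXB.
set C := cut h t U in c3 *.
have CB : cut (shrink U a \o h) (shrink U a \o t) U = C.
  by rewrite cut_comp shrink_preimset aU setUid.
have CA : cut (shrink (~: U) b \o h) (shrink (~: U) b \o t) U = C.
  rewrite cut_comp shrink_preimset (negbTE bU); congr cut.
  by apply/setP => x; rewrite !inE negbK andbb.
have evK : ~~ odd #|DB :&: C| by rewrite -CB; apply: evB.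
have K3 : #|DB :&: C| <= 3 by rewrite -c3 subset_leq_card ?subsetIr.
have [K0|Kn0] := eqVneq (DB :&: C) set0.
  have [X0|Xn0] := eqVneq (X :&: U) set0; last first.
    have /liB : splits U XB.
      apply/splitsP; split; first by exists a; rewrite // /XB !inE eqxx Xn0 orbT.
      have [X'0|/set0Pn [x xX']] := eqVneq (X :\: U) set0.
        by exists b; rewrite // /XB !inE X'0 !eqxx !orbT.
      by exists x; [rewrite /XB inE xX' | move: xX'; rewrite inE => /andP []].
    by rewrite CB K0 eqxx.
  apply: (@glue _ _ h t z U a b set0 DB X set0 XB) => //.
  - by move=> U'; rewrite set0I cards0.
  - by move=> U' /splitsP [[x]]; rewrite inE.
  - by rewrite set0I K0.
  - by rewrite K0 cards0.
  - by rewrite X0.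
  - by rewrite /XB subsetUl.
  - by move/splitsP => [[x xX xU]]; move/setP: X0 => /(_ x); rewrite !inE xX xU.
  - by rewrite inE.
have K2 : #|DB :&: C| = 2.
  by move: Kn0; rewrite -cards_eq0; case: #|_| K3 evK => [|[|[|[|]]]].
have [e3 e3C e3K] : exists2 e, e \in C & e \notin DB.
  have [|] := boolP (C \subset DB); last by move/subsetPn => [e ? ?]; exists e.
  by move/setIidPr => K; move: K2; rewrite K c3.
have CE : DB :&: C = C :\ e3.
  apply/eqP; rewrite eqEcard; apply/andP; split.
    apply/subsetP => e; rewrite !inE => /andP [eB ->]; rewrite andbT.
    by apply: contraTneq eB => ->.
  by rewrite K2; move: c3; rewrite (cardsD1 e3) e3C add1n => [[->]].
have c3' : #|cut h t (~: U)| = 3 by rewrite cutC.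
have bU' : b \in ~: U by rewrite inE.
have VU'' : 1 < #|V :&: ~: U| by rewrite -setDE.
have [DA [zDA evA liA]] :=
  @solve_shrink h t e3 V X XA m n (~: U) b IH adm tri exm szn bU' bV c3' VU'' XA5 sXA.
have evK' : ~~ odd #|DA :&: C| by rewrite -CA; apply: evA.
have sK' : DA :&: C \subset DB :&: C.
  rewrite CE; apply/subsetP => e; rewrite !inE => /andP [eA ->]; rewrite andbT.
  by apply: contraTneq eA => ->.
have [K'0|K'n0] := eqVneq (DA :&: C) set0.
  have [X0|Xn0] := eqVneq (X :\: U) set0; last first.
    have /liA : splits U XA.
      apply/splitsP; split; last by exists b; rewrite // /XA !inE eqxx Xn0 orbT.
      have [X'0|/set0Pn [x xX']] := eqVneq (X :&: U) set0.
        by exists a; rewrite // /XA !inE X'0 !eqxx !orbT.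
      by exists x; [rewrite /XA inE xX' | move: xX'; rewrite inE => /andP []].
    by rewrite CA K'0 eqxx.
  apply: (@glue _ _ h t z U a b DA set0 X XA set0) => //.
  - by move=> U'; rewrite set0I cards0.
  - by move=> U' /splitsP [[x]]; rewrite inE.
  - by rewrite set0I K'0.
  - by rewrite set0I cards0.
  - by rewrite /XA subsetUl.
  - by rewrite X0.
  - by move/splitsP => [_ [x xX xU]]; move/setP: X0 => /(_ x); rewrite !inE xX (negbTE xU).
  - by rewrite (negbTE zU).
  - by rewrite inE.
apply: (@glue _ _ h t z U a b DA DB X XA XB) => //.
- apply/eqP; rewrite eqEcard sK' K2 /=.
  by move: K'n0 evK'; rewrite -cards_eq0; case: #|_| => [|[|]].
- by rewrite K2.
- by rewrite /XA subsetUl.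
- by rewrite /XB subsetUl.
- case/andP => X1 X2; rewrite /XA /XB !inE !eqxx /=.
  by rewrite X1 X2 !orbT.
- by rewrite (negbTE zU).
Qed.

(* Deleting [e] leaves a node of degree 2 only where [e] meets a node of degree 3,
   and such a node is outside [X]. *)
Lemma step_delete h t z V X m n e :
  solvable_below m n -> admissible h t V X -> three_connected h t V ->
  internally_four h t V -> excess h t V <= m -> msize h t V <= n ->
  h e != t e ->
  (forall x, x \in X -> #|cut h t [set x]| = 3 -> e \notin cut h t [set x]) ->
  exists D, good h t z X D.
Proof.
move=> IH [hV sXV X5] tri four exm szn nloop eX.
(* Deleting [e] means making it a loop at [t e]. *)
pose h' x := if x == e then t e else h x.
have cut' U : cut h' t U = cut h t U :\ e.
  apply/setP => x; rewrite !inE /h'; case: eqP => [->|//]; exact: addbb.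
have [|||||||D [zD evD liD]] := @solve h t z V X m n V IH h' t.
- split=> // x; rewrite /h'; have /andP [hx tx] := hV x.
  by case: eqP tx => [->|_] tx; rewrite ?hx tx.
- move=> U spU; rewrite cut'; have c3 := tri _ spU.
  have [lt2|] := ltnP 2 #|cut h t U :\ e|; first by left.
  move: c3; rewrite (cardsD1 e (cut h t U)); case eU: (e \in cut h t U) => c3 le2; last first.
    by move: c3 le2; rewrite add0n; lia.
  right; split; first by lia.
  have c3' : #|cut h t U| = 3 by rewrite (cardsD1 e) eU; lia.
  have [a aV sing] := four U spU c3'; exists a => //; rewrite inE aV andbT.
  apply/negP => aX; have cE : cut h t U = cut h t [set a].
    case: sing => s; last exact: cut_traceC s.
    by apply: cut_trace hV _; rewrite s; apply/setP => x; rewrite !inE andbC;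
      case: eqP => // ->; rewrite aV.
  by have := eX a aX; rewrite -cE eU => /(_ c3').
- by [].
- by [].
- by [].
- by move=> v _; rewrite cut' leq_max subset_leq_card ?orbT // subsetDl.
- rewrite /msize ltn_add2l; apply: proper_card; apply/properP; split.
    by apply/subsetP => x; rewrite !inE /h'; case: (x =P e) => [->|]; rewrite ?eqxx.
  by exists e; rewrite !inE /h' ?eqxx.
have DE U : (D :\ e) :&: cut h t U = D :&: cut h' t U.
  by rewrite cut'; apply/setP => x; rewrite !inE; case: eqP; rewrite ?andbF.
exists (D :\ e); split.
- by rewrite !inE (negbTE zD) andbF.
- by move=> U; rewrite DE.
- by move=> U; rewrite DE; apply: liD.
Qed.

End Steps.

(** * Splitting a node of degree above 3 *)

Section Expand.
Variables (E W : finType) (h t : E -> W) (z : E) (V X : {set W}).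
Variables (v : W) (e1 e2 : E).

(* The vertex [v] is split: the new vertex [None] takes over the [v]-ends of
   [e1] and [e2], and the new edge [None] joins it to [v]. *)
Definition expand_end (k : E -> W) (e : E) : option W :=
  if (e \in [set e1; e2]) && (k e == v) then None else Some (k e).
Definition expand_h (e : option E) : option W :=
  if e is Some e then expand_end h e else Some v.
Definition expand_t (e : option E) : option W :=
  if e is Some e then expand_end t e else None.
Definition expand_set (A : {set W}) : {set option W} := None |: (some @: A).

Lemma mem_some (T : finType) (A : {set T}) x : (Some x \in some @: A) = (x \in A).
Proof. by rewrite mem_imset //; apply: Some_inj. Qed.

Lemma none_some (T : finType) (A : {set T}) : (None \in some @: A) = false.
Proof. by apply/imsetP => [[]]. Qed.

Lemma expand_cut_same (U : {set option W}) :
  (None \in U) = (Some v \in U) ->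
  cut expand_h expand_t U = some @: cut h t (some @^-1: U).
Proof.
move=> Nv; apply/setP => [[e|]]; last by rewrite none_some inE /= Nv addbb.
rewrite mem_some !inE /= /expand_end.
by do 2 case: ifP => [/andP [_ /eqP ->]|_]; rewrite ?Nv.
Qed.

(** The new edge is contracted again: [lift] puts [None] on the side of [v], so this edge is never
    cut. *)
Lemma expand_lift D :
  good expand_h expand_t (Some z) (some @: X) D -> exists D, good h t z X D.
Proof.
move=> [zD evD liD]; exists (some @^-1: D).
pose lift (U : {set W}) : {set option W} := [set x | if x is Some w then w \in U else v \in U].
have liftE U : some @^-1: lift U = U by apply/setP => x; rewrite !inE.
have DE U : some @: ((some @^-1: D) :&: cut h t U) = D :&: cut expand_h expand_t (lift U).
  rewrite expand_cut_same ?liftE; last by rewrite !inE.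
  apply/setP => [[e|]]; rewrite in_setI ?none_some ?andbF // !mem_some in_setI.
  by rewrite [in LHS]inE.
split; first by rewrite inE.
- by move=> U; rewrite -(card_imset _ Some_inj) DE; apply: evD.
move=> U /splitsP [[x xX xU] [y yX yU]].
have /liD : splits (lift U) (some @: X).
  by apply/splitsP; split; [exists (Some x)|exists (Some y)]; rewrite ?mem_some ?inE.
by rewrite -DE imset_eq0.
Qed.

Hypothesis ends : forall e, (h e \in V) && (t e \in V).
Hypotheses (vV : v \in V) (ne : e1 != e2).
Hypotheses (e1v : e1 \in cut h t [set v]) (e2v : e2 \in cut h t [set v]).

Lemma expand_endE e u : e \in cut h t [set v] -> joins h t e v u ->
  e \in [set e1; e2] -> u != v ->
  forall U, (Some e \in cut expand_h expand_t U) = (None \in U) (+) (Some u \in U).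
Proof.
move=> _ /orP [] /andP [/eqP hE /eqP tE] e12 uv U; rewrite inE /= /expand_end e12 hE tE /= eqxx.
  by rewrite (negbTE uv).
by rewrite (negbTE uv) addbC.
Qed.

Lemma expand_other e U : e \notin [set e1; e2] ->
  (Some e \in cut expand_h expand_t U) = (e \in cut h t (some @^-1: U)).
Proof. by move=> e12; rewrite !inE /= /expand_end (negbTE e12). Qed.

(** The new node has at most three edges, while [v] loses [e1] and [e2] and gains only the new
    edge. *)
Lemma expand_excess : 3 < #|cut h t [set v]| ->
  excess expand_h expand_t (expand_set V) < excess h t V.
Proof.
move=> c4; rewrite /excess big_setU1 ?none_some //= big_imset /=; last first.
  by move=> x y _ _ /Some_inj.
have [u1 j1 u1v] : exists2 u, joins h t e1 v u & u != v.
  move: e1v; rewrite !inE /joins; have [hc|hc] := eqVneq (h e1) v => /= te.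
    by exists (t e1); rewrite ?eqxx.
  by exists (h e1); rewrite ?eqxx ?te ?orbT.
have [u2 j2 u2v] : exists2 u, joins h t e2 v u & u != v.
  move: e2v; rewrite !inE /joins; have [hc|hc] := eqVneq (h e2) v => /= te.
    by exists (t e2); rewrite ?eqxx.
  by exists (h e2); rewrite ?eqxx ?te ?orbT.
have e1S : e1 \in [set e1; e2] by rewrite !inE eqxx.
have e2S : e2 \in [set e1; e2] by rewrite !inE eqxx orbT.
have cN : #|cut expand_h expand_t [set None]| <= 3.
  have sub : cut expand_h expand_t [set None] \subset [set None; Some e1; Some e2].
    apply/subsetP => [[e|]]; rewrite ?inE //= /expand_end !inE.
    by rewrite !(inj_eq Some_inj); do 2 case: (e == _).
  by apply: leq_trans (subset_leq_card sub) _; apply: leq_trans (leq_card_setU _ _) _; rewrite cards1 cards2.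
have cv : #|cut expand_h expand_t [set Some v]| < #|cut h t [set v]|.
  have sub : cut expand_h expand_t [set Some v] \subset
             None |: (some @: (cut h t [set v] :\: [set e1; e2])).
    apply/subsetP => [[e|]]; rewrite ?inE //= mem_some inE.
    have [e12|e12] := boolP (e \in [set e1; e2]); last first.
      by rewrite /expand_end (negbTE e12) /= !inE.
    move: (e12); rewrite !inE => /orP [] /eqP ee; subst e.
      by have := @expand_endE _ _ e1v j1 e12 u1v [set Some v]; rewrite !inE /= (inj_eq Some_inj) (negbTE u1v) => ->.
    by have := @expand_endE _ _ e2v j2 e12 u2v [set Some v]; rewrite !inE /= (inj_eq Some_inj) (negbTE u2v) => ->.
  apply: leq_ltn_trans (subset_leq_card sub) _.
  rewrite cardsU1 none_some /= card_imset; last exact: Some_inj.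
  rewrite cardsDS; last by apply/subsetP => e; rewrite !inE => /orP [] /eqP ->; move: e1v e2v; rewrite !inE.
  by rewrite cards2 ne; clear -c4; lia.
have /eqP -> : #|cut expand_h expand_t [set None]| - 3 == 0 by rewrite subn_eq0.
rewrite add0n.
rewrite (bigD1 v) //= [X in _ < X](bigD1 v) //= -addSn.
apply: leq_add; first exact: ltn_sub2r c4 cv.
apply: leq_sum => u /andP [uV uv]; apply: leq_sub2r.
have sub : cut expand_h expand_t [set Some u] \subset some @: cut h t [set u].
  apply/subsetP => [[e|]]; rewrite ?inE //= ?none_some ?mem_some.
    rewrite /expand_end !inE.
    by do 2 case: ifP => [/andP [_ /eqP ->]|_]; rewrite ?(inj_eq Some_inj) ?[v == u]eq_sym ?(negbTE uv).
  by rewrite (inj_eq Some_inj) eq_sym (negbTE uv).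
by apply: leq_trans (subset_leq_card sub) _; rewrite card_imset //; apply: Some_inj.
Qed.

Lemma cardsI2 (T : finType) (A : {set T}) (x y : T) : x != y ->
  #|A :&: [set x; y]| = (x \in A) + (y \in A).
Proof.
move=> xy; rewrite setIUr cardsU -setIIr.
rewrite (_ : [set x] :&: [set y] = set0) ?setI0 ?cards0 ?subn0.
  have c1 u : #|A :&: [set u]| = (u \in A).
    have [uA|uA] := boolP (u \in A).
      by rewrite (setIidPr _) ?cards1 // sub1set.
    by apply: eq_card0 => w; rewrite !inE; case: eqP => [->|]; rewrite ?andbF ?andbT // (negbTE uA).
  by rewrite !c1.
by apply/setP => u; rewrite !inE; case: eqP => // ->; rewrite (negbTE xy).
Qed.

Lemma joins_at (k : E) : k \in cut h t [set v] -> exists2 u, joins h t k v u & u != v.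
Proof.
rewrite !inE /joins; have [hc|hc] := eqVneq (h k) v => /= te.
  by exists (t k); rewrite ?eqxx.
by exists (h k); rewrite ?eqxx ?te ?orbT.
Qed.

(** Only cuts between [None] and [v] are new. Compared with the old cut of [U0], the new edge is
    gained and each of [e1], [e2] is toggled. The count falls below 3 only if both were cut and the
    old cut had size 3. That cut is trivial: at a common neighbour of degree 3, which the last
    hypothesis excludes, or at [v], whose degree is larger. *)
Lemma expand_three : three_connected h t V -> internally_four h t V ->
  3 < #|cut h t [set v]| ->
  (forall u, joins h t e1 v u -> joins h t e2 v u -> #|cut h t [set u]| != 3) ->
  three_connected expand_h expand_t (expand_set V).
Proof.
move=> tri four c4 nobad U spU.
have [Nv|Nv] := eqVneq (None \in U) (Some v \in U).
  rewrite expand_cut_same // card_imset; last exact: Some_inj.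
  apply: tri; case/splitsP: spU => [[x xV xU] [y yV yU]].
  apply/splitsP; split.
    case: x xV xU => [x|_]; first by rewrite !inE /= mem_some => xV xU; exists x; rewrite ?inE.
    by rewrite Nv => vU; exists v; rewrite ?inE.
  case: y yV yU => [y|_]; first by rewrite !inE /= mem_some => yV yU; exists y; rewrite ?inE.
  by rewrite Nv => vU; exists v; rewrite ?inE.
wlog NU : U spU Nv / None \in U.
  move=> wl; have [NU|NU] := boolP (None \in U); first exact: wl.
  rewrite -cutC; apply: wl; rewrite ?splitsC // !in_setC //.
  by move: Nv; do 2 case: (_ \in U).
have vU : Some v \notin U by move: Nv; rewrite NU; case: (_ \in U).
set U0 := some @^-1: U.
have vU0 : v \notin U0 by rewrite inE.
pose S := [set e | Some e \in cut expand_h expand_t U].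
have [u1 j1 u1v] := joins_at e1v; have [u2 j2 u2v] := joins_at e2v.
have e1S : e1 \in [set e1; e2] by rewrite !inE eqxx.
have e2S : e2 \in [set e1; e2] by rewrite !inE eqxx orbT.
have cS : #|cut expand_h expand_t U| = #|S|.+1.
  rewrite (_ : cut _ _ _ = None |: some @: S); last first.
    apply/setP => [[e|]]; first by rewrite in_setU1 mem_some [in RHS]inE.
    by rewrite !inE /= NU (negbTE vU).
  by rewrite cardsU1 none_some card_imset //; apply: Some_inj.
have S12 : #|S :&: [set e1; e2]| = (u1 \notin U0) + (u2 \notin U0).
  rewrite cardsI2 // [e1 \in _]inE [e2 \in _]inE.
  rewrite (expand_endE e1v j1 e1S u1v) (expand_endE e2v j2 e2S u2v).
  by rewrite NU !inE.
have C12 : #|cut h t U0 :&: [set e1; e2]| = (u1 \in U0) + (u2 \in U0).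
  by rewrite cardsI2 // (joins_cut _ j1) (joins_cut _ j2) (negbTE vU0).
have SC : S :\: [set e1; e2] = cut h t U0 :\: [set e1; e2].
  apply/setP => e; rewrite !in_setD; have [//|e12] := boolP (e \in [set _; _]).
  by rewrite /= inE expand_other.
have := cardsID [set e1; e2] S; have := cardsID [set e1; e2] (cut h t U0).
rewrite cS S12 C12 SC => cU0 cS'.
have u1V : u1 \in V.
  by have := ends e1; case/orP: j1 => /andP [/eqP -> /eqP ->] /andP [].
have u2V : u2 \in V.
  by have := ends e2; case/orP: j2 => /andP [/eqP -> /eqP ->] /andP [].
have [V0|Vn0] := eqVneq (V :&: U0) set0.
  have uV u : u \in V -> u \notin U0.
    by move=> uV; have /setP/(_ u) := V0; rewrite in_setI uV in_set0 /= => ->.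
  by move: cS' cU0; rewrite !uV //=; clear; lia.
have spU0 : splits U0 V.
  by rewrite /splits Vn0; apply/set0Pn; exists v; rewrite inE vU0.
have c3 := tri _ spU0.
have [b1|b1] := boolP (u1 \in U0); have [b2|b2] := boolP (u2 \in U0);
  move: cU0 cS' c3; rewrite ?b1 ?b2 ?(negbTE b1) ?(negbTE b2) /=; try (clear; lia).
move=> cU0 cS' c3.
suff : #|cut h t U0| != 3 by move: cU0 cS' c3; clear; lia.
apply/negP => /eqP c3'; have [a aV [s|s]] := four _ spU0 c3'.
  have ua u : u \in V -> u \in U0 -> u = a.
    by move=> uV uU; have /setP/(_ u) := s; rewrite in_setI in_set1 uV uU => /esym/eqP.
  have u1a := ua _ u1V b1; have u2a := ua _ u2V b2; subst u1 u2.
  have /negP := nobad a j1 j2; apply; rewrite -c3'; apply/eqP; congr #|pred_of_set _|.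
  apply: cut_trace ends _; rewrite s; apply/setP => x; rewrite !inE andbC.
  by case: eqP => // ->; rewrite aV.
have va : v = a.
  by have /setP/(_ v) := s; rewrite in_setD in_set1 vU0 vV => /esym/eqP.
by move: c4; rewrite va -(cut_traceC ends s) c3'.
Qed.

End Expand.

Lemma step_expand (E W : finType) (h t : E -> W) z V X m n v :
  solvable_below m n -> admissible h t V X -> three_connected h t V ->
  internally_four h t V -> excess h t V <= m ->
  v \in V -> 3 < #|cut h t [set v]| ->
  exists D, good h t z X D.
Proof.
move=> IH [hV sXV X5] tri four exm vV c4.
have [e1 e1v] : exists e, e \in cut h t [set v] by apply/card_gt0P; lia.
have [u1 j1 u1v] := joins_at e1v.
have u1V : u1 \in V.
  by have := hV e1; case/orP: j1 => /andP [/eqP -> /eqP ->] /andP [].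
have jU k u u' : joins h t k v u -> joins h t k v u' -> u != v -> u' != v -> u = u'.
  move=> /orP [] /andP [/eqP h1 /eqP t1] /orP [] /andP [/eqP h2 /eqP t2] uv u'v.
  - by rewrite -t1 -t2.
  - by move: u'v; rewrite -h2 h1 eqxx.
  - by move: uv; rewrite -h1 h2 eqxx.
  - by rewrite -h1 -h2.
have [e2 [e2v ne bad]] : exists e2, [/\ e2 \in cut h t [set v], e1 != e2 &
    forall u, joins h t e1 v u -> joins h t e2 v u -> #|cut h t [set u]| != 3].
  (* If [u1] has degree 3, one of the more than three edges at [v] does not lead to [u1]; otherwise
     any second edge will do. *)
  have [c3|c3] := eqVneq #|cut h t [set u1]| 3; last first.
    have [e2] : exists e, e \in cut h t [set v] :\ e1.
      by apply/card_gt0P; move: c4; rewrite (cardsD1 e1) e1v; lia.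
    rewrite !inE eq_sym => /andP [ne e2v]; exists e2; split => //; first by rewrite !inE.
    move=> u ju _; have <- // : u1 = u; apply: (jU e1 u1 u) => //.
    by move: e1v; rewrite (joins_cut _ ju) !inE eqxx.
  have /subsetPn [e2 e2v e2u] : ~~ (cut h t [set v] \subset cut h t [set u1]).
    by apply: contraL c4 => /subset_leq_card; rewrite c3 -leqNgt.
  exists e2; split => //.
    by apply: contraNneq e2u => <-; rewrite (joins_cut _ j1) !inE eqxx eq_sym (negbTE u1v).
  move=> u ju ju2; have uv : u != v.
    by move: e1v; rewrite (joins_cut _ ju) !inE eqxx.
  have uu : u1 = u by apply: jU (j1) ju _ _.
  by subst u; move: e2u; rewrite (joins_cut _ ju2) !inE eqxx eq_sym (negbTE u1v).
have [|||D Dg] := IH _ _ (expand_h h v e1 e2) (expand_t t v e1 e2) (Some z)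
                 (expand_set V) (some @: X); last first.
- exact: (expand_lift Dg).
- left; apply: leq_trans exm; exact: expand_excess.
- by apply: three_nearly; apply: expand_three.
split.
- move=> [e|]; last by rewrite !inE mem_some vV.
  have /andP [he te] := hV e.
  by rewrite /= /expand_end; do 2 case: ifP => _; rewrite !inE ?mem_some ?he ?te.
- apply/subsetP => _ /imsetP [x xX ->]; rewrite !inE mem_some.
  exact: (subsetP sXV).
by rewrite card_imset //; apply: Some_inj.
Qed.

(** * The exhaustive search for cubic multigraphs *)

(** The search is evaluated by [vm_compute]: it works on lists of naturals, and uses [if] in place
    of a boolean connective where call by value would compute both operands. *)
Definition ldeg (es : seq (nat * nat)) (i : nat) : nat :=
  count (fun e => eqn e.1 i || eqn e.2 i) es.

Definition lmem (i : nat) (s : seq nat) : bool := has (eqn i) s.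

Definition grow (c : seq nat) (e : nat * nat) : seq nat :=
  if lmem e.1 c then (if lmem e.2 c then c else e.2 :: c)
  else if lmem e.2 c then e.1 :: c else c.

(* Too small a [k] would make [valid] fail, not make it unsound. *)
Definition reach (k : nat) (es : seq (nat * nat)) (c : seq nat) : seq nat :=
  iter k (fun c => foldl grow c es) c.

Definition valid (n : nat) (xs : seq nat) (es : seq (nat * nat)) : bool :=
  all (fun i => ~~ odd (ldeg es i)) (iota 0 n) &&
  (let c := reach 4 es (take 1 xs) in all (fun x => lmem x c) xs).

(* In a cubic multigraph an even subgraph has degree 2 at every node of [xs]. *)
Fixpoint find_even (n : nat) (xs : seq nat) (rest chosen : seq (nat * nat)) : bool :=
  if rest is e :: r then
    if all (fun p => let d := ldeg chosen p in (d <= 2) && (2 <= d + ldeg rest p)) xs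
    then if find_even n xs r (e :: chosen) then true else find_even n xs r chosen
    else false
  else valid n xs chosen.

Fixpoint masks (n : nat) : seq (seq bool) :=
  if n is n'.+1 then
    let s := masks n' in map (cons true) s ++ map (cons false) s
  else [:: [::]].

Definition small_cut (n : nat) (es : seq (nat * nat)) (m : seq bool) : bool :=
  let s := count id m in
  let c := count (fun e => nth false m e.1 (+) nth false m e.2) es in
  ((c <= 2) && (0 < s < n)) || ((c <= 3) && (1 < s) && (s.+1 < n)).

Definition lpair (cl : seq (nat * nat)) (i j : nat) : bool :=
  has (fun e => eqn e.1 i && eqn e.2 j) cl.

(* The multigraph is discovered edge by edge: [ty] tells which of the nodes found
   so far are in [X], [es] lists the edges found besides [z], and all edges
   between a pair in [cl] have been found. A node outside [X] gets no new
   neighbour outside [X]. A branch is closed by an even subgraph as soon as all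
   [nx] nodes of [X] are present, and a complete multigraph without one has a cut
   excluded by [three_connected] or [internally_four]. *)
Fixpoint search (fuel nx : nat) (chk : bool) (ty : seq bool) (z : nat * nat)
    (es cl : seq (nat * nat)) : bool :=
  if fuel is f.+1 then
    let n := size ty in
    let xs := filter (nth false ty) (iota 0 n) in
    if (if chk && eqn (size xs) nx then find_even n xs es [::] else false) then true else
    let es' := z :: es in
    let opn := filter (fun i => ldeg es' i <= 2) (iota 0 n) in
    if filter (fun i => ~~ nth false ty i) opn ++ filter (nth false ty) opn
      is v :: _ then
      if filter (fun w => [&& ~~ eqn w v, nth false ty v || nth false ty w &
                              ~~ lpair cl v w]) opn is w :: _ then
        if search f nx true ty z ((v, w) :: es) ((v, w) :: (w, v) :: cl)
        then search f nx false ty z es ((v, w) :: (w, v) :: cl) else false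
      else
        (if size xs < nx then search f nx true (rcons ty true) z ((v, n) :: es) ((v, n) :: (n, v) :: cl)
         else true) &&
        (if nth false ty v then search f nx true (rcons ty false) z ((v, n) :: es) ((v, n) :: (n, v) :: cl)
         else true)
    else if size xs < nx then true else has (small_cut n es') (masks n)
  else false.

(** The ends of [z] are the nodes 0 and 1; node 0 is taken in [X], since every edge meets [X]. Their
    pair is closed from the start because parallel edges do not occur. The fuel 60 bounds the depth,
    and running out would give [false]. *)
Lemma search_true : all (fun nx => all (fun b =>
  search 60 nx true [:: true; b] (0, 1) [::] [:: (0, 1); (1, 0)]) [:: true; false])
  [:: 2; 3; 4; 5].
Proof. by vm_compute. Qed.

(** * Soundness of the search *)

Section Sound.
Variables (E W : finType) (h t : E -> W) (V X : {set W}) (z : E).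
Hypothesis ends : forall e, (h e \in V) && (t e \in V).
Hypothesis sXV : X \subset V.
Hypothesis cubic : forall v, v \in V -> #|cut h t [set v]| = 3.
Hypothesis cover : forall e, h e != t e -> (h e \in X) || (t e \in X).
Hypothesis tri : three_connected h t V.
Hypothesis four : internally_four h t V.
Hypothesis V3 : 2 < #|V|.

Variable w0 : W.

Definition labels (vs : seq W) (e : E) (p : nat * nat) :=
  [&& joins h t e (nth w0 vs p.1) (nth w0 vs p.2), p.1 < size vs, p.2 < size vs &
      p.1 != p.2].

Lemma joinsC e x y : joins h t e x y = joins h t e y x.
Proof. by rewrite /joins orbC. Qed.

(** Parallel edges would leave [x] and [y] one further edge each, hence at most two edges around the
    pair, although a third node exists. *)
Lemma no_parallel e e' x y : x \in V -> y \in V -> x != y ->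
  joins h t e x y -> joins h t e' x y -> e' = e.
Proof.
move=> xV yV xy je je'; apply/eqP/negPn/negP => ne.
have sp : splits [set x; y] V.
  apply/splitsP; split; first by exists x; rewrite ?inE ?eqxx.
  have /subsetPn [w wV wxy] : ~~ (V \subset [set x; y]).
    by apply: contraL V3 => /subset_leq_card; rewrite cards2 xy -leqNgt.
  by exists w.
have := tri sp.
have sub : cut h t [set x; y] \subset
           (cut h t [set x] :\: [set e; e']) :|: (cut h t [set y] :\: [set e; e']).
  apply/subsetP => d dU.
  have dxy : d \notin [set e; e'].
    rewrite !inE; apply/negP => /orP [] /eqP de; subst d.
      by move: dU; rewrite (joins_cut _ je) !inE !eqxx orbT.
    by move: dU; rewrite (joins_cut _ je') !inE !eqxx orbT.
  move: dU; rewrite in_setU !(in_setD _ _ d) dxy /= !inE.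
  by do 4 case: (_ == _).
move/leq_trans/(_ (subset_leq_card sub)).
have c1 u v : joins h t e u v -> joins h t e' u v -> u \in V -> u != v ->
    #|cut h t [set u] :\: [set e; e']| = 1.
  move=> ju ju' uV uv; rewrite cardsD cubic // cardsI2 1?eq_sym //.
  by rewrite (joins_cut _ ju) (joins_cut _ ju') !inE eqxx eq_sym (negbTE uv).
have := leq_card_setU (cut h t [set x] :\: [set e; e']) (cut h t [set y] :\: [set e; e']).
rewrite (c1 x y) // (c1 y x) // ?[joins _ _ _ y x]joinsC // 1?eq_sym //.
by move=> le1 /leq_trans /(_ le1).
Qed.

Lemma labels_cut vs e p i : uniq vs -> labels vs e p -> i < size vs ->
  (e \in cut h t [set nth w0 vs i]) = eqn p.1 i || eqn p.2 i.
Proof.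
move=> uvs /and4P [je p1 p2 p12] ilt; rewrite (joins_cut _ je) !inE !nth_uniq //.
rewrite !eqnE; case: (p.1 =P i) p12 => [->|_]; case: (p.2 =P i) => [->|_] //.
by rewrite eqxx.
Qed.

Lemma labels_deg vs es ps i : uniq vs -> all2 (labels vs) es ps -> i < size vs ->
  count [in cut h t [set nth w0 vs i]] es = ldeg ps i.
Proof.
move=> uvs; elim: es ps => [|e es IH] [|p ps] //= /andP [le les] ilt.
by rewrite (IH ps) // (labels_cut uvs le ilt).
Qed.

Lemma count_card (T : finType) (P : pred T) (es : seq T) : uniq es ->
  count P es = #|[set e in es | P e]|.
Proof.
move=> ues; rewrite -size_filter -(card_uniqP _) ?filter_uniq //.
by apply: eq_card => e; rewrite !inE mem_filter andbC.
Qed.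

(** This ties a search state to the multigraph: node [i] stands for [nth w0 vs i], and the edges
    [es] carry the labels [ps]. The last clause gives [cl] its meaning. *)
Definition realizes (ty : seq bool) (ps cl : seq (nat * nat)) (vs : seq W) (es : seq E) :=
  [/\ uniq vs, {subset vs <= V}, ty = map [in X] vs &
      [/\ uniq es, all2 (labels vs) es ps &
      forall i j e, lpair cl i j -> i < size vs -> j < size vs ->
        joins h t e (nth w0 vs i) (nth w0 vs j) -> e \in es]].

Definition closed_under (S : pred nat) (ps : seq (nat * nat)) :=
  all (fun p => S p.1 == S p.2) ps.

Lemma lmemE i s : lmem i s = (i \in s).
Proof. by elim: s => //= j s ->; rewrite inE. Qed.

(** Soundness rests on this direction alone: [reach] never leaves a set of nodes that no edge
    leaves, whatever the number of rounds. *)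
Lemma reach_closed (S : pred nat) k ps c :
  closed_under S ps -> all S c -> all S (reach k ps c).
Proof.
move=> Sps Sc; rewrite /reach; elim: k => //= k; move: (iter _ _ _) => {}c {}Sc.
elim: ps Sps c Sc => //= p ps IH /andP [/eqP Sp Sps] c Sc; apply: IH => //.
rewrite /grow !lmemE; case: ifP => pc; case: ifP => p'c //=; rewrite Sc andbT.
  by rewrite -Sp (allP Sc).
by rewrite Sp (allP Sc).
Qed.

Lemma find_even_sound n xs rest chosen vs (er ec : seq E) :
  find_even n xs rest chosen -> uniq (er ++ ec) ->
  all2 (labels vs) er rest -> all2 (labels vs) ec chosen ->
  exists ed pd, [/\ valid n xs pd, uniq ed, all2 (labels vs) ed pd &
                   {subset ed <= er ++ ec}].
Proof.
elim: rest chosen er ec => [|p r IH] chosen [|e er] ec //=.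
  by move=> v u _ lc; exists ec, chosen; split.
case: ifP => // _; case: ifP => [fe _|_ fe] /andP [eN u] /andP [le ler] lec.
  have uE : uniq (er ++ e :: ec) by rewrite -[e :: ec]cat1s uniq_catCA /= eN.
  have lE : all2 (labels vs) (e :: ec) (p :: chosen) by rewrite /= le.
  have [ed [pd [v ued led sub]]] := IH _ er (e :: ec) fe uE ler lE.
  exists ed, pd; split=> // x /sub; rewrite !mem_cat !inE !mem_cat.
  by case/or3P => ->; rewrite ?orbT.
have [ed [pd [v ued led sub]]] := IH _ er ec fe u ler lec.
by exists ed, pd; split => // x /sub; rewrite inE => ->; rewrite orbT.
Qed.

Lemma labels_ends vs es ps e : all2 (labels vs) es ps -> e \in es ->
  exists2 p, p \in ps & labels vs e p.
Proof.
elim: es ps => [|e' es IH] [|p ps] //= /andP [le les]; rewrite inE => /predU1P [->|/(IH _ les) [q qps lq]].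
  by exists p; rewrite ?mem_head.
by exists q; rewrite // inE qps orbT.
Qed.

Lemma labels_edges vs es ps p : all2 (labels vs) es ps -> p \in ps ->
  exists2 e, e \in es & labels vs e p.
Proof.
elim: es ps => [|e' es IH] [|q ps] //= /andP [le les]; rewrite inE => /predU1P [->|/(IH _ les) [e ees lq]].
  by exists e'; rewrite ?mem_head.
by exists e; rewrite // inE ees orbT.
Qed.

(** Unlabelled nodes meet no edge of [ed]. If a [U] splitting [X] were crossed by no edge, its
    labels and their complement would both be closed, and [reach] could not pass from one to the
    other. *)
Lemma valid_sound vs pd ed (z' : E) :
  uniq vs -> {subset X <= vs} ->
  valid (size vs) (filter (nth false (map [in X] vs)) (iota 0 (size vs))) pd ->
  uniq ed -> all2 (labels vs) ed pd -> z' \notin ed -> good h t z' X [set e in ed].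
Proof.
move=> uvs Xvs /andP [/allP ev /= con] ued led zed; split; first by rewrite inE.
  apply: even_set1 => x.
  have -> : #|[set e in ed] :&: cut h t [set x]| = count [in cut h t [set x]] ed.
    by rewrite count_card //; apply: eq_card => e; rewrite !inE.
  have [xvs|xvs] := boolP (x \in vs).
    rewrite -(nth_index w0 xvs) (labels_deg uvs led) ?index_mem //.
    by apply: ev; rewrite mem_iota add0n index_mem.
  rewrite (eq_in_count (a2 := pred0)) ?count_pred0 // => e eed.
  have [p _ /and4P [je p1 p2 _]] := labels_ends led eed.
  rewrite (joins_cut _ je) !inE.
  have ne i : i < size vs -> nth w0 vs i == x = false.
    by move=> ilt; apply/negbTE; apply: contra xvs => /eqP <-; apply: mem_nth.
  by rewrite !ne.
move=> U /splitsP [[x xX xU] [y yX yU]]; apply/negP => /eqP D0.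
pose S := [pred i | nth w0 vs i \in U].
have clS : closed_under S pd.
  apply/allP => p pps; have [e eed /and4P [je p1 p2 _]] := labels_edges led pps.
  have /setP/(_ e) := D0; rewrite in_setI (joins_cut _ je) !inE eed /=.
  by do 2 case: (_ \in U).
have clS' : closed_under (predC S) pd.
  by apply: sub_all clS => p /eqP /= ->.
set xs := filter _ _ in con.
have ixs u : u \in X -> index u vs \in xs.
  move=> uX; rewrite mem_filter mem_iota add0n index_mem Xvs //= andbT.
  by rewrite (nth_map w0) ?index_mem ?Xvs // nth_index ?Xvs.
have xix := ixs _ xX; have yiy := ixs _ yX.
case: xs {ixs} con xix yiy => // i0 xs con xix yiy.
have reachS (S' : pred nat) : closed_under S' pd -> S' i0 -> forall i, i \in i0 :: xs -> S' i.
  move=> cl S0 i ixs'; have /allP H : all S' (reach 4 pd [:: i0]).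
    by apply: reach_closed => //=; rewrite S0.
  by apply: H; rewrite -lmemE; have := allP con i ixs'; rewrite /= take0.
have [S0|S0] := boolP (S i0).
  have := reachS _ clS S0 _ yiy; rewrite /= nth_index ?Xvs //.
  by rewrite (negbTE yU).
by have := reachS _ clS' S0 _ xix; rewrite /= nth_index ?Xvs // xU.
Qed.

Lemma open_edge vs es ps i : uniq vs -> {subset vs <= V} -> uniq es ->
  all2 (labels vs) es ps -> i < size vs ->
  (ldeg ps i <= 2) = [exists e, (e \in cut h t [set nth w0 vs i]) && (e \notin es)].
Proof.
move=> uvs sV ues les ilt; rewrite -(labels_deg uvs les ilt) count_card //.
have c3 := cubic (sV _ (mem_nth w0 ilt)); set C := cut _ _ _ in c3 *.
have sub : [set e in es | e \in C] \subset C by apply/subsetP => e; rewrite inE => /andP [].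
apply/idP/existsP => [lt2|[e /andP [eC ees]]].
  have /subsetPn [e eC ees] : ~~ (C \subset [set e in es | e \in C]).
    by apply: contraL lt2 => /subset_leq_card; rewrite c3 -ltnNge.
  by exists e; move: ees; rewrite inE eC andbT.
rewrite -ltnS -c3; apply: proper_card; apply/properP; split=> //.
by exists e; rewrite // inE (negbTE ees).
Qed.

Lemma size_filter_nth (P : pred W) vs :
  size (filter (nth false (map P vs)) (iota 0 (size vs))) = count P vs.
Proof.
rewrite size_filter -[RHS](count_map P id) -[in RHS](mkseq_nth false (map P vs)).
by rewrite size_map count_map.
Qed.

Lemma count_sub vs : uniq vs -> (count [in X] vs < #|X|) = ~~ (X \subset [set x in vs]).
Proof.
move=> uvs; rewrite count_card //.
have sub : [set x in vs | x \in X] \subset X by apply/subsetP => x; rewrite inE => /andP [].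
apply/idP/idP => [|/subsetPn [x xX xvs]].
  apply: contraL => /subsetP sX; rewrite -leqNgt; apply/subset_leq_card/subsetP => x xX.
  by rewrite inE xX andbT; have := sX x xX; rewrite inE.
apply: proper_card; apply/properP; split=> //; exists x => //.
by apply: contra xvs; rewrite !inE => /andP [].
Qed.

Lemma all2_impl (A B : Type) (P Q : A -> B -> bool) s s' :
  (forall a b, P a b -> Q a b) -> all2 P s s' -> all2 Q s s'.
Proof. by move=> PQ; elim: s s' => [|a s IH] [|b s'] //= /andP [/PQ -> /IH]. Qed.

Lemma size_masks n m : m \in masks n -> size m = n.
Proof.
elim: n m => [|n IH] m /=; first by rewrite inE => /eqP ->.
by rewrite mem_cat => /orP [] /mapP [m' /IH <- ->].
Qed.

Lemma lpair_cons2 cl v w i j : lpair [:: (v, w), (w, v) & cl] i j ->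
  [\/ i = v /\ j = w, i = w /\ j = v | lpair cl i j].
Proof.
rewrite /lpair /= => /or3P [/andP [/eqP <- /eqP <-]|/andP [/eqP <- /eqP <-]|H];
  [exact: Or31 | exact: Or32 | exact: Or33].
Qed.

Lemma joins_loop e x y : joins h t e x y -> x != y -> h e != t e.
Proof. by case/orP => /andP [/eqP -> /eqP ->] //; rewrite eq_sym. Qed.

Lemma realizes_close ty ps cl vs es v w : realizes ty ps cl vs es ->
  v < size vs -> w < size vs ->
  (forall e, joins h t e (nth w0 vs v) (nth w0 vs w) -> e \in es) ->
  realizes ty ps [:: (v, w), (w, v) & cl] vs es.
Proof.
move=> [uvs sV tyE [ues les clP]] vlt wlt H; split=> //; split=> // i j e.
case/lpair_cons2 => [[-> ->]|[-> ->]|] ilt jlt; [exact: H| |exact: clP].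
by rewrite joinsC; exact: H.
Qed.

Lemma realizes_edge ty ps cl vs es v w e : realizes ty ps cl vs es ->
  v < size vs -> w < size vs -> v != w -> e \notin es ->
  joins h t e (nth w0 vs v) (nth w0 vs w) ->
  realizes ty ((v, w) :: ps) cl vs (e :: es).
Proof.
move=> [uvs sV tyE [ues les clP]] vlt wlt vw ees je; split=> //; split=> /=.
- by rewrite ees.
- by rewrite /labels je vlt wlt vw.
- by move=> i j e' ij ilt jlt je'; rewrite inE (clP i j) ?orbT.
Qed.

Lemma realizes_vertex ty ps cl vs es u : realizes ty ps cl vs es ->
  u \in V -> u \notin vs ->
  all (fun p => (p.1 < size vs) && (p.2 < size vs)) cl ->
  realizes (rcons ty (u \in X)) ps cl (rcons vs u) es.
Proof.
move=> [uvs sV -> [ues les clP]] uV uvs' bcl; split.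
- by rewrite rcons_uniq uvs'.
- by move=> x; rewrite mem_rcons inE => /predU1P [->|/sV].
- by rewrite map_rcons.
split=> //.
  apply: all2_impl les => e p /and4P [je p1 p2 p12].
  by rewrite /labels !nth_rcons p1 p2 je p12 size_rcons !ltnS (ltnW p1) (ltnW p2).
move=> i j e ij; have /hasP [p /(allP bcl) /andP [p1 p2] /andP [/eqP pi /eqP pj]] := ij.
move: p1 p2; rewrite pi pj => ilt jlt _ _; rewrite !nth_rcons ilt jlt.
exact: clP ij ilt jlt.
Qed.

(** The branches exhaust the possibilities for an undiscovered edge at the open node [v]: it may
    lead to a candidate [w], present or absent in the two recursive calls, and when no candidate is
    left it leads to a new node. By [cover] the new node is in [X] whenever [v] is not. *)
Lemma search_sound f chk ty ps cl vs es zz :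
  search f #|X| chk ty zz ps cl -> realizes ty (zz :: ps) cl vs (z :: es) ->
  all (fun p => (p.1 < size vs) && (p.2 < size vs)) cl ->
  exists D, good h t z X D.
Proof.
elim: f chk ty ps cl vs es => //= f IH chk ty ps cl vs es.
move=> + rea bcl; have [uvs sV tyE [ues les clP]] := rea.
have tysz : size ty = size vs by rewrite tyE size_map.
have tyn i : i < size vs -> nth false ty i = (nth w0 vs i \in X).
  by move=> ilt; rewrite tyE (nth_map w0).
have /= /andP [zes ues'] := ues; have /andP [lz les'] := les.
have szxs : size (filter (nth false ty) (iota 0 (size ty))) = count [in X] vs.
  by rewrite tysz tyE size_filter_nth.
rewrite szxs; have csub := count_sub uvs.
case: ifP => [|_].
  case: ifP => // /andP [_ /eqP cX] fe _.
  have uesn : uniq (es ++ [::]) by rewrite cats0.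
  have lesn : all2 (labels vs) es ps := les'.
  have [ed [pd [v ued led sub]]] :=
    find_even_sound fe uesn lesn (isT : all2 (labels vs) [::] [::]).
  exists [set e in ed]; apply: (@valid_sound vs pd) => //.
  - move: csub; rewrite cX ltnn => /esym/negPn/subsetP H x /H; by rewrite inE.
  - by move: v; rewrite tysz tyE.
  by apply/negP => /sub; rewrite cats0; apply/negP.
set opn := filter _ (iota _ _).
have opnP i : (i \in opn) = (i < size vs) &&
    [exists e, (e \in cut h t [set nth w0 vs i]) && (e \notin z :: es)].
  rewrite mem_filter mem_iota add0n tysz andbC /=; case ilt: (i < size vs) => //=.
  by rewrite -(open_edge uvs sV ues les ilt).
have perm : filter (fun i => ~~ nth false ty i) opn ++ filter (nth false ty) opn =i opn.
  by move=> i; rewrite mem_cat !mem_filter -andb_orl orNb.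
case: (filter _ opn ++ _) perm => [|v vr] perm.
  (* No node is open, so every edge at a found node has been found. *)
  have clV e i : i < size vs -> e \in cut h t [set nth w0 vs i] -> e \in z :: es.
    move=> ilt ei; have := perm i; rewrite inE opnP ilt /= => /esym/existsP H.
    by apply/negPn/negP => ees; apply: H; exists e; rewrite ei.
  have vs0 : 0 < size vs by case/and4P: lz => _; case: (vs).
  case: ifP => [cX _|_].
    (* If a node of [X] were missing, the found nodes would have an empty cut. *)
    move: cX; rewrite csub => /subsetPn [x xX xvs].
    have sp : splits [set y in vs] V.
      apply/splitsP; split; last by exists x; rewrite // (subsetP sXV).
      by exists (nth w0 vs 0); rewrite ?inE ?mem_nth ?sV ?mem_nth.
    have [e eU] : exists e, e \in cut h t [set y in vs].
      by apply/card_gt0P; apply: leq_trans (tri sp).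
    suff ees : e \in z :: es.
      have [p _ /and4P [je p1 p2 _]] := labels_ends les ees.
      by move: eU; rewrite (joins_cut _ je) !inE !mem_nth.
    move: (eU); rewrite inE !in_set; case hvs: (h e \in vs) => /= tvs.
      apply: (clV e (index (h e) vs)); rewrite ?index_mem // nth_index // !inE eqxx.
      by apply: contra tvs => /eqP ->.
    apply: (clV e (index (t e) vs)); rewrite ?index_mem // nth_index // !inE eqxx addbT.
    by apply: contraFN hvs => /eqP ->.
  move=> /hasP [m mm sm]; exfalso.
  have szm := size_masks mm; rewrite tysz in szm.
  pose U := [set x in mask m vs].
  have memU i : i < size vs -> (nth w0 vs i \in U) = nth false m i.
    by move=> ilt; rewrite inE in_mask // mem_nth //= index_uniq.
  have sUvs x : x \in U -> x \in vs by rewrite inE; apply: mem_mask.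
  have cardU : #|V :&: U| = count id m.
    rewrite (setIidPr _); last by apply/subsetP => x /sUvs /sV.
    by rewrite -(size_mask szm) -(card_uniqP (mask_uniq uvs m)); apply: eq_card => x; rewrite inE.
  have cardU' : size vs - count id m <= #|V :\: U|.
    have -> : size vs = #|[set x in vs]|.
      by rewrite -(card_uniqP uvs); apply: eq_card => x; rewrite inE.
    have <- : #|[set x in vs] :&: U| = count id m.
      rewrite -cardU; apply: eq_card => x; rewrite !in_setI.
      by case xU: (x \in U); rewrite ?andbF // inE sUvs ?sV ?sUvs.
    rewrite -cardsD; apply/subset_leq_card/setSD/subsetP => x; rewrite inE; exact: sV.
  have cutU : #|cut h t U| <= count (fun e => nth false m e.1 (+) nth false m e.2) (zz :: ps).
    have <- : count [in cut h t U] (z :: es) =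
              count (fun e => nth false m e.1 (+) nth false m e.2) (zz :: ps).
      move: les; elim: (z :: es) (zz :: ps) => [|e es1 IHe] [|p ps1] // /andP [le les1].
      have /and4P [je p1 p2 _] := le.
      by rewrite /= (IHe _ les1) (joins_cut _ je) !memU.
    rewrite count_card //; apply/subset_leq_card/subsetP => e eU; rewrite inE eU andbT.
    have outE x y : x \in U -> y \notin U -> joins h t e x y -> e \in z :: es.
      move=> xU yU je; apply: (clV e (index x vs)); rewrite ?index_mem ?sUvs // nth_index ?sUvs //.
      rewrite (joins_cut _ je) !inE eqxx; case: eqP yU => // ->; by rewrite xU.
    move: eU; rewrite inE; case hU: (h e \in U); case tU: (t e \in U) => // _.
      by apply: (outE (h e) (t e)); rewrite ?hU ?tU // /joins !eqxx.
    by apply: (outE (t e) (h e)); rewrite ?hU ?tU // /joins !eqxx orbT.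
  have spl : 0 < count id m -> count id m < size vs -> splits U V.
    move=> s0 sn; rewrite /splits -!card_gt0 cardU s0 /=.
    by apply: leq_trans cardU'; rewrite subn_gt0.
  move: sm; rewrite /small_cut tysz => /orP [/and3P [c2 s0 sn]|/andP [/andP [c3 s1] sn]].
    by have := tri (spl s0 sn); rewrite ltnNge (leq_trans cutU c2).
  have sp : splits U V by apply: spl; [apply: ltnW | apply: ltnW].
  have cU3 : #|cut h t U| = 3.
    by apply/eqP; rewrite eqn_leq (leq_trans cutU c3) tri.
  have [a aV [sing|sing]] := four sp cU3.
    by move: s1; rewrite -cardU sing cards1.
  by move: cardU'; rewrite sing cards1 leqNgt ltn_subRL addn1 sn.
have vopn : v \in opn by rewrite -perm mem_head.
have := vopn; rewrite opnP => /andP [vlt /existsP [e0 /andP [e0v e0es]]].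
pose ok w := [&& ~~ eqn w v, nth false ty v || nth false ty w & ~~ lpair cl v w].
have vW := sV _ (mem_nth w0 vlt).
have [u ju uv] := joins_at e0v.
have uV : u \in V.
  by have := ends e0; case/orP: ju => /andP [/eqP -> /eqP ->] /andP [].
have okP e w : w < size vs -> e \notin z :: es ->
    joins h t e (nth w0 vs v) (nth w0 vs w) -> nth w0 vs w != nth w0 vs v -> ok w && (w \in opn).
  move=> wlt ees je nvw; rewrite opnP wlt /= andbC; apply/andP; split.
    by apply/existsP; exists e; rewrite ees (joins_cut _ je) !inE eqxx eq_sym (negbTE nvw).
  apply/and3P; split.
  - by rewrite eqnE; apply: contraNneq nvw => ->.
  - rewrite !tyn //; have := cover (joins_loop je _); rewrite eq_sym nvw => /(_ isT).
    by case/orP: je => /andP [/eqP -> /eqP ->] //; rewrite orbC.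
  - by apply: contra ees => vw; apply: clP vw vlt wlt je.
have : filter ok opn =i [pred w | ok w & w \in opn] by move=> w; rewrite mem_filter.
rewrite -/ok; case: (filter ok opn) => [|w wr] okE.
  have uvs' : u \notin vs.
    apply/negP => uin; have := okE (index u vs).
    rewrite inE in_nil (okP e0) ?index_mem ?nth_index //.
  have bcl' : all (fun p => (p.1 < size (rcons vs u)) && (p.2 < size (rcons vs u)))
                [:: (v, size vs), (size vs, v) & cl].
    rewrite /= size_rcons !ltnS leqnn (ltnW vlt) /=.
    by apply: sub_all bcl => p /andP [p1 p2]; rewrite !ltnS (ltnW p1) (ltnW p2).
  have rea' : realizes (rcons ty (u \in X)) ((v, size vs) :: zz :: ps)
      [:: (v, size vs), (size vs, v) & cl] (rcons vs u) (e0 :: z :: es).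
    have nv : nth w0 (rcons vs u) v = nth w0 vs v by rewrite nth_rcons vlt.
    have nu : nth w0 (rcons vs u) (size vs) = u by rewrite nth_rcons ltnn eqxx.
    apply: realizes_close; rewrite ?size_rcons ?ltnS ?(ltnW vlt) //.
      apply: realizes_edge; rewrite ?size_rcons ?ltnS ?(ltnW vlt) ?nv ?nu //.
        exact: realizes_vertex.
      by rewrite neq_ltn vlt.
    move=> e; rewrite nv nu => je; rewrite inE.
    by rewrite (no_parallel vW uV _ ju je) ?eqxx // eq_sym.
  (* The label of [z] has to stay at the head, where [search] puts it. *)
  have rea'' : realizes (rcons ty (u \in X)) (zz :: (v, size vs) :: ps)
      [:: (v, size vs), (size vs, v) & cl] (rcons vs u) (z :: e0 :: es).
    move: rea' => [? ? ? [ue le cl']]; split=> //; split.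
    - by move: ue; rewrite /= !inE !negb_or eq_sym => /andP [/andP [-> ->] /andP [-> ->]].
    - by move: le => /= /and3P [-> -> ->].
    - by move=> i j e ij il jl je; have := cl' i j e ij il jl je; rewrite !inE orbCA.
  rewrite tysz; case uX: (u \in X) rea'' => rea''.
    case: ifP => [_ /andP [H _]|]; first exact: IH H rea'' bcl'.
    rewrite csub => /negbT/negPn/subsetP/(_ u uX); rewrite inE.
    by rewrite (negbTE uvs').
  have vX : nth false ty v.
    rewrite tyn //; have := cover (joins_loop ju _); rewrite eq_sym uv => /(_ isT).
    by case/orP: ju => /andP [/eqP -> /eqP ->]; rewrite uX ?orbF.
  by rewrite vX => /andP [_ H]; exact: IH H rea'' bcl'.
have /andP [/and3P [wv tvw clvw] wopn] : ok w && (w \in opn).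
  by have := okE w; rewrite mem_head => /esym.
have := wopn; rewrite opnP => /andP [wlt _].
have vw : v != w by rewrite eq_sym -eqnE.
have bcl' : all (fun p => (p.1 < size vs) && (p.2 < size vs)) [:: (v, w), (w, v) & cl].
  by rewrite /= vlt wlt.
case: ifP => // H1 H2.
have [/existsP [e /andP [je ees]]|nex] :=
  boolP [exists e, joins h t e (nth w0 vs v) (nth w0 vs w) && (e \notin z :: es)]; last first.
  apply: (IH _ _ _ _ _ es H2 _ bcl'); apply: realizes_close => // e je.
  by apply/negPn/negP => ees; case/negP: nex; apply/existsP; exists e; rewrite je.
apply: (IH _ _ _ _ _ (e :: es) H1 _ bcl').
have rea' : realizes ty ((v, w) :: zz :: ps) [:: (v, w), (w, v) & cl] vs (e :: z :: es).
  apply: realizes_close => //; first exact: realizes_edge.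
  move=> e' je'; rewrite inE.
  by rewrite (no_parallel vW (sV _ (mem_nth w0 wlt)) _ je je') ?eqxx // nth_uniq.
move: rea' => [? ? ? [ue le cl']]; split=> //; split.
- by move: ue; rewrite /= !inE !negb_or eq_sym => /andP [/andP [-> ->] /andP [-> ->]].
- by move: le => /= /and3P [-> -> ->].
- by move=> i j e' ij il jl je'; have := cl' i j e' ij il jl je'; rewrite !inE orbCA.
Qed.

End Sound.

(** * Base cases and the induction for even subgraphs *)

Lemma splits_card (W : finType) (U V : {set W}) : splits U V -> 1 < #|V|.
Proof.
move=> /andP []; rewrite -!card_gt0 -(cardsID U V); case: #|_| => // n _.
by case: #|_| => // k _; rewrite addSn addnS.
Qed.

Lemma good_trivial (E W : finType) (h t : E -> W) z (X : {set W}) :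
  #|X| <= 1 -> good h t z X set0.
Proof.
move=> X1; split; first by rewrite inE.
  by move=> U; rewrite set0I cards0.
by move=> U /splits_card; rewrite ltnNge X1.
Qed.

(** With two nodes every splitting cut is the cut at [u], of size 3, and two of its edges other than
    [z] form the even set. The case stands apart from the search because here parallel edges do
    occur. *)
Lemma good_two (E W : finType) (h t : E -> W) z (V X : {set W}) :
  (forall e, (h e \in V) && (t e \in V)) -> #|V| <= 2 -> X \subset V -> 1 < #|X| ->
  (forall v, v \in V -> #|cut h t [set v]| = 3) -> exists D, good h t z X D.
Proof.
move=> hV V2 sXV X2 cubic.
have [u uV] : exists u, u \in V.
  by apply/card_gt0P; apply: leq_trans (subset_leq_card sXV); apply: ltnW.
have [z' z'u zz'] : exists2 z', z' \in cut h t [set u] &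
    z \in cut h t [set u] -> z = z'.
  have [zu|_] := boolP (z \in cut h t [set u]); first by exists z.
  by have /card_gt0P [e eu] : 0 < #|cut h t [set u]|; [rewrite cubic | exists e].
have cutE U : splits U V -> cut h t U = cut h t [set u].
  wlog uU : U / u \in U.
    move=> wl; have [uU|uU] := boolP (u \in U); first exact: wl.
    by rewrite -splitsC -cutC; apply: wl; rewrite inE.
  move=> sp; apply: cut_trace hV _; apply/eqP; rewrite eq_sym eqEcard.
  rewrite subsetI subsetIl /= (subset_trans (subsetIr _ _)) ?sub1set //=.
  have -> : V :&: [set u] = [set u] by apply/setIidPr; rewrite sub1set.
  rewrite cards1; case/andP: sp => _; rewrite -card_gt0.
  by move: V2; rewrite -(cardsID U V); case: #|V :\: U| => // n; rewrite addnS; case: #|_| => [|[]].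
have D2 : #|cut h t [set u] :\ z'| = 2.
  by have := cubic u uV; rewrite (cardsD1 z') z'u add1n => [[->]].
exists (cut h t [set u] :\ z'); split.
- rewrite !inE; apply/negP => /andP [nzz' zu]; case/negP: nzz'.
  by apply/eqP/zz'; rewrite !inE.
- move=> U; have [/cutE ->|] := boolP (splits U V).
    by rewrite (setIidPl _) ?D2 // subsetDl.
  rewrite negb_and !negbK => /orP [] /eqP V0.
    by rewrite (cut_disjoint0 hV V0) setI0 cards0.
  have -> : cut h t U = set0 by rewrite -cutC; apply: cut_disjoint0 hV _; rewrite -setDE.
  by rewrite setI0 cards0.
- move=> U /splitsP [[x xX xU] [y yX yU]]; rewrite cutE; last first.
    by apply/splitsP; split; [exists x|exists y] => //; apply: (subsetP sXV).
  by rewrite (setIidPl _) ?subsetDl // -cards_eq0 D2.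
Qed.

Lemma good_cubic (E W : finType) (h t : E -> W) z (V X : {set W}) :
  admissible h t V X -> 1 < #|X| -> three_connected h t V -> internally_four h t V ->
  (forall v, v \in V -> #|cut h t [set v]| = 3) ->
  (forall e, h e != t e -> (h e \in X) || (t e \in X)) ->
  exists D, good h t z X D.
Proof.
move=> [hV sXV X5] X2 tri four cubic cover.
have [V2|V3] := leqP #|V| 2; first exact: good_two hV V2 sXV X2 cubic.
have [x0 x0X] : exists x, x \in X by apply/card_gt0P; apply: ltnW.
(* The search needs an avoided edge with distinct ends; if [z] is a loop, an edge at a node of [X]
   takes its place. *)
have [z0 nl zz0] : exists2 z0, h z0 != t z0 & h z != t z -> z0 = z.
  have [nl|lz] := boolP (h z != t z); first by exists z.
  have /card_gt0P [e] : 0 < #|cut h t [set x0]| by rewrite cubic // (subsetP sXV).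
  rewrite !inE => ex; exists e => //; apply: contraTneq ex => ->.
  by rewrite addbb.
have [x [y [xX yV xy jxy]]] : exists x y, [/\ x \in X, y \in V, x != y & joins h t z0 x y].
  have /andP [hz tz] := hV z0.
  case/orP: (cover _ nl) => zX.
    by exists (h z0), (t z0); rewrite /joins !eqxx.
  by exists (t z0), (h z0); rewrite /joins !eqxx orbT eq_sym.
have srch : search 60 #|X| true [:: true; y \in X] (0, 1) [::] [:: (0, 1); (1, 0)].
  have /allP/(_ #|X|) := search_true; rewrite !inE.
  have -> : [|| #|X| == 2, #|X| == 3, #|X| == 4 | #|X| == 5].
    by move: X2 X5; case: #|X| => [|[|[|[|[|[|]]]]]].
  by move=> /(_ isT) /allP; apply; case: (y \in X); rewrite !inE.
have xV := subsetP sXV x xX.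
have rea : realizes h t V X x [:: true; y \in X] [:: (0, 1)] [:: (0, 1); (1, 0)]
    [:: x; y] [:: z0].
  split; first by rewrite /= inE xy.
  - by move=> w; rewrite !inE => /orP [] /eqP ->.
  - by rewrite /= xX.
  split; [by [] | by rewrite /labels /= jxy |].
  have par e : joins h t e x y -> e \in [:: z0].
    by move=> je; rewrite inE (no_parallel cubic tri V3 xV yV xy jxy je) eqxx.
  move=> i j e /lpair_cons2 [[-> ->]|[-> ->]|] //= _ _; first exact: par.
  by rewrite joinsC; exact: par.
have [D [zD evD liD]] := search_sound hV sXV cubic cover tri four V3 srch rea isT.
(* Removing [z] changes no cut: it is the edge already avoided, or a loop. *)
exists (D :\ z).
have DE U : (D :\ z) :&: cut h t U = D :&: cut h t U.
  apply/setP => e; rewrite !inE; case: eqP => // -> /=.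
  have [nlz|] := boolP (h z != t z); first by rewrite -(zz0 nlz) (negbTE zD).
  by rewrite negbK => /eqP ->; rewrite addbb andbF.
split; first by rewrite !inE eqxx.
  by move=> U; rewrite DE.
by move=> U /liD; rewrite DE.
Qed.

(** Each reduction relies on the failure of the earlier ones: with no node of degree 2 outside [X]
    the multigraph is 3-edge-connected, with no nontrivial 3-edge-cut it is [internally_four], and
    when neither deletion nor splitting applies it is cubic and every non-loop meets [X]. *)
Lemma solve_step m n (E W : finType) (h t : E -> W) z (V X : {set W}) :
  solvable_below m n -> admissible h t V X -> nearly_three_connected h t V X ->
  excess h t V <= m -> msize h t V <= n -> exists D, good h t z X D.
Proof.
move=> IH adm near exm szn; have [hV sXV X5] := adm.
have [X1|X2] := leqP #|X| 1; first by exists set0; apply: good_trivial.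
have [/existsP [a /and3P [aV aX /eqP c2]]|nodeg2] :=
  boolP [exists a, [&& a \in V, a \notin X & #|cut h t [set a]| == 2]].
  exact: step_degree2 IH adm near exm szn aV aX c2.
have single a U : a \in V -> V :&: U = [set a] -> cut h t U = cut h t [set a].
  move=> aV s; apply: cut_trace hV _; rewrite s; apply/esym/setIidPr.
  by rewrite sub1set.
have tri : three_connected h t V.
  move=> U /near [//|[c2 [a]]]; rewrite inE => /andP [aX aV] s.
  case/negP: nodeg2; apply/existsP; exists a; rewrite aV aX -c2 /=.
  by apply/eqP; case: s => [/(single a U aV) -> //|/(cut_traceC hV) ->].
have [/existsP [U /and3P [/eqP c3 U1 U2]]|four'] :=
  boolP [exists U : {set W}, [&& #|cut h t U| == 3, 1 < #|V :&: U| & 1 < #|V :\: U|]].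
  exact: step_cut IH adm tri exm szn c3 U1 U2.
have four : internally_four h t V.
  move=> U /andP [s1 s2] c3.
  have sing (S : {set W}) : S \subset V -> S != set0 -> ~~ (1 < #|S|) ->
      exists2 a, a \in V & S = [set a].
    rewrite -leqNgt => sS S0 S1.
    have /eqP/cards1P [a aE] : #|S| = 1 by apply/eqP; rewrite eqn_leq S1 card_gt0.
    by exists a; rewrite // (subsetP sS) // aE inE.
  have [U1|U1] := boolP (1 < #|V :&: U|); last first.
    by have [a aV aE] := sing _ (subsetIl _ _) s1 U1; exists a => //; left.
  have [U2|U2] := boolP (1 < #|V :\: U|); last first.
    by have [a aV aE] := sing _ (subsetDl _ _) s2 U2; exists a => //; right.
  by case/negP: four'; apply/existsP; exists U; rewrite c3 U1 U2.
have [/existsP [e /andP [nl /forall_inP H]]|ncov] :=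
  boolP [exists e, (h e != t e) &&
     [forall (x | x \in X), (#|cut h t [set x]| == 3) ==> (e \notin cut h t [set x])]].
  apply: (step_delete z IH adm tri four exm szn nl) => x xX c3.
  by have := H x xX; rewrite c3.
have [/existsP [v /andP [vV c4]]|ncub] :=
  boolP [exists v, (v \in V) && (3 < #|cut h t [set v]|)].
  exact: step_expand IH adm tri four exm vV c4.
have V2 : 1 < #|V| by apply: leq_trans X2 (subset_leq_card sXV).
apply: (good_cubic z adm X2 tri four) => [v vV|e nl].
  apply/eqP; rewrite eqn_leq tri; last first.
    apply/andP; split; apply/set0Pn; first by exists v; rewrite !inE vV eqxx.
    have /subsetPn [w wV wv] : ~~ (V \subset [set v]).
      by apply: contraL V2 => /subset_leq_card; rewrite cards1 -leqNgt.
    by exists w; rewrite inE wV wv.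
  by rewrite andbT leqNgt; apply: contra ncub => c4; apply/existsP; exists v; rewrite vV.
move: ncov; rewrite negb_exists => /forallP/(_ e); rewrite nl /= negb_forall.
move=> /existsP [x]; rewrite !negb_imply => /and3P [xX _].
rewrite andbT !inE; have [-> | _] := eqVneq (h e) x; first by rewrite xX.
by have [-> | //] := eqVneq (t e) x; rewrite xX orbT.
Qed.

Lemma solvable m n : solvable_below m n.
Proof.
elim: m n => [|m IHm].
  elim=> [|n IHn] E W h t z V X adm near [//|[ex sz]] //.
  by apply: (solve_step z IHn adm near); rewrite ?ex // -ltnS.
elim=> [|n IHn] E W h t z V X adm near [ex|[ex sz]] //.
- apply: (IHm (msize h t V).+1) adm near _.
  by move: ex; rewrite ltnS leq_eqVlt => /predU1P [->|]; [right | left].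
- by apply: IHn adm near _; left.
by apply: (solve_step z IHn adm near); rewrite ?ex // -ltnS.
Qed.

Theorem even_subgraph (E W : finType) (h t : E -> W) (z : E) (V X : {set W}) :
  admissible h t V X -> nearly_three_connected h t V X ->
  exists D, good h t z X D.
Proof.
move=> adm near.
apply: (@solvable (excess h t V) (msize h t V).+1 _ _ h t z V X adm near).
by right.
Qed.

(** * Euler trails *)

Section Euler.
Variables (E W : finType) (h t : E -> W).
Implicit Types (x y u : W) (e d : E) (s r : seq E) (D : {set E}) (U : {set W}).

Definition incident x e := (h e == x) || (t e == x).

(** For a loop at [x] this is [x] again. *)
Definition other x e := if h e == x then t e else h e.

Fixpoint trail x s := if s is e :: s' then incident x e && trail (other x e) s' else true.

Definition trail_end x s := foldl other x s.

Definition trail_nodes x s := x :: scanl other x s.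

Lemma incident_other x e : incident x e -> incident (other x e) e.
Proof.
by rewrite /incident /other; case: (h e =P x) => [_ _|_ /= /eqP _]; rewrite eqxx ?orbT.
Qed.

Lemma incident_cut x e U : incident x e ->
  (e \in cut h t U) = (x \in U) (+) (other x e \in U).
Proof.
rewrite /incident /other inE; case: (h e =P x) => [-> //|_ /= /eqP ->].
by rewrite addbC.
Qed.

Lemma trail_cat x s r : trail x (s ++ r) = trail x s && trail (trail_end x s) r.
Proof. by elim: s x => //= e s IH x; rewrite IH andbA. Qed.

Lemma trail_end_cat x s r : trail_end x (s ++ r) = trail_end (trail_end x s) r.
Proof. exact: foldl_cat. Qed.

Lemma trail_parity x s U : trail x s ->
  odd (count [in cut h t U] s) = (x \in U) (+) (trail_end x s \in U).
Proof.
elim: s x => [|e s IH] x /=; first by rewrite addbb.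
move=> /andP [xe /IH sE]; rewrite oddD sE (incident_cut _ xe) oddb.
by rewrite -/(trail_end _ _); do 3 case: (_ \in U).
Qed.

Lemma trail_nodes_split x s u : u \in trail_nodes x s ->
  exists s1 s2, s = s1 ++ s2 /\ trail_end x s1 = u.
Proof.
elim: s x => [|e s IH] x; rewrite /trail_nodes /=.
  by rewrite inE => /eqP ->; exists [::], [::].
rewrite inE => /predU1P [->|/IH [s1 [s2 [-> <-]]]]; first by exists [::], (e :: s).
by exists (e :: s1), s2.
Qed.

Lemma trail_incident x s e u : trail x s -> e \in s -> incident u e ->
  u \in trail_nodes x s.
Proof.
elim: s x => //= d s IH x /andP [xd tr]; rewrite inE => /predU1P [->|es] ue.
  rewrite /trail_nodes !inE; move: xd ue; rewrite /incident /other.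
  case: (h d =P x) => [-> _|_ /= /eqP ->]; first by case/orP => /eqP ->; rewrite eqxx ?orbT.
  by case/orP => /eqP ->; rewrite eqxx ?orbT.
by rewrite /trail_nodes inE IH ?orbT.
Qed.

Definition trail_in D x s := [&& uniq s, all [in D] s & trail x s].

Lemma trail_in_size D x s : trail_in D x s -> size s <= #|D|.
Proof.
move=> /and3P [us /allP sD _]; rewrite -(card_uniqP us).
by apply: subset_leq_card; apply/subsetP => e /sD.
Qed.

(** A trail that ends away from [x] has used an odd number of edges at its end, but [D] has an even
    number there, so one is left to go on. *)
Lemma even_return D x d : even_set h t D -> d \in D -> incident x d ->
  exists2 s, trail_in D x s & (s != [::]) && (trail_end x s == x).
Proof.
move=> evD dD xd.
suff H n s : #|D| - size s < n -> trail_in D x s -> s != [::] ->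
    exists2 s, trail_in D x s & (s != [::]) && (trail_end x s == x).
  by apply: (H _ [:: d] (ltnSn _)) => //; rewrite /trail_in /= dD xd.
elim: n s => // n IH s ltn sD s0; have [sx|nx] := eqVneq (trail_end x s) x.
  by exists s; rewrite // s0 sx eqxx.
have /and3P [us /allP sD' tr] := sD.
have [e eD es] : exists2 e, e \in D :&: cut h t [set trail_end x s] & e \notin s.
  apply/subsetPn; apply/negP => sub; have := evD [set trail_end x s].
  have -> : #|D :&: cut h t [set trail_end x s]| = count [in cut h t [set trail_end x s]] s.
    rewrite count_card //; apply: eq_card => e; rewrite !in_setI [RHS]inE.
    apply/andP/andP => [[eD eU]|[/sD' -> ->] //]; split=> //.
    by apply: (subsetP sub); rewrite inE eD.
  by rewrite (trail_parity _ tr) !inE eqxx eq_sym (negbTE nx).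
move: eD; rewrite inE => /andP [eD eU].
have inc : incident (trail_end x s) e.
  by move: eU; rewrite !inE /incident; do 2 case: (_ == _).
have sD2 : trail_in D x (rcons s e).
  rewrite /trail_in rcons_uniq es us all_rcons eD -cats1 trail_cat tr /= inc.
  by rewrite ?andbT; apply/allP.
apply: (IH (rcons s e)) => //; last by case: (s).
have := trail_in_size sD2; rewrite size_rcons; move: ltn; clear; lia.
Qed.

Lemma euler_trail D x : even_set h t D ->
  exists s, [/\ trail_in D x s, trail_end x s = x &
    forall d u, d \in D -> incident u d -> u \in trail_nodes x s -> d \in s].
Proof.
move=> evD.
suff H n s : #|D| - size s < n -> trail_in D x s -> trail_end x s = x ->
    exists s, [/\ trail_in D x s, trail_end x s = x &
      forall d u, d \in D -> incident u d -> u \in trail_nodes x s -> d \in s].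
  exact: (H _ [::] (ltnSn _)).
elim: n s => // n IH s ltn sD sx; have /and3P [us /allP sD' tr] := sD.
have [/existsP [d /existsP [u /and4P [dD ud us' ds]]]|no] := boolP [exists d, exists u,
    [&& d \in D, incident u d, u \in trail_nodes x s & d \notin s]]; last first.
  exists s; split=> // d u dD ud us'; apply/negPn/negP => ds.
  by case/negP: no; apply/existsP; exists d; apply/existsP; exists u; rewrite dD ud us'.
have evs : even_set h t (D :\: [set e in s]).
  move=> U; have := evD U; rewrite -(cardsID [set e in s] (D :&: cut h t U)) oddD.
  have -> : #|D :&: cut h t U :&: [set e in s]| = count [in cut h t U] s.
    rewrite count_card //; apply: eq_card => e; rewrite !in_setI [RHS]inE [e \in [set _ in s]]inE.
    by case es: (e \in s); rewrite ?andbF //= sD' ?andbT.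
  rewrite (trail_parity _ tr) sx addbb /=; congr (~~ odd #|pred_of_set _|).
  by rewrite setIDAC.
have [|//|r /and3P [ur /allP rD trr] /andP [r0 /eqP ru]] := even_return (x := u) (d := d) evs.
  by rewrite !inE ds.
have [s1 [s2 [sE s1u]]] := trail_nodes_split us'.
have rs e : e \in r -> e \notin s by move/rD; rewrite !inE => /andP [].
have uniq' : uniq (s1 ++ r ++ s2).
  rewrite uniq_catCA cat_uniq ur -sE us andbT /=; apply/hasPn => e es.
  by apply: contraL es => /rs.
have sD2 : trail_in D x (s1 ++ r ++ s2).
  rewrite /trail_in uniq' /=; apply/andP; split.
    apply/allP => e; rewrite !mem_cat => /or3P [es|/rD|es].
    + by apply: sD'; rewrite sE mem_cat es.
    + by rewrite inE => /andP [].
    + by apply: sD'; rewrite sE mem_cat es orbT.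
  by move: tr; rewrite sE !trail_cat s1u ru trr => /andP [-> ->].
apply: (IH (s1 ++ r ++ s2)) => //.
  have := trail_in_size sD2; move: ltn; rewrite sE !size_cat.
  by case: (r) r0 => //= e r' _; clear; lia.
by move: sx; rewrite sE !trail_end_cat s1u ru.
Qed.

Lemma trail_path x e s : trail x (e :: s) ->
  path (fun d d' => [exists w, incident w d && incident w d']) e s /\ incident (trail_end x (e :: s)) (last e s).
Proof.
elim: s x e => [|d s IH] x e /=.
  by rewrite andbT => /incident_other.
move=> /andP [xe tr]; have [p l] := IH _ _ tr; split=> //.
rewrite p andbT; apply/existsP; exists (other x e).
by rewrite incident_other //=; case/andP: tr.
Qed.

Lemma trail_cycle x s : trail x s -> trail_end x s = x ->
  cycle (fun d d' => [exists w, incident w d && incident w d']) s.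
Proof.
case: s => // e s tr xE; have [p l] := trail_path tr.
rewrite /= rcons_path p /=; apply/existsP; exists x.
by rewrite -{1}xE l; case/andP: tr.
Qed.

End Euler.

Lemma cycle_neq (E : eqType) (R : rel E) s : uniq s -> 1 < size s -> cycle R s ->
  cycle (fun d d' => R d d' && (d != d')) s.
Proof.
case: s => // e s us s1 /=.
(* The closing element [e] either does not occur in the rest of the list, or is the current element
   at the very start, where the rest must be nonempty. *)
have u' : forall a r, uniq (rcons (a :: r) e) || ((a == e) && (r != [::]) && uniq (a :: r)) -> path R a (rcons r e) ->
  path (fun d d' => R d d' && (d != d')) a (rcons r e).
  move=> a r; elim: r a => [|b r IH] a /=.
    by rewrite !andbT inE andbF orbF => -> ->.
  move=> U /andP [Rab Rr]; rewrite Rab /=; apply/andP; split.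
    case/orP: U => [/andP [H _]|/and3P [_ H _]].
      by apply: contraNneq H => ->; rewrite inE eqxx.
    by apply: contraNneq H => ->; rewrite inE eqxx.
  apply: IH => //; apply/orP; left.
  case/orP: U => [/andP [_ //]|/and3P [/andP [/eqP -> _] H H']].
  by rewrite rcons_uniq H.
apply: u'; rewrite us eqxx andbT /=; apply/orP; right.
by case: (s) s1.
Qed.

(** 3-connectedness is mostly applied in this form, with [A] the set of vertices reached or one side
    of a supposed separation. *)
Lemma connected_closed (T : finType) (G : rel T) (S A : {set T}) x y :
  k_connected 3 G -> #|S| < 3 ->
  (forall u v, u \in A -> u \notin S -> v \notin S -> G u v -> v \in A) ->
  x \in A -> x \notin S -> y \notin S -> y \in A.
Proof.
move=> [_ conn] S3 clA xA xS yS.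
have xS' : x \in ~: S by rewrite inE.
have yS' : y \in ~: S by rewrite inE.
have /connectP [p] := conn S S3 _ _ xS' yS'.
elim: p x xA xS {xS'} => [|u p IH] x xA xS /= => [_ ->|/andP [/and3P [_ + xu] pp] yE] //.
by rewrite inE => uS; apply: (IH u) => //; apply: clA xu.
Qed.

(** With at most two neighbours, these would separate [v] from a further vertex. *)
Lemma three_neighbours (T : finType) (G : rel T) v :
  k_connected 3 G -> irreflexive G -> 2 < #|[set u | G v u]|.
Proof.
move=> conn irr; rewrite ltnNge; apply/negP => N2.
have T4 := conn.1.
have [w] : exists w, w \in ~: (v |: [set u | G v u]).
  apply/card_gt0P; rewrite cardsCs setCK subn_gt0; apply: leq_trans T4.
  by rewrite cardsU1 ltnS; case: (_ \notin _); rewrite ?ltnS // ltnW.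
rewrite !inE negb_or => /andP [wv vw].
have : w \in [set v].
  apply: (connected_closed (S := [set u | G v u]) (x := v) conn); rewrite ?inE ?irr //.
  by move=> a b; rewrite !inE => /eqP -> _ /negP.
by rewrite inE (negbTE wv).
Qed.

Definition del (T : finType) (G : rel T) (z : T) : rel T :=
  [rel u v | [&& u != z, v != z & G u v]].

(** This is what puts each edge into a single maximal clique. *)
Definition diamond_free (T : finType) (H : rel T) := forall u v a b,
  H u v -> H u a -> H u b -> H v a -> H v b -> a != b -> H a b.

Definition no_claw (T : finType) (H : rel T) := forall v a b c,
  H v a -> H v b -> H v c -> a != b -> a != c -> b != c -> [|| H a b, H a c | H b c].

(** * Diamond-free graphs are line graphs *)

Section LineGraph.
Variables (T : finType) (H : rel T).
Hypothesis Hsym : symmetric H.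
Hypothesis Hirr : irreflexive H.
Hypothesis dia : diamond_free H.
Hypothesis claw : no_claw H.

(* The maximal clique containing the edge [uv] of a diamond-free graph. *)
Definition clique_of u v := [set w | ((w == u) || H w u) && ((w == v) || H w v)].

(* Every vertex lies in the two cliques [node1 v] and [node2 v], which coincide
   when the neighbours of [v] form a clique; [v] is then a loop of the multigraph. *)
Definition nbr1 v := odflt v [pick u | H v u].
Definition nbr2 v := odflt (nbr1 v) [pick u | H v u && (u \notin clique_of v (nbr1 v))].

Definition node1 v := clique_of v (nbr1 v).
Definition node2 v := clique_of v (nbr2 v).

Definition isnode (K : {set T}) := [exists v, [exists u, H v u && (K == clique_of v u)]].

Lemma H_neq u v : H u v -> u != v.
Proof. by apply: contraTneq => ->; rewrite Hirr. Qed.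

Lemma clique_of_adj u v a b : H u v -> a \in clique_of u v -> b \in clique_of u v ->
  a != b -> H a b.
Proof.
move=> uv; rewrite !inE => /andP [au av] /andP [bu bv] ab.
have [ae|anu] := eqVneq a u; first by subst a; rewrite eq_sym (negbTE ab) in bu; rewrite Hsym.
have [be|bnu] := eqVneq b u; first by subst b; rewrite (negbTE ab) in au.
have [ae|anv] := eqVneq a v; first by subst a; rewrite eq_sym (negbTE ab) in bv; rewrite Hsym.
have [be|bnv] := eqVneq b v; first by subst b; rewrite (negbTE ab) in av.
rewrite (negbTE anu) in au; rewrite (negbTE bnu) in bu.
rewrite (negbTE anv) in av; rewrite (negbTE bnv) in bv.
by apply: (dia uv); rewrite 1?Hsym.
Qed.

Lemma clique_ofE u v a b : H u v -> a \in clique_of u v -> b \in clique_of u v ->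
  a != b -> clique_of a b = clique_of u v.
Proof.
move=> uv aK bK ab; have Hab := clique_of_adj uv aK bK ab.
have uK : u \in clique_of u v by rewrite !inE eqxx uv orbT.
have vK : v \in clique_of u v by rewrite !inE eqxx Hsym uv orbT.
apply/setP => x; apply/idP/idP => [|xK]; last first.
  rewrite inE; apply/andP; split.
    by case: eqP => //= /eqP xa; apply: clique_of_adj uv xK aK xa.
  by case: eqP => //= /eqP xb; apply: clique_of_adj uv xK bK xb.
have [-> //|xa] := eqVneq x a; have [-> //|xb] := eqVneq x b.
rewrite inE (negbTE xa) (negbTE xb) /= => /andP [Hxa Hxb].
have key w : w \in clique_of u v -> (x == w) || H x w.
  move=> wK; have [//|xw] := eqVneq x w => /=.
  have [-> //|wa] := eqVneq w a; have [-> //|wb] := eqVneq w b.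
  have wa' : H w a by apply: clique_of_adj uv wK aK wa.
  have wb' : H w b by apply: clique_of_adj uv wK bK wb.
  by apply: (dia Hab) => //; rewrite Hsym.
by rewrite inE !key.
Qed.

Lemma nodeP K : isnode K ->
  [/\ forall a b, a \in K -> b \in K -> a != b -> H a b,
      forall a b, a \in K -> b \in K -> a != b -> K = clique_of a b &
      forall a, a \in K -> exists2 b, b \in K & H a b].
Proof.
case/existsP => v /existsP [u /andP [vu /eqP ->]]; split.
- by move=> a b; apply: clique_of_adj.
- by move=> a b aK bK ab; rewrite (clique_ofE vu aK bK).
have uK : u \in clique_of v u by rewrite !inE eqxx Hsym vu orbT.
have vK : v \in clique_of v u by rewrite !inE eqxx vu orbT.
move=> a aK; have [av|av] := eqVneq a v; first by exists u; rewrite ?av.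
by exists v; rewrite // (clique_of_adj vu).
Qed.

Lemma clique_of_node u v : H u v -> isnode (clique_of u v).
Proof. by move=> uv; apply/existsP; exists u; apply/existsP; exists v; rewrite uv eqxx. Qed.

Lemma clique_ofL u v : H u v -> u \in clique_of u v.
Proof. by move=> uv; rewrite !inE eqxx uv orbT. Qed.

Lemma clique_ofC u v : clique_of u v = clique_of v u.
Proof. by apply/setP => x; rewrite !inE andbC. Qed.

Lemma clique_ofR u v : H u v -> v \in clique_of u v.
Proof. by rewrite Hsym clique_ofC; apply: clique_ofL. Qed.

Lemma nbr1P v : [exists u, H v u] -> H v (nbr1 v).
Proof. by rewrite /nbr1; case: pickP => //= no /existsP [u]; rewrite no. Qed.

Lemma nbr2P v : [exists u, H v u] -> H v (nbr2 v).
Proof.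
move=> ex; rewrite /nbr2; case: pickP => [u /andP [] //|_ /=]; exact: nbr1P.
Qed.

Lemma node1_isnode v : [exists u, H v u] -> isnode (node1 v).
Proof. by move/nbr1P/clique_of_node. Qed.

Lemma node2_isnode v : [exists u, H v u] -> isnode (node2 v).
Proof. by move/nbr2P/clique_of_node. Qed.

Lemma node1_mem v : [exists u, H v u] -> v \in node1 v.
Proof. by move/nbr1P/clique_ofL. Qed.

Lemma node2_mem v : [exists u, H v u] -> v \in node2 v.
Proof. by move/nbr2P/clique_ofL. Qed.

(** If [b] is outside [node1 v], so is the vertex [w] chosen as [nbr2 v]. Neither is adjacent to
    [nbr1 v], so claw-freeness at [v] makes them equal or adjacent: there is no third clique at
    [v]. *)
Lemma nodes_of K v : isnode K -> v \in K -> (node1 v == K) || (node2 v == K).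
Proof.
move=> nK vK; have [_ KE Kb] := nodeP nK; have [b bK vb] := Kb v vK.
have ex : [exists u, H v u] by apply/existsP; exists b.
have KE' : K = clique_of v b by apply: KE; rewrite ?H_neq.
have mem u : H v u -> b \in clique_of v u -> clique_of v u = K.
  by move=> vu bu; rewrite KE' (clique_ofE vu _ bu) ?clique_ofL // H_neq.
have [bn1|bn1] := boolP (b \in node1 v).
  by rewrite /node1 mem ?eqxx // nbr1P.
apply/orP; right; rewrite /node2 mem ?nbr2P //.
rewrite /nbr2; case: pickP => [w /andP [vw wn1] /=|/(_ b)]; last first.
  by rewrite vb -/(node1 v) bn1.
have v1 := nbr1P ex.
have [-> //|bw] := eqVneq b w; first exact: clique_ofR.
have nadj x : H v x -> x \notin clique_of v (nbr1 v) -> (nbr1 v != x) && ~~ H (nbr1 v) x.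
  move=> vx; rewrite !inE negb_and !negb_or [H x v]Hsym vx andbF /= => /andP [x1 nx].
  by rewrite eq_sym x1 Hsym.
have /andP [n1b h1b] := nadj b vb bn1; have /andP [n1w h1w] := nadj w vw wn1.
have := claw v1 vb vw n1b n1w bw; rewrite (negbTE h1b) (negbTE h1w) /= => hbw.
by rewrite !inE (negbTE bw) hbw Hsym vb !orbT.
Qed.

End LineGraph.

(** * Cycles of G - z when two cliques cover the neighbours of z *)

Section Closed.
Variables (T : finType) (G : rel T) (z : T).
Hypothesis Gsym : symmetric G.
Hypothesis Girr : irreflexive G.
Hypothesis conn : k_connected 3 G.
Notation H := (del G z).
Hypothesis dia : diamond_free H.
Hypothesis claw : no_claw H.
Variables K1 K2 : {set T}.
Hypothesis nK1 : isnode H K1.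
Hypothesis nK2 : isnode H K2.
Hypothesis cover : forall n, G z n -> (n \in K1) || (n \in K2).

Lemma del_sym : symmetric H.
Proof. by move=> u v; rewrite /del /= Gsym; case: (u == z); case: (v == z). Qed.

Lemma del_irr : irreflexive H.
Proof. by move=> u; rewrite /del /= Girr !andbF. Qed.

(* [z] is made an edge between the cliques that cover its neighbours. *)
Let hn v := if v == z then K1 else node1 H v.
Let tn v := if v == z then K2 else node2 H v.
Let Vn := [set K | isnode H K].

Lemma del_nbr v : v != z -> [exists u, H v u].
Proof.
move=> vz; have /subsetPn [u] : ~~ ([set u | G v u] \subset [set z]).
  apply: contraL (three_neighbours v conn Girr) => /subset_leq_card.
  by rewrite cards1 -leqNgt => /leq_trans ->.
by rewrite !inE => vu uz; apply/existsP; exists u; rewrite /del /= vz uz.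
Qed.

Lemma ends_node e : (hn e \in Vn) && (tn e \in Vn).
Proof.
rewrite !inE /hn /tn; case: eqP => [_|/eqP ez]; first by rewrite nK1 nK2.
by rewrite (node1_isnode (del_nbr ez)) (node2_isnode (del_nbr ez)).
Qed.

Lemma node_not_z K v : isnode H K -> v \in K -> v != z.
Proof. by move=> /(nodeP del_sym dia) [_ _ Kb] /Kb [b _ /and3P []]. Qed.

Lemma incident_mem K v : v != z -> incident hn tn K v -> v \in K.
Proof.
move=> vz; rewrite /incident /hn /tn (negbTE vz) => /orP [] /eqP <-.
  by apply/node1_mem/del_nbr.
exact/node2_mem/del_nbr.
Qed.

Lemma mem_incident K v : isnode H K -> v \in K -> incident hn tn K v.
Proof.
move=> nK vK; rewrite /incident /hn /tn (negbTE (node_not_z nK vK)).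
exact: nodes_of del_sym del_irr dia claw _ _ nK vK.
Qed.

(** This turns edge cuts of the multigraph into vertex cuts of [G]: adjacent vertices outside a cut
    lie on the same side of it. *)
Lemma adjacent_share u v : G u v -> exists2 K, incident hn tn K u & incident hn tn K v.
Proof.
wlog vz : u v / v != z.
  move=> wl uv; have [vz|vz] := eqVneq v z; last exact: wl uv.
  have uz : u != z by apply: contraTneq uv => ->; rewrite vz Girr.
  by rewrite Gsym in uv; have [K] := wl _ _ uz uv; exists K.
move=> uv; have [uz|uz] := eqVneq u z.
  subst u; case/orP: (cover uv) => vK.
    by exists K1; [rewrite /incident /hn eqxx eqxx | apply: mem_incident].
  by exists K2; [rewrite /incident /tn !eqxx orbT | apply: mem_incident].
have Huv : H u v by rewrite /del /= uz vz.
have nK := clique_of_node Huv; exists (clique_of H u v); apply: mem_incident => //.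
  exact: clique_ofL.
exact: clique_ofR del_sym _ _ Huv.
Qed.

(* Each vertex is represented by an end of degree at least 3, as nodes of degree 2
   may not be prescribed. *)
Lemma rep_exists x : x != z ->
  exists K, [&& isnode H K, x \in K & (2 < #|K|) || (K \in [set K1; K2])].
Proof.
move=> xz; have ex := del_nbr xz.
have [n1 n2] := (node1_isnode ex, node2_isnode ex).
have [m1 m2] := (node1_mem ex, node2_mem ex).
have [c1|c1] := ltnP 2 #|node1 H x|; first by exists (node1 H x); rewrite n1 m1 c1.
have [c2|c2] := ltnP 2 #|node2 H x|; first by exists (node2 H x); rewrite n2 m2 c2.
(* When both cliques have at most two vertices, [x] has at most two neighbours besides [z]; so it is
   adjacent to [z] and lies in [K1] or [K2]. *)
have sub : [set u | G x u] \subset z |: ((node1 H x :\ x) :|: (node2 H x :\ x)).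
  apply/subsetP => u; rewrite inE => xu; rewrite in_setU1 in_setU !in_setD1.
  have [//|uz /=] := eqVneq u z.
  have Hxu : H x u by rewrite /del /= xz uz.
  have ux : u != x by apply: contraTneq xu => ->; rewrite Girr.
  have uK := clique_ofR del_sym Hxu.
  have := nodes_of del_sym del_irr dia claw (clique_of_node Hxu) (clique_ofL Hxu).
  by case/orP => /eqP ->; rewrite ux uK ?orbT.
have xz' : G z x.
  rewrite Gsym; apply/negPn/negP => nxz; have := three_neighbours x conn Girr.
  rewrite ltnNge => /negP; apply.
  have sub' : [set u | G x u] \subset (node1 H x :\ x) :|: (node2 H x :\ x).
    apply/subsetP => u xu; have := subsetP sub u xu; rewrite in_setU1 => /predU1P [uz|//].
    by move: xu; rewrite uz inE (negbTE nxz).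
  apply: leq_trans (subset_leq_card sub') _; apply: leq_trans (leq_card_setU _ _) _.
  move: c1 c2; rewrite (cardsD1 x (node1 H x)) (cardsD1 x (node2 H x)) m1 m2 !add1n.
  by move=> c1 c2; apply: (@leq_add _ _ 1 1).
case/orP: (cover xz') => xK; [exists K1 | exists K2];
  by rewrite ?nK1 ?nK2 xK !inE eqxx ?orbT.
Qed.

(** A cut [R] of at most two edges is a set of at most two vertices and does not separate [G], so
    all other edges lie on one side. A node on the other side is a clique inside [R] with at least
    two vertices, hence equals [R] and is the only node there. It is neither [K1] nor [K2], since
    otherwise the edge [z] would have an end there. *)
Lemma nodes_nearly (Xn : {set {set T}}) :
  (forall K, K \in Xn -> (2 < #|K|) || (K \in [set K1; K2])) ->
  nearly_three_connected hn tn Vn Xn.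
Proof.
move=> XnP U spU; set R := cut hn tn U.
have [|R2] := ltnP 2 #|R|; first by left.
right.
suff side (U' : {set {set T}}) : splits U' Vn -> cut hn tn U' = R ->
    (forall e, e \notin R -> hn e \notin U') ->
    #|R| = 2 /\ exists2 a, a \in Vn :\: Xn & Vn :&: U' = [set a].
  have [noin|/forallPn [e]] := boolP [forall e, (e \notin R) ==> (hn e \notin U)].
    have inU e : e \notin R -> hn e \notin U.
      by move=> eR; have /forallP/(_ e)/implyP/(_ eR) := noin.
    by have [-> [a aV aE]] := side U spU erefl inU; split=> //; exists a => //; left.
  rewrite negb_imply negbK => /andP [eR eU].
  have inU e' : e' \notin R -> hn e' \notin ~: U.
    move=> e'R; rewrite inE negbK.
    suff: e' \in [set d | hn d \in U] by rewrite in_set.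
    apply: (connected_closed (S := R) (x := e) conn) => //; last by rewrite inE.
    move=> u v; rewrite !inE => uU uR vR uv.
    have [K Ku Kv] := adjacent_share uv.
    have KU d : (hn d \in U) (+) (tn d \in U) = false -> incident hn tn K d ->
        (hn d \in U) = (K \in U).
      by move=> cU /orP [] /eqP <- //; move: cU; do 2 case: (_ \in U).
    by rewrite (KU v) ?(negbTE vR) // -(KU u) ?(negbTE uR).
  have spU' : splits (~: U) Vn by rewrite splitsC.
  have [-> [a aV aE]] := side (~: U) spU' (cutC _ _ _) inU.
  by split=> //; exists a => //; right; rewrite setDE.
move=> spU' cU' noin.
have all_R K v : K \in Vn :&: U' -> v \in K -> v \in R.
  rewrite in_setI [K \in Vn]inE => /andP [nK KU] vK; apply/negPn/negP => vR.
  have hv := noin v vR; have /orP [] := mem_incident nK vK => /eqP vE.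
    by rewrite vE KU in hv.
  by move: vR; rewrite -cU' inE vE KU (negbTE hv).
have KR K : K \in Vn :&: U' -> K = R /\ 1 < #|K|.
  move=> KU; have nK : isnode H K by move: KU; rewrite !inE => /andP [].
  have Kge2 : 1 < #|K|.
    have /existsP [v /existsP [u /andP [vu /eqP ->]]] := nK.
    have sub : [set v; u] \subset clique_of H v u.
      by rewrite subUset !sub1set (clique_ofL vu) (clique_ofR del_sym vu).
    apply: leq_trans (subset_leq_card sub); rewrite cards2.
    by rewrite (H_neq del_irr vu).
  split=> //; apply/eqP; rewrite eqEcard (leq_trans R2) // andbT.
  by apply/subsetP => v; apply: all_R.
have /andP [/set0Pn [K KU] _] := spU'.
have [KE Kc] := KR K KU.
have R2' : #|R| = 2 by apply/eqP; rewrite eqn_leq R2 -KE.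
split=> //; exists K; last first.
  apply/setP => K'; rewrite in_set1; apply/idP/eqP => [K'U|-> //].
  by have [-> _] := KR K' K'U; rewrite KE.
have /setIP [KV KU'] := KU; rewrite in_setD KV andbT.
apply/negP => /XnP; rewrite KE R2' ltnn /= -KE => K12.
have zR : z \notin R by rewrite -KE; apply/negP => /(node_not_z (K := K)); rewrite eqxx; move: KV; rewrite inE => -> /(_ isT).
have := noin z zR; move: zR; rewrite -cU' inE /hn /tn eqxx => zR.
by case/set2P: K12 zR => <-; rewrite KU' //; case: (K1 \in U').
Qed.

Lemma closed_cycle (X : {set T}) : z \notin X -> 2 < #|X| -> #|X| <= 5 ->
  exists s, [/\ uniq s, cycle H s & {subset X <= s}].
Proof.
move=> zX X3 X5.
pose rep x := odflt set0 [pick K | [&& isnode H K, x \in K & (2 < #|K|) || (K \in [set K1; K2])]].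
have repP x : x \in X -> [/\ isnode H (rep x), x \in rep x &
    (2 < #|rep x|) || (rep x \in [set K1; K2])].
  move=> xX; rewrite /rep; case: pickP => [K /and3P [] //|no].
  have [|K] := rep_exists (x := x); first by apply: contraNneq zX => <-.
  by rewrite no.
have xz x : x \in X -> x != z by move=> xX; apply: contraNneq zX => <-.
pose Xn := rep @: X.
have XnP K : K \in Xn -> (2 < #|K|) || (K \in [set K1; K2]).
  by case/imsetP => x /repP [_ _ ?] ->.
have adm : admissible hn tn Vn Xn.
  split; first exact: ends_node.
    by apply/subsetP => K /imsetP [x /repP [nK _ _] ->]; rewrite inE.
  by apply: leq_trans (leq_imset_card _ _) _.
have [D [zD evD liD]] := even_subgraph z adm (nodes_nearly XnP).
(* A vertex of [X] missed by [D] is added as a loop at its representative: parity is unaffected, and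
   the Euler trail visits it inside the clique [rep x]. *)
pose F := X :\: D.
pose h2 e := if e \in F then rep e else hn e.
pose t2 e := if e \in F then rep e else tn e.
have zF : z \notin F by rewrite !inE (negbTE zX) andbF.
have inc2 K e : e != z -> incident h2 t2 K e -> isnode H K && (e \in K).
  move=> ez; rewrite /incident /h2 /t2; case: ifP => [eF|_].
    rewrite orbb => /eqP <-; have [|-> -> _] := repP e; last by [].
    by move: eF; rewrite inE => /andP [].
  move=> inc; rewrite (incident_mem ez inc) andbT.
  by have := ends_node e; case/orP: inc => /eqP <-; rewrite !inE => /andP [].
have ev2 : even_set h2 t2 (D :|: X).
  move=> U; have := evD U; congr (~~ odd #|pred_of_set _|).
  apply/setP => e; rewrite !inE /h2 /t2; case eF: (e \in F).
    by move: eF; rewrite inE => /andP [/negbTE -> ->]; rewrite addbb andbF.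
  by move: eF; rewrite inE; case: (e \in D) => //= ->.
have [x0 x0X] : exists x, x \in X by apply/card_gt0P; apply: leq_trans X3.
have [s [/and3P [us /allP sD tr] sE smax]] := euler_trail (rep x0) ev2.
set N := trail_nodes _ _ _ _ in smax.
have sz e : e \in s -> e != z.
  by move/sD => eD; apply: contraTneq eD => ->; rewrite !inE negb_or zD.
pose U := [set K | K \in N].
(* No edge of [D] leaves the set of visited nodes, so [links] puts all representatives on the
   trail. *)
have NU : D :&: cut hn tn U = set0.
  apply/eqP; rewrite -subset0; apply/subsetP => e; rewrite inE => /andP [eD eU].
  have eF : e \notin F by rewrite !inE eD.
  have DX : e \in D :|: X by rewrite inE eD.
  have inc1 : incident h2 t2 (hn e) e by rewrite /incident /h2 (negbTE eF) eqxx.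
  have inc2' : incident h2 t2 (tn e) e by rewrite /incident /t2 (negbTE eF) eqxx orbT.
  move: eU; rewrite inE ![_ \in U]in_set; case h1: (hn e \in N) => /= t1.
    by case/negP: t1; exact: (trail_incident tr (smax _ _ DX inc1 h1) inc2').
  by have := trail_incident tr (smax _ _ DX inc2' t1) inc1; rewrite -/N h1.
have XU x : x \in X -> rep x \in N.
  move=> xX; apply/negPn/negP => nx.
  have : splits U Xn.
    apply/splitsP; split; first by exists (rep x0); rewrite ?imset_f // inE /N mem_head.
    by exists (rep x); rewrite ?imset_f // inE.
  by move/liD; rewrite NU eqxx.
have Xs : {subset X <= s}.
  move=> x xX; apply: (smax x (rep x)); [by rewrite inE xX orbT| |exact: XU].
  rewrite /incident /h2 /t2; case: ifP => [_|/negbT]; first by rewrite eqxx.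
  rewrite inE xX andbT negbK => xD; have [nK xK _] := repP x xX.
  exact: mem_incident.
exists s; split=> //.
have s1 : 1 < size s.
  apply: ltnW; apply: leq_trans X3 _; rewrite -(card_uniqP us).
  by apply/subset_leq_card/subsetP.
have := cycle_neq us s1 (trail_cycle tr sE).
apply: (sub_in_cycle _ (allss s)) => d d' ds d's /andP [/existsP [K /andP [Kd Kd']] dd'].
have /andP [nK dK] := inc2 _ _ (sz _ ds) Kd; have /andP [_ d'K] := inc2 _ _ (sz _ d's) Kd'.
by have [+ _ _] := nodeP del_sym dia nK; apply.
Qed.

End Closed.

(** * Vertices whose neighbours induce a 5-cycle *)

Section Pentagon.
Variables (T : finType) (H : rel T).
Hypothesis Hsym : symmetric H.
Hypothesis Hirr : irreflexive H.
Hypothesis dia : diamond_free H.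
Hypothesis claw : no_claw H.

Definition pentagon (N : {set T}) (c0 c1 c2 c3 c4 : T) :=
  [/\ uniq [:: c0; c1; c2; c3; c4], N = [set:: [:: c0; c1; c2; c3; c4]] &
      [&& H c0 c1, H c1 c2, H c2 c3, H c3 c4 & H c4 c0]].

Lemma node_full K u v w : isnode H K -> u \in K -> v \in K -> H u v ->
  (w == u) || H w u -> (w == v) || H w v -> w \in K.
Proof.
move=> nK uK vK uv wu wv; have [_ KE _] := nodeP Hsym dia nK.
by rewrite (KE u v) ?(H_neq Hirr uv) // inE wu.
Qed.

(** Fix [a] in [N] with its cliques [A1] and [A2]; its non-neighbours [B] in [N] form a clique. Let
    [P] and [Q] be the parts of [N] in only one of [A1], [A2]. A vertex of [B] has at most one
    neighbour in [P], at most one in [Q], and is adjacent to one of any [p], [q]. Unless one clique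
    of [a] and a clique around [B] cover [N], this leaves one vertex in [P], one in [Q] and two in
    [B]: the pentagon. *)
Lemma cover_or_pentagon (N : {set T}) : (forall v, v \in N -> [exists u, H v u]) ->
  (exists K, isnode H K) ->
  (forall a b c, a \in N -> b \in N -> c \in N -> a != b -> a != c -> b != c ->
     [|| H a b, H a c | H b c]) ->
  (exists K1 K2, [/\ isnode H K1, isnode H K2 & forall n, n \in N -> (n \in K1) || (n \in K2)]) \/
  (exists c0 c1 c2 c3 c4, pentagon N c0 c1 c2 c3 c4).
Proof.
move=> exN [K0 nK0] ind.
have [N0|/set0Pn [a aN]] := eqVneq N set0.
  by left; exists K0, K0; split=> // n; rewrite N0 inE.
have exa := exN a aN.
set A1 := node1 H a; set A2 := node2 H a.
have n1 : isnode H A1 by apply: node1_isnode.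
have n2 : isnode H A2 by apply: node2_isnode.
have a1 : a \in A1 by apply: node1_mem.
have a2 : a \in A2 by apply: node2_mem.
have [c1 E1 _] := nodeP Hsym dia n1; have [c2 E2 _] := nodeP Hsym dia n2.
have neq u v : H u v -> u != v by apply: H_neq.
have A12 n : H a n -> (n \in A1) || (n \in A2).
  move=> an; have := nodes_of Hsym Hirr dia claw (clique_of_node an) (clique_ofL an).
  by rewrite /A1 /A2; case/orP => /eqP ->; rewrite (clique_ofR Hsym) ?orbT.
have aA n : (n \in A1) || (n \in A2) -> n != a -> H a n.
  by case/orP => nA na; [apply: c1 | apply: c2]; rewrite // eq_sym.
pose B := [set b in N | (b != a) && ~~ H a b].
have BP b : b \in B -> [/\ b \in N, b != a & ~~ H a b] by rewrite inE => /and3P [].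
have Badj b b' : b \in B -> b' \in B -> b != b' -> H b b'.
  move=> /BP [bN ba nab] /BP [b'N b'a nab'] bb'.
  have := ind a b b' aN bN b'N; rewrite eq_sym ba eq_sym b'a bb' => /(_ isT isT isT).
  by rewrite (negbTE nab) (negbTE nab').
have notB n : n \in N -> n \notin B -> (n \in A1) || (n \in A2).
  move=> nN; rewrite inE nN /= negb_and !negbK => /orP [/eqP ->|/A12 //].
  by rewrite a1.
have na1 n : n \notin A1 -> n != a by apply: contraNneq => ->.
have na2 n : n \notin A2 -> n != a by apply: contraNneq => ->.
have sep p q : p \in A1 -> p \notin A2 -> q \in A2 -> q \notin A1 -> ~~ H p q.
  move=> p1 p2 q2 q1; apply: contra (q1) => pq.
  apply: (node_full n1 p1 a1); first by rewrite Hsym aA ?p1 ?na2.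
    by rewrite Hsym pq orbT.
  by rewrite Hsym aA ?orbT ?na1 // q2 orbT.
pose P := [set p in N | (p \in A1) && (p \notin A2)].
pose Q := [set q in N | (q \in A2) && (q \notin A1)].
have PP p : p \in P -> [/\ p \in N, p \in A1 & p \notin A2] by rewrite inE => /and3P [].
have QP q : q \in Q -> [/\ q \in N, q \in A2 & q \notin A1] by rewrite inE => /and3P [].
have inP n : n \in N -> n \in A1 -> n \notin A2 -> n \in P.
  by move=> nN nA1 nA2; rewrite inE; apply/and3P.
have inQ n : n \in N -> n \in A2 -> n \notin A1 -> n \in Q.
  by move=> nN nA2 nA1; rewrite inE; apply/and3P.
have Aor b p q : b \in B -> p \in P -> q \in Q -> H b p || H b q.
  move=> bB /PP [pN p1 p2] /QP [qN q2 q1]; have [bN ba nab] := BP b bB.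
  have Hap : H a p by rewrite aA ?p1 ?na2.
  have Haq : H a q by rewrite aA ?q2 ?orbT ?na1.
  have pq : p != q by apply: contraNneq p2 => ->.
  have bp : b != p by apply: contraNneq nab => ->.
  have bq : b != q by apply: contraNneq nab => ->.
  have := ind b p q bN pN qN bp bq pq.
  by rewrite (negbTE (sep p q p1 p2 q2 q1)) orbF.
(* Two neighbours in a clique at [a] would put [b] into that clique, next to [a]. *)
have one K b x y : isnode H K -> a \in K -> b \in B -> x \in K -> y \in K -> x != y ->
    H b x -> ~~ H b y.
  move=> nK aK bB xK yK xy bx; apply/negP => b_y; have [_ ba nab] := BP b bB.
  have [cK _ _] := nodeP Hsym dia nK.
  have bK : b \in K by apply: (node_full nK xK yK (cK _ _ xK yK xy)); rewrite ?bx ?b_y orbT.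
  by case/negP: nab; apply: cK; rewrite // eq_sym.
have oneP b x y : b \in B -> x \in P -> y \in P -> x != y -> H b x -> ~~ H b y.
  by move=> bB /PP [_ x1 _] /PP [_ y1 _]; apply: (one A1).
have oneQ b x y : b \in B -> x \in Q -> y \in Q -> x != y -> H b x -> ~~ H b y.
  by move=> bB /QP [_ x1 _] /QP [_ y1 _]; apply: (one A2).
have [B0|/set0Pn [b0 b0B]] := eqVneq B set0.
  by left; exists A1, A2; split=> // n nN; apply: notB; rewrite // B0 inE.
have nodeB x : (forall b, b \in B -> H b x) ->
    exists2 K, isnode H K & x \in K /\ forall b, b \in B -> b \in K.
  move=> Bx; have b0x := Bx b0 b0B; exists (clique_of H b0 x); first exact: clique_of_node.
  split; first exact: clique_ofR.
  move=> b bB; rewrite inE Bx // orbT andbT.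
  by have [//|bb0] := eqVneq b b0; rewrite (Badj _ _ bB b0B).
have nodeB' : exists2 K, isnode H K & forall b, b \in B -> b \in K.
  have [/forall_inP sB|/forall_inPn [b1 b1B nb]] := boolP [forall (b | b \in B), b == b0].
    have [b0N _ _] := BP b0 b0B; exists (node1 H b0); first exact/node1_isnode/exN.
    by move=> b /sB /eqP ->; exact/node1_mem/exN.
  have b10 := Badj _ _ b1B b0B nb; exists (clique_of H b1 b0); first exact: clique_of_node.
  move=> b bB; rewrite inE.
  by apply/andP; split; case: eqP => //= /eqP; apply: Badj.
have [P0|/set0Pn [p pP]] := eqVneq P set0.
  have [K nK BK] := nodeB'; left; exists A2, K; split=> // n nN.
  have [/BK ->|nB] := boolP (n \in B); first by rewrite orbT.
  have [//|nA2] := boolP (n \in A2).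
  have := notB n nN nB; rewrite (negbTE nA2) orbF => nA1.
  by have := inP n nN nA1 nA2; rewrite P0 inE.
have [Q0|/set0Pn [q qQ]] := eqVneq Q set0.
  have [K nK BK] := nodeB'; left; exists A1, K; split=> // n nN.
  have [/BK ->|nB] := boolP (n \in B); first by rewrite orbT.
  have [//|nA1] := boolP (n \in A1).
  have := notB n nN nB; rewrite (negbTE nA1) /= => nA2.
  by have := inQ n nN nA2 nA1; rewrite Q0 inE.
have caseQ : (forall b, b \in B -> H b q) -> (forall q', q' \in Q -> q' = q) ->
    exists K1 K2, [/\ isnode H K1, isnode H K2 & forall n, n \in N -> (n \in K1) || (n \in K2)].
  move=> Bq Qq; have [K nK [qK BK]] := nodeB q Bq; exists A1, K; split=> // n nN.
  have [/BK ->|nB] := boolP (n \in B); first by rewrite orbT.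
  have [//|nA1] := boolP (n \in A1).
  have := notB n nN nB; rewrite (negbTE nA1) /= => nA2.
  by rewrite (Qq n) ?qK ?orbT //; exact: inQ.
have caseP : (forall b, b \in B -> H b p) -> (forall p', p' \in P -> p' = p) ->
    exists K1 K2, [/\ isnode H K1, isnode H K2 & forall n, n \in N -> (n \in K1) || (n \in K2)].
  move=> Bp Pp; have [K nK [pK BK]] := nodeB p Bp; exists A2, K; split=> // n nN.
  have [/BK ->|nB] := boolP (n \in B); first by rewrite orbT.
  have [//|nA2] := boolP (n \in A2).
  have := notB n nN nB; rewrite (negbTE nA2) orbF => nA1.
  by rewrite (Pp n) ?pK ?orbT //; exact: inP.
have [/exists_inP [q' q'Q qq']|Q1] := boolP [exists (q' | q' \in Q), q' != q].
  left; have Bp b p' : b \in B -> p' \in P -> H b p'.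
    move=> bB p'P; have := Aor b p' q bB p'P qQ; have := Aor b p' q' bB p'P q'Q.
    case: (H b p') => //= bq' bq; have := oneQ b q' q bB q'Q qQ qq' bq'.
    by rewrite bq.
  apply: caseP => [b bB|p' p'P]; first exact: Bp.
  apply/eqP/negPn/negP => p'p; have := oneP b0 p' p b0B p'P pP p'p (Bp _ _ b0B p'P).
  by rewrite Bp.
have Qq q' : q' \in Q -> q' = q.
  move=> q'Q; apply/eqP/negPn/negP => qq'; case/negP: Q1.
  by apply/exists_inP; exists q'.
have [/exists_inP [p' p'P pp']|P1] := boolP [exists (p' | p' \in P), p' != p].
  left; apply: caseQ => // b bB; have := Aor b p q bB pP qQ; have := Aor b p' q bB p'P qQ.
  case: (H b q); rewrite ?orbT ?orbF // => bp' bp.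
  by have := oneP b p' p bB p'P pP pp' bp'; rewrite bp.
have Pp p' : p' \in P -> p' = p.
  move=> p'P; apply/eqP/negPn/negP => pp'; case/negP: P1.
  by apply/exists_inP; exists p'.
have [/forall_inP Bq|/forall_inPn [b2 b2B b2q]] := boolP [forall (b | b \in B), H b q].
  by left; apply: caseQ.
have [/forall_inP Bp|/forall_inPn [b1 b1B b1p]] := boolP [forall (b | b \in B), H b p].
  by left; apply: caseP.
have b2p : H b2 p by have := Aor b2 p q b2B pP qQ; rewrite (negbTE b2q) orbF.
have b1q : H b1 q by have := Aor b1 p q b1B pP qQ; rewrite (negbTE b1p).
have b21 : b2 != b1 by apply: contraNneq b2q => ->.
have H21 := Badj _ _ b2B b1B b21.
have [pN p1 p2] := PP p pP; have [qN q2 q1] := QP q qQ.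
have [b1N b1a nab1] := BP b1 b1B; have [b2N b2a nab2] := BP b2 b2B.
have Hap : H a p by rewrite aA ?p1 ?na2.
have Haq : H a q by rewrite aA ?q2 ?orbT ?na1.
(* A third vertex of [B] is adjacent to [p] or [q]; diamond-freeness would then make [b1] adjacent
   to [p] or [b2] adjacent to [q]. *)
have Bsub b : b \in B -> (b == b1) || (b == b2).
  move=> bB; apply/negPn/negP; rewrite negb_or => /andP [bb1 bb2].
  have Hb1 := Badj _ _ bB b1B bb1; have Hb2 := Badj _ _ bB b2B bb2.
  have := Aor b p q bB pP qQ => /orP [bp|bq].
    case/negP: b1p; rewrite Hsym; apply: (dia (u := b2) (v := b)) => //;
      rewrite 1?[H b2 b]Hsym 1?[H p b1]Hsym //.
    by apply: contraNneq nab1 => <-.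
  case/negP: b2q; rewrite Hsym; apply: (dia (u := b1) (v := b)) => //;
    rewrite 1?[H b1 b]Hsym 1?[H b1 b2]Hsym //.
  by apply: contraNneq nab2 => <-.
right; exists a, p, b2, b1, q; split.
- have ab1 : a != b1 by rewrite eq_sym.
  have ab2 : a != b2 by rewrite eq_sym.
  have pb1 : p != b1 by apply: contraNneq nab1 => <-.
  have pb2 : p != b2 by rewrite eq_sym neq.
  have pq : p != q by apply: contraNneq p2 => ->.
  have b2q' : b2 != q by apply: contraNneq nab2 => ->.
  by rewrite /= !inE !negb_or (neq _ _ Hap) (neq _ _ Haq) (neq _ _ b1q) ab1 ab2 pb1 pb2 pq b2q' b21.
- apply/setP => n; rewrite !inE; apply/idP/idP => [nN|]; last first.
    by case/or4P => [/eqP ->|/eqP ->|/eqP ->|/orP [] /eqP ->].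
  have [/Bsub /orP [] ->|nB] := boolP (n \in B); rewrite ?orbT //.
  have [-> //|nna] := eqVneq n a; have := notB n nN nB.
  case nA1: (n \in A1); case nA2: (n \in A2) => //= _.
  + have an : a != n by rewrite eq_sym.
    by move: p2; rewrite (E2 a n) // -(E1 a n) // p1.
  + by rewrite (Pp n) ?eqxx //; apply: inP; rewrite ?nA2.
  + by rewrite (Qq n) ?eqxx ?orbT //; apply: inQ; rewrite ?nA1.
by rewrite Hap [H p b2]Hsym b2p H21 b1q Hsym Haq.
Qed.

End Pentagon.

Definition avoid (T : finType) (H : rel T) (S : {set T}) : rel T :=
  [rel u v | [&& u \notin S, v \notin S & H u v]].

Definition drop_edge (T : finType) (G : rel T) (x y : T) : rel T :=
  [rel u v | [&& G u v, ~~ ((u == x) && (v == y)) & ~~ ((u == y) && (v == x))]].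

(** * The diamond-free case *)

Section DiamondFree.
Variables (T : finType) (G : rel T) (z : T).
Hypothesis Gsym : symmetric G.
Hypothesis Girr : irreflexive G.
Hypothesis conn : k_connected 3 G.
Hypothesis claw : no_claw G.
Notation H := (del G z).
Hypothesis dia : diamond_free H.

Lemma delP u v : H u v -> [/\ u != z, v != z & G u v].
Proof. by case/and3P. Qed.

Lemma del_claw : no_claw H.
Proof.
move=> v a b c /delP [vz az va] /delP [_ bz vb] /delP [_ cz vc] ab ac bc.
by rewrite /del /= az bz cz /=; apply: (claw va).
Qed.

Lemma k_connectedP (G' : rel T) : 3 < #|T| ->
  reflect (k_connected 3 G')
    [forall S : {set T}, (#|S| < 3) ==> [forall (x | x \notin S),
       [forall (y | y \notin S), connect (avoid G' S) x y]]].
Proof.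
move=> T4; have E (S : {set T}) x y :
    connect [rel u v | [&& u \in ~: S, v \in ~: S & G' u v]] x y = connect (avoid G' S) x y.
  by apply: eq_connect => u v; rewrite /avoid /= !inE.
apply: (iffP forallP) => [con|[_ con] S].
  split=> // S S3 x y; rewrite !inE => xS yS; rewrite E.
  by have /implyP/(_ S3)/forall_inP/(_ x xS)/forall_inP := con S; apply.
apply/implyP => S3; apply/forall_inP => x xS; apply/forall_inP => y yS.
by rewrite -E; apply: con; rewrite ?inE.
Qed.

(** If at most two vertices [S] separate [G] without the edge [z c0], they separate [z] from [c0].
    The paths through [c1] and through [c4] force [S] to consist of these two, and [c2], still
    adjacent to [z], is then cut off from [c0]. *)
Lemma drop_spoke (N : {set T}) c0 c1 c2 c3 c4 : N = [set n | G z n] ->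
  pentagon H N c0 c1 c2 c3 c4 ->
  k_connected 3 (drop_edge G z c0) \/ ~~ connect (avoid H [set c1; c4]) c0 c2.
Proof.
move=> NE [uc NC /and5P [h01 h12 h23 h34 h40]].
set G0 := drop_edge G z c0.
have [con|] := altP (k_connectedP G0 conn.1); first by left.
case/forallPn => S; rewrite negb_imply => /andP [S3 /forall_inPn [x xS /forall_inPn [y yS ncon]]].
right; apply: contra ncon => con02.
have G0sym : symmetric G0.
  by move=> u v; rewrite /G0 /drop_edge /= Gsym [X in _ && X]andbC ![(u == _) && _]andbC.
have zN c : c \in [:: c0; c1; c2; c3; c4] -> G z c.
  by move=> cN; have : c \in N; [rewrite NC inE | rewrite NE inE].
have cz c : c \in [:: c0; c1; c2; c3; c4] -> c != z.
  by move/zN => zc; apply: contraTneq zc => ->; rewrite Girr.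
have G0H u v : H u v -> G0 u v.
  by move/delP => [uz vz uv]; rewrite /G0 /drop_edge /= uv (negbTE uz) (negbTE vz) andbF.
have G0z c : c \in [:: c1; c2; c3; c4] -> G0 z c.
  move=> cN; have cN' : c \in [:: c0; c1; c2; c3; c4] by rewrite inE cN orbT.
  rewrite /G0 /drop_edge /= zN // eqxx (negbTE (cz _ cN')) andbF andbT /=.
  by apply: contraTneq cN => ->; case/andP: uc.
have csym : connect_sym (avoid G0 S).
  by apply: sym_connect_sym => a b; rewrite /avoid /= G0sym andbCA.
have key : z \notin S -> c0 \notin S -> connect (avoid G0 S) z c0.
  move=> zS c0S; have step u v : u \notin S -> v \notin S -> G0 u v -> connect (avoid G0 S) u v.
    by move=> uS vS uv; apply: connect1; rewrite /avoid /= uS vS.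
  have [c1S|c1S] := boolP (c1 \in S); last first.
    apply: (connect_trans (step z c1 zS c1S _)); first by rewrite G0z ?inE ?eqxx.
    by apply: step => //; rewrite G0sym G0H.
  have [c4S|c4S] := boolP (c4 \in S); last first.
    apply: (connect_trans (step z c4 zS c4S _)); first by rewrite G0z ?inE ?eqxx ?orbT.
    by apply: step => //; rewrite G0H.
  have SE : [set c1; c4] = S.
    apply/eqP; rewrite eqEcard; apply/andP; split.
      by apply/subsetP => c /set2P [] ->.
    rewrite cards2; suff -> : c1 != c4 by [].
    by apply: contraTneq uc => ->; rewrite /= !inE eqxx !orbT /= !andbF.
  have c2S : c2 \notin S.
    rewrite -SE !inE negb_or; apply/andP; split; apply: contraTneq uc => ->;
    by rewrite /= !inE eqxx ?orbT /= ?andbF.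
  apply: (connect_trans (step z c2 zS c2S _)); first by rewrite G0z ?inE ?eqxx ?orbT.
  rewrite csym.
  apply: connect_sub con02 => u v; rewrite SE => /and3P [uS vS uv].
  by apply: step => //; apply: G0H.
suff : y \in [set u | connect (avoid G0 S) x u] by rewrite inE.
apply: (connected_closed (S := S) (x := x) conn) => //; last by rewrite inE.
move=> u v; rewrite !inE => xu uS vS uv.
apply: (connect_trans xu).
have [/andP [/eqP uz /eqP vc]|n1] := boolP ((u == z) && (v == c0)).
  by subst u v; apply: key.
have [/andP [/eqP uc0 /eqP vz]|n2] := boolP ((u == c0) && (v == z)).
  by subst u v; rewrite csym; apply: key.
by apply: connect1; rewrite /avoid /= uS vS /G0 /drop_edge /= uv n1 n2.
Qed.

Lemma pentagon_rot (N : {set T}) c0 c1 c2 c3 c4 :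
  pentagon H N c0 c1 c2 c3 c4 -> pentagon H N c1 c2 c3 c4 c0.
Proof.
move=> [uc -> /and5P [h01 h12 h23 h34 h40]]; split; last by rewrite h12 h23 h34 h40.
  by rewrite -(rot_uniq 1) in uc.
by apply/setP => n; rewrite !inE; do 5 case: (n == _).
Qed.

(** Dropping the edge does not change [G - z], where diamonds and claws are excluded; the four
    neighbours left to [z] are covered by the cliques on [c1 c2] and on [c3 c4]. *)
Lemma drop_cycle (N X : {set T}) c0 c1 c2 c3 c4 : N = [set n | G z n] ->
  pentagon H N c0 c1 c2 c3 c4 -> k_connected 3 (drop_edge G z c0) ->
  z \notin X -> 2 < #|X| -> #|X| <= 5 ->
  exists s, [/\ uniq s, cycle H s & {subset X <= s}].
Proof.
move=> NE [uc NC /and5P [h01 h12 h23 h34 h40]] con zX X3 X5.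
set G0 := drop_edge G z c0 in con.
have G0sym : symmetric G0.
  by move=> u v; rewrite /G0 /drop_edge /= Gsym [X in _ && X]andbC ![(u == _) && _]andbC.
have G0irr : irreflexive G0 by move=> u; rewrite /G0 /drop_edge /= Girr.
have E : del G0 z =2 H.
  move=> u v; rewrite /del /G0 /drop_edge /=.
  by case: (u == z); case: (v == z); rewrite //= andbF andbT.
have dia0 : diamond_free (del G0 z).
  by move=> u v a b; rewrite !E; apply: dia.
have claw0 : no_claw (del G0 z).
  by move=> v a b c; rewrite !E; apply: del_claw.
rewrite -!E in h12 h34.
have cov n : G0 z n -> (n \in clique_of (del G0 z) c1 c2) || (n \in clique_of (del G0 z) c3 c4).
  move=> zn; have : n \in N by rewrite NE inE; case/and3P: zn.
  rewrite NC inE !in_cons in_nil orbF => /predU1P [nc0|].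
    by move: zn; rewrite nc0 /G0 /drop_edge /= !eqxx andbF.
  have s0 := del_sym z G0sym.
  by case/or4P => /eqP ->;
    rewrite ?(clique_ofL h12) ?(clique_ofR s0 h12) ?(clique_ofL h34) ?(clique_ofR s0 h34) ?orbT.
have [s [us cs Xs]] := closed_cycle G0sym G0irr con dia0 claw0 (clique_of_node h12)
  (clique_of_node h34) cov zX X3 X5.
by exists s; split=> //; rewrite -(eq_cycle E).
Qed.

(** Let [M] be the component of a further vertex after removing [z] and the pentagon. Attached to
    two pentagon vertices at distance 2, it would connect them against a hypothesis. So it is
    attached to at most two vertices, and these would separate it from [z]. *)
Lemma pentagon_spans (N : {set T}) c0 c1 c2 c3 c4 : N = [set n | G z n] ->
  pentagon H N c0 c1 c2 c3 c4 ->
  ~~ connect (avoid H [set c1; c4]) c0 c2 ->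
  ~~ connect (avoid H [set c2; c0]) c1 c3 ->
  ~~ connect (avoid H [set c3; c1]) c2 c4 ->
  ~~ connect (avoid H [set c4; c2]) c3 c0 ->
  ~~ connect (avoid H [set c0; c3]) c4 c1 ->
  forall v, v != z -> v \in N.
Proof.
move=> NE [uc NC _] n0 n1 n2 n3 n4 v vz; apply/negPn/negP => vN.
have Hsym := del_sym z Gsym.
pose C := z |: N; pose M := [set u | connect (avoid H C) v u].
pose att c := [exists m in M, H m c].
have vC : v \notin C by rewrite in_setU1 negb_or vz.
have MC m : m \in M -> m \notin C.
  rewrite inE => /connectP [p]; elim/last_ind: p => [|p w _] /=; first by move=> _ ->.
  by rewrite rcons_path last_rcons => /andP [_ /and3P [_ wC _]] ->.
have csym S : connect_sym (avoid H S).
  by apply: sym_connect_sym => a b; rewrite /avoid /= Hsym andbCA.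
have thru c d (S : {set T}) : S \subset N -> c \in N -> d \in N -> c \notin S -> d \notin S ->
    att c -> att d -> connect (avoid H S) c d.
  move=> sS cN dN cS dS /exists_inP [m mM mc] /exists_inP [m' m'M m'd].
  have MS w : w \in M -> w \notin S.
    by move/MC; apply: contra => /(subsetP sS) wN; rewrite in_setU1 wN orbT.
  have sub : subrel (connect (avoid H C)) (connect (avoid H S)).
    apply: connect_sub => a b /and3P [aC bC ab]; apply: connect1.
    rewrite /avoid /= ab andbT; apply/andP; split.
      by apply: contra aC => /(subsetP sS) aN; rewrite in_setU1 aN orbT.
    by apply: contra bC => /(subsetP sS) bN; rewrite in_setU1 bN orbT.
  have cm : connect (avoid H S) c m.
    by rewrite csym; apply: connect1; rewrite /avoid /= cS MS.
  have md : connect (avoid H S) m' d by apply: connect1; rewrite /avoid /= dS MS.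
  apply: connect_trans cm _; apply: connect_trans md; apply: sub.
  by move: mM m'M; rewrite !inE => vm; apply: connect_trans; rewrite csym.
have inN c : c \in [:: c0; c1; c2; c3; c4] -> c \in N by move=> cN; rewrite NC inE.
have [m0 m1 m2 m3 m4] : [/\ c0 \in N, c1 \in N, c2 \in N, c3 \in N & c4 \in N].
  by split; apply: inN; rewrite !inE eqxx ?orbT.
have sub2 a b : a \in N -> b \in N -> [set a; b] \subset N.
  by move=> aN bN; rewrite subUset !sub1set aN.
move: (uc); rewrite /= !inE !negb_or -!andbA => /and5P [u01 u02 u03 u04].
move=> /and5P [u12 u13 u14 u23 /andP [u24 /andP [u34 _]]].
pose S := [set c in N | att c].
have S3 : #|S| < 3.
  have f0 : ~~ (att c0 && att c2).
    apply: contra n0 => /andP [a0 a2]; apply: thru => //; first exact: sub2.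
      by rewrite !inE negb_or u01 u04.
    by rewrite !inE negb_or eq_sym u12 u24.
  have f1 : ~~ (att c1 && att c3).
    apply: contra n1 => /andP [a0 a2]; apply: thru => //; first exact: sub2.
      by rewrite !inE negb_or u12 eq_sym u01.
    by rewrite !inE negb_or eq_sym u23 eq_sym u03.
  have f2 : ~~ (att c2 && att c4).
    apply: contra n2 => /andP [a0 a2]; apply: thru => //; first exact: sub2.
      by rewrite !inE negb_or u23 eq_sym u12.
    by rewrite !inE negb_or eq_sym u34 eq_sym u14.
  have f3 : ~~ (att c3 && att c0).
    apply: contra n3 => /andP [a0 a2]; apply: thru => //; first exact: sub2.
      by rewrite !inE negb_or u34 eq_sym u23.
    by rewrite !inE negb_or u04 u02.
  have f4 : ~~ (att c4 && att c1).
    apply: contra n4 => /andP [a0 a2]; apply: thru => //; first exact: sub2.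
      by rewrite !inE negb_or eq_sym u04 eq_sym u34.
    by rewrite !inE negb_or u13 eq_sym u01.
  have -> : #|S| = count att [:: c0; c1; c2; c3; c4].
    rewrite count_card //; apply: eq_card => c.
    by rewrite !in_set NC in_set.
  move: f0 f1 f2 f3 f4 => /=.
  by do 5 case: (att _).
have vM : v \in M by rewrite inE connect0.
have zM : z \in M.
  apply: (connected_closed (S := S) (x := v) conn) => //.
  - move=> u w uM uS wS uw.
    have uC := MC u uM; move: uC; rewrite in_setU1 negb_or => /andP [uz uN].
    have wz : w != z.
      by apply: contra uN => /eqP wz; rewrite NE inE Gsym -wz.
    have Huw : H u w by rewrite /del /= uz wz.
    have wN : w \notin N.
      apply: contra wS => wN; rewrite inE wN; apply/exists_inP; by exists u.
    move: uM; rewrite !inE => vu; apply: connect_trans vu _; apply: connect1.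
    by rewrite /avoid /= Huw !in_setU1 !negb_or uz uN wz wN.
  - by rewrite inE negb_and vN.
  by rewrite inE negb_and NE inE Girr.
by have := MC z zM; rewrite in_setU1 eqxx.
Qed.

Theorem diamond_cycle (X : {set T}) : z \notin X -> 2 < #|X| -> #|X| <= 5 ->
  exists s, [/\ uniq s, cycle H s & {subset X <= s}].
Proof.
move=> zX X3 X5; have Hsym := del_sym z Gsym; have Hirr := del_irr z Girr.
pose N := [set n | G z n].
have Nz v : v \in N -> v != z.
  by rewrite inE; apply: contraTneq => ->; rewrite Girr.
have exN v : v \in N -> [exists u, H v u] by move=> /Nz; apply: del_nbr.
have [x xX] : exists x, x \in X by apply/card_gt0P; apply: leq_trans X3.
have xz : x != z by apply: contraNneq zX => <-.
have exK : exists K, isnode H K.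
  have /existsP [u xu] := del_nbr Girr conn xz.
  by exists (clique_of H x u); apply: clique_of_node.
have ind a b c : a \in N -> b \in N -> c \in N -> a != b -> a != c -> b != c ->
    [|| H a b, H a c | H b c].
  move=> aN bN cN ab ac bc; rewrite /del /= !Nz //=.
  by move: aN bN cN; rewrite !inE => za zb zc; apply: (claw za).
have [[K1 [K2 [nK1 nK2 cov]]]|[c0 [c1 [c2 [c3 [c4 pen]]]]]] :=
  cover_or_pentagon Hsym Hirr dia del_claw exN exK ind.
  apply: (closed_cycle Gsym Girr conn dia del_claw nK1 nK2 _ zX X3 X5).
  by move=> n zn; apply: cov; rewrite inE.
have p1 := pentagon_rot pen; have p2 := pentagon_rot p1.
have p3 := pentagon_rot p2; have p4 := pentagon_rot p3.
have [k|n0] := drop_spoke erefl pen; first exact: (drop_cycle erefl pen k).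
have [k|n1] := drop_spoke erefl p1; first exact: (drop_cycle erefl p1 k).
have [k|n2] := drop_spoke erefl p2; first exact: (drop_cycle erefl p2 k).
have [k|n3] := drop_spoke erefl p3; first exact: (drop_cycle erefl p3 k).
have [k|n4] := drop_spoke erefl p4; first exact: (drop_cycle erefl p4 k).
have span := pentagon_spans erefl pen n0 n1 n2 n3 n4.
have [uc NC /and5P [h01 h12 h23 h34 h40]] := pen.
exists [:: c0; c1; c2; c3; c4]; split => //; first by rewrite /= h01 h12 h23 h34 h40.
move=> y yX; have : y \in N by apply: span; apply: contraNneq zX => <-.
by rewrite NC inE.
Qed.

End DiamondFree.

Lemma last_rev (T : Type) (x : T) s : last x (rev s) = head x s.
Proof. by case: s => //= a s; rewrite rev_cons last_rcons. Qed.

Lemma head_rev (T : Type) (x : T) s : head x (rev s) = last x s.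
Proof. by case/lastP: s => // s a; rewrite rev_rcons last_rcons. Qed.

(** * Rerouting a cycle of the completed graph *)

Section Segments.
Variables (T : finType) (H : rel T) (x : T).
Hypothesis Hsym : symmetric H.
Hypothesis Hirr : irreflexive H.
Hypothesis claw : no_claw H.
Implicit Types (s r q : seq T).

(* A segment is a piece of the cycle that is left when [x] and the new edges are
   removed; its ends are neighbours of [x]. *)
Definition segment s := [&& s != [::], sorted H s, H x (head x s) & H x (last x s)].

Definition meets s n := H (head x s) n || H (last x s) n.

Definition joinable s r := meets s (head x r) || meets s (last x r).

Lemma segment_rev s : segment s -> segment (rev s).
Proof.
move=> /and4P [s0 so ha la]; apply/and4P; split; rewrite ?head_rev ?last_rev //.
  by rewrite -size_eq0 size_rev size_eq0.
by rewrite rev_sorted (eq_sorted (e' := H)) // => u v; rewrite Hsym.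
Qed.

Lemma segment_cat s r : segment s -> segment r -> H (last x s) (head x r) ->
  segment (s ++ r).
Proof.
case: s => // a s; case: r => // b r /and4P [_ /= so ha _] /and4P [_ /= ro _ lb] ab.
apply/and4P; split=> //; first by rewrite /= cat_path so /= ab.
by rewrite /= last_cat.
Qed.

Lemma segment1 n : H x n -> segment [:: n].
Proof. by rewrite /segment /= => ->. Qed.

Lemma segment_end s n : segment s -> meets s n ->
  exists s', [/\ segment s', perm_eq s' s, H (last x s') n & head x s' \in [:: head x s; last x s]].
Proof.
move=> ss /orP [hn|ln]; last by exists s; rewrite mem_head.
exists (rev s); rewrite segment_rev // perm_rev last_rev head_rev.
by split; rewrite // !inE eqxx orbT.
Qed.

Lemma join s r : segment s -> segment r -> joinable s r ->
  exists2 q, segment q & perm_eq q (s ++ r).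
Proof.
move=> ss sr /orP [/(segment_end ss) [s' [ss' ps' hl _]]|/(segment_end ss) [s' [ss' ps' hl _]]].
  by exists (s' ++ r); [apply: segment_cat | rewrite perm_cat2r].
exists (s' ++ rev r); first by apply: segment_cat (segment_rev sr) _; rewrite // head_rev.
by apply: perm_cat => //; rewrite perm_rev.
Qed.

Lemma extend s n : segment s -> meets s n -> H x n ->
  exists s', [/\ segment s', perm_eq s' (n :: s) & last x s' = n].
Proof.
move=> ss /(segment_end ss) [s' [ss' ps' hl _]] xn; exists (rcons s' n).
rewrite last_rcons -cats1; split=> //; first by apply: segment_cat (segment1 xn) hl.
by rewrite cats1 perm_rcons perm_cons.
Qed.

Lemma joinable_last s r : meets r (last x s) -> joinable s r.
Proof.
by rewrite /joinable /meets ![H (last x s) _]Hsym => /orP [] ->; rewrite ?orbT.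
Qed.

Lemma joinableC s r : joinable s r = joinable r s.
Proof.
rewrite /joinable /meets ![H _ (head x r)]Hsym ![H _ (last x r)]Hsym.
by do 4 case: (H _ _).
Qed.

Lemma meets_last s n : H (last x s) n -> meets s n.
Proof. by rewrite /meets => ->; rewrite orbT. Qed.

(** The ends are adjacent, so the segment closes to a cycle. Apply claw-freeness at [y] to [x] and
    the two neighbours [a], [b] of [y] on the segment. If [x] is adjacent to [a] or [b], the cycle
    can be opened at [y]; otherwise the edge [a b] bypasses [y]. *)
Lemma pivot s y : segment s -> uniq (x :: s) -> y \in s -> y != head x s -> y != last x s ->
  H x y -> H (last x s) (head x s) ->
  (exists s', [/\ segment s', perm_eq s' s & last x s' = y]) \/
  (exists s', [/\ segment s', perm_eq (y :: s') s, head x s' = head x s & last x s' = last x s]).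
Proof.
move=> ss us ys yh yl xy cl.
case/splitPr: ys ss us yh yl cl => s1 s2.
case/lastP: s1 => [|s1 a]; first by rewrite /= eqxx.
case: s2 => [|b s2]; first by rewrite last_cat /= eqxx.
have sym_case t1 t2 c d : segment (rcons t1 c ++ y :: d :: t2) ->
    H (last x (rcons t1 c ++ y :: d :: t2)) (head x (rcons t1 c ++ y :: d :: t2)) ->
    H x d ->
    exists s', [/\ segment s', perm_eq s' (rcons t1 c ++ y :: d :: t2) & last x s' = y].
  move=> ss cl xd; exists ((d :: t2) ++ rcons (rcons t1 c) y).
  have pe : perm_eq ((d :: t2) ++ rcons (rcons t1 c) y) (rcons t1 c ++ y :: d :: t2).
    by rewrite perm_catC cat_rcons.
  split=> //; last by rewrite last_cat last_rcons.
  have /and4P [_ so ha la] := ss.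
  have hE : head x (rcons (rcons t1 c) y) = head x (rcons t1 c ++ y :: d :: t2) by case: (t1).
  have lE : last x (rcons t1 c ++ y :: d :: t2) = last d t2 by rewrite last_cat.
  have so1 : sorted H (rcons (rcons t1 c) y).
    by move: so; rewrite -cat_rcons => /cat_sorted2 [].
  have so2 : sorted H (d :: t2).
    by move: so; rewrite -cat_rcons => /cat_sorted2 [].
  apply: segment_cat.
  - by apply/and4P; split=> //=; rewrite -lE.
  - by apply/and4P; split=> //; [case: (t1) | rewrite hE | rewrite last_rcons].
  - by rewrite hE /= -lE.
move=> ss us _ _ cl.
have /and4P [_ so ha la] := ss.
have [hay hyb] : H a y /\ H y b.
  move: so; case: (s1) => [|e s1'] /=; first by rewrite andbA => /andP [/andP [-> ->]].
  by rewrite cat_path last_rcons /= => /and4P [_ -> ->].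
have xs : x \notin rcons s1 a ++ y :: b :: s2 by case/andP: us.
have ax : a != x by apply: contraNneq xs => <-; rewrite mem_cat mem_rcons mem_head.
have bx : b != x by apply: contraNneq xs => <-; rewrite mem_cat !inE eqxx !orbT.
have ab : a != b.
  move: us; rewrite /= cat_uniq => /and4P [_ _ /hasPn /(_ b) ne _].
  have := ne; rewrite !inE eqxx orbT => /(_ isT).
  by apply: contraNneq => <-; rewrite mem_rcons mem_head.
have yx : H y x by rewrite Hsym.
have ya : H y a by rewrite Hsym.
have := claw yx ya hyb; rewrite eq_sym ax eq_sym bx ab => /(_ isT isT isT).
case/or3P => [xa|xb|hab].
- left; have := sym_case (rev s2) (rev s1) b a.
  have E : rcons (rev s2) b ++ y :: a :: rev s1 = rev (rcons s1 a ++ y :: b :: s2).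
    by rewrite rev_cat rev_rcons !rev_cons !cat_rcons.
  rewrite E segment_rev // head_rev last_rev Hsym => /(_ isT cl xa) [s' [? ps' ?]].
  by exists s'; split=> //; apply: perm_trans ps' _; rewrite perm_rev.
- by left; apply: sym_case.
right; exists (rcons s1 a ++ b :: s2); split.
- apply/and4P; split.
  + by case: (s1).
  + move: so; case: (s1) => [|e s1'] /=; first by rewrite hab => /and3P [].
    by rewrite !cat_path last_rcons /= hab => /and4P [-> _ _ ->].
  + by move: ha; case: (s1).
  + by move: la; rewrite !last_cat.
- by rewrite -cat1s perm_catCA.
- by case: (s1).
- by rewrite !last_cat.
Qed.

(** The new segment may pick up further neighbours of [x], hence an inclusion and not a
    permutation. *)
Definition covers s r := exists q, [/\ segment q, uniq (x :: q) & {subset s ++ r <= q}].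

Lemma seg_head s : segment s -> head x s \in s.
Proof. by case: s => // a s _; rewrite mem_head. Qed.

Lemma seg_last s : segment s -> last x s \in s.
Proof. by case: s => // a s _; rewrite /= mem_last. Qed.

Lemma seg_hd s : segment s -> H x (head x s). Proof. by case/and4P. Qed.
Lemma seg_lt s : segment s -> H x (last x s). Proof. by case/and4P. Qed.

Lemma cat_neq s r a b : uniq (s ++ r) -> a \in s -> b \in r -> a != b.
Proof.
rewrite cat_uniq => /and3P [_ /hasPn sr _] aS bR.
by apply: contraNneq (sr b bR) => <-.
Qed.

Lemma joinablePn s r : ~~ joinable s r ->
  [/\ ~~ H (head x s) (head x r), ~~ H (last x s) (head x r),
      ~~ H (head x s) (last x r) & ~~ H (last x s) (last x r)].
Proof. by rewrite /joinable /meets !negb_or => /andP [/andP [-> ->] /andP [-> ->]]. Qed.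

Lemma join_covers s r : segment s -> segment r -> uniq (x :: s ++ r) -> joinable s r ->
  covers s r.
Proof.
move=> ss sr us /(join ss sr) [q sq pq]; exists q; split=> //.
  by rewrite (perm_uniq (s2 := x :: s ++ r)) // perm_cons.
by move=> a; rewrite (perm_mem pq).
Qed.

Lemma covers_sub s r s' r' : {subset s ++ r <= s' ++ r'} -> covers s' r' -> covers s r.
Proof. by move=> sub [q [sq uq cq]]; exists q; split=> // a /sub /cq. Qed.

Lemma coversC s r : covers s r -> covers r s.
Proof. by apply: covers_sub => a; rewrite !mem_cat orbC. Qed.

(** Claw-freeness at [x], applied to the two ends of [s] and the head of [r]. *)
Lemma ends_adjacent s r y : segment s -> segment r -> uniq (s ++ r) -> ~~ joinable s r ->
  y \in s -> y != head x s -> H (last x s) (head x s).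
Proof.
move=> ss sr us /joinablePn [n1 n2 _ _] ys yh.
have lh : last x s != head x s.
  case: s ss us ys yh {n1 n2} => // a s _; rewrite cat_uniq inE => /= /andP [/andP [as_ _] _].
  case/predU1P => [->|ys _]; first by rewrite eqxx.
  by apply: contraNneq as_ => <-; case: s ys => // b s _; rewrite /= mem_last.
have := claw (seg_lt ss) (seg_hd ss) (seg_hd sr) lh.
rewrite (cat_neq us (seg_last ss) (seg_head sr)) (cat_neq us (seg_head ss) (seg_head sr)).
by rewrite (negbTE n1) (negbTE n2) !orbF; apply.
Qed.

(** The segment [s] is rearranged to end in [n], by appending [n] or, if [n] is inside [s], by
    [pivot]; it can then be joined to [r]. *)
Lemma common_neighbour_covers_out s r n : segment s -> segment r -> uniq (x :: s ++ r) -> ~~ joinable s r ->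
  H x n -> meets s n -> meets r n -> n \notin r -> covers s r.
Proof.
move=> ss sr us nj xn sn rn nr; have [xsr usr] : x \notin s ++ r /\ uniq (s ++ r) by apply/andP.
have finish s3 : segment s3 -> last x s3 = n -> uniq (x :: s3 ++ r) -> {subset s <= s3} -> covers s r.
  move=> ss3 l3 us3 sub; apply: (@covers_sub _ _ s3 r).
    by move=> a; rewrite !mem_cat => /orP [/sub ->|->]; rewrite ?orbT.
  by apply: join_covers => //; apply: joinable_last; rewrite l3.
have uperm s3 : perm_eq s3 s -> uniq (x :: s3 ++ r).
  by move=> p3; rewrite (perm_uniq (s2 := x :: s ++ r)) // perm_cons perm_cat2r.
have [ns|ns] := boolP (n \in s); last first.
  have [s3 [ss3 p3 l3]] := extend ss sn xn; apply: (finish s3) => //.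
    rewrite (perm_uniq (s2 := [:: x, n & s ++ r])) ?perm_cons -?cat_cons ?perm_cat2r //.
    rewrite !cons_uniq inE negb_or xsr mem_cat negb_or ns nr usr !andbT.
    by apply: contraTneq xn => <-; rewrite Hirr.
  by move=> a aS; rewrite (perm_mem p3) inE aS orbT.
have nh : n != head x s.
  by apply: contraNneq nj => nE; rewrite joinableC /joinable -nE rn.
have nl : n != last x s.
  by apply: contraNneq nj => nE; rewrite joinableC /joinable -nE rn orbT.
have us' : uniq (x :: s).
  by move: us; rewrite /= mem_cat negb_or cat_uniq => /andP [/andP [-> _] /andP [-> _]].
have cl := ends_adjacent ss sr usr nj ns nh.
case: (pivot ss us' ns nh nl xn cl) => [[s3 [ss3 p3 l3]]|[s2 [ss2 p2 h2 l2]]].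
  by apply: (finish s3) => //; [apply: uperm | move=> a; rewrite (perm_mem p3)].
have sn2 : meets s2 n by rewrite /meets h2 l2.
have [s3 [ss3 p3 l3]] := extend ss2 sn2 xn; have p3s := perm_trans p3 p2.
by apply: (finish s3) => //; [apply: uperm | move=> a; rewrite (perm_mem p3s)].
Qed.

Lemma common_neighbour_covers s r n : segment s -> segment r -> uniq (x :: s ++ r) ->
  H x n -> meets s n -> meets r n -> covers s r.
Proof.
move=> ss sr us xn sn rn.
have [j|nj] := boolP (joinable s r); first exact: join_covers.
have [nr|nr] := boolP (n \in r); last exact: common_neighbour_covers_out nr.
apply: coversC; apply: (common_neighbour_covers_out (n := n)) => //.
- by rewrite (perm_uniq (s2 := x :: s ++ r)) // perm_cons perm_catC.
- by rewrite joinableC.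
by apply/negP => ns; move: us; rewrite /= cat_uniq => /and4P [_ _ /hasPn /(_ n nr) /negP].
Qed.

(** The neighbourhood of [x] is connected: an edge crosses each of its bipartitions. *)
Hypothesis nconn : forall Y : {set T}, (exists2 a, H x a & a \in Y) ->
  (exists2 b, H x b & b \notin Y) ->
  exists a b, [/\ H x a, H x b, a \in Y, b \notin Y & H a b].

(** [Y] holds the ends of [s] and their neighbours. Of an edge [y y'] leaving [Y], the vertex [y] is
    adjacent to an end of [s], and claw-freeness at [x] makes [y'] the head of [r] or adjacent to
    it. Once [s] is rearranged to end in [y], the vertex [y'] is a common neighbour; the cases
    depend on whether [y] lies on [s], on [r] or on neither. *)
Lemma two_segments s r : segment s -> segment r -> uniq (x :: s ++ r) -> covers s r.
Proof.
move=> ss sr us; have [xsr usr] : x \notin s ++ r /\ uniq (s ++ r) by apply/andP.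
have [j|nj] := boolP (joinable s r); first exact: join_covers.
have [n1 n2 n3 n4] := joinablePn nj.
pose Y := [set n | (n == head x s) || (n == last x s) || meets s n].
have [||y [y' [xy xy' yY y'Y yy']]] := nconn (Y := Y).
- by exists (head x s); rewrite ?seg_hd // inE eqxx.
- exists (head x r); rewrite ?seg_hd // inE !negb_or (negbTE n1) (negbTE n2) andbT.
  by rewrite !(eq_sym (head x r)) (cat_neq usr (seg_head ss)) ?(cat_neq usr (seg_last ss)) ?seg_head.
move: y'Y; rewrite inE !negb_or => /andP [/andP [y'h y'l] /andP [nh nl]].
have [yh yl] : y != head x s /\ y != last x s.
  by split; [apply: contraNneq nh => <-| apply: contraNneq nl => <-].
have sy : meets s y by move: yY; rewrite inE (negbTE yh) (negbTE yl).
have [yE|y'hr] := eqVneq y' (head x r).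
  by apply: (common_neighbour_covers (n := y)) => //; rewrite /meets -yE Hsym yy'.
have ry' : meets r y'.
  have := claw (seg_hd ss) (seg_hd sr) xy' (cat_neq usr (seg_head ss) (seg_head sr)).
  rewrite eq_sym y'h eq_sym y'hr (negbTE n1) (negbTE nh) /meets /= => -> //.
have finish s3 r3 : segment s3 -> segment r3 -> last x s3 = y -> meets r3 y' ->
    uniq (x :: s3 ++ r3) -> {subset s ++ r <= s3 ++ r3} -> covers s r.
  move=> ss3 sr3 l3 m3 us3 sub; apply: covers_sub sub _.
  by apply: (common_neighbour_covers (n := y')) => //; apply: meets_last; rewrite l3.
have yx : x != y by apply: contraTneq xy => <-; rewrite Hirr.
have us' : uniq (x :: s).
  by move: us; rewrite /= mem_cat negb_or cat_uniq => /andP [/andP [-> _] /andP [-> _]].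
have ur' : uniq (x :: r).
  by move: us; rewrite /= mem_cat negb_or cat_uniq => /andP [/andP [_ ->] /and3P [_ _ ->]].
have [ys|ys] := boolP (y \in s).
  have fin s3 : segment s3 -> perm_eq s3 s -> last x s3 = y -> covers s r.
    move=> ss3 p3 l3; apply: (finish s3 r) => //.
      by rewrite (perm_uniq (s2 := x :: s ++ r)) // perm_cons perm_cat2r.
    by move=> a; rewrite !mem_cat (perm_mem p3).
  have cl := ends_adjacent ss sr usr nj ys yh.
  case: (pivot ss us' ys yh yl xy cl) => [[s3 [ss3 p3 l3]]|[s2 [ss2 p2 h2 l2]]].
    exact: (fin s3).
  have sy2 : meets s2 y by rewrite /meets h2 l2.
  have [s3 [ss3 p3 l3]] := extend ss2 sy2 xy.
  by apply: (fin s3) => //; apply: perm_trans p3 p2.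
have [yr|yr] := boolP (y \in r); last first.
  have [s3 [ss3 p3 l3]] := extend ss sy xy; apply: (finish s3 r) => //.
    rewrite (perm_uniq (s2 := [:: x, y & s ++ r])) ?perm_cons -?cat_cons ?perm_cat2r //.
    by rewrite !cons_uniq inE negb_or xsr mem_cat negb_or ys yr usr yx.
  by move=> a; rewrite !mem_cat (perm_mem p3) inE => /orP [] ->; rewrite ?orbT.
have yhr : y != head x r by apply: contraNneq nj => yE; rewrite /joinable -yE sy.
have ylr : y != last x r by apply: contraNneq nj => yE; rewrite /joinable -yE sy orbT.
have usr' : uniq (r ++ s) by rewrite (perm_uniq (s2 := s ++ r)) // perm_catC.
have njC : ~~ joinable r s by rewrite joinableC.
have cl := ends_adjacent sr ss usr' njC yr yhr.
case: (pivot sr ur' yr yhr ylr xy cl) => [[r3 [sr3 p3 l3]]|[r2 [sr2 p2 h2 l2]]].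
  apply: (@covers_sub _ _ s r3).
    by move=> a; rewrite !mem_cat (perm_mem p3).
  apply: join_covers => //; last by rewrite joinableC; apply: joinable_last; rewrite l3.
  by rewrite (perm_uniq (s2 := x :: s ++ r)) // perm_cons perm_cat2l.
have [s3 [ss3 p3 l3]] := extend ss sy xy.
have pe : perm_eq (s3 ++ r2) (s ++ r).
  apply: (@perm_trans _ (s ++ (y :: r2))); last by rewrite perm_cat2l.
  apply: (@perm_trans _ ((y :: s) ++ r2)); first by rewrite perm_cat2r.
  by rewrite -[(y :: s) ++ r2]/([:: y] ++ s ++ r2) perm_catCA.
apply: (finish s3 r2) => //.
- by rewrite /meets h2 l2.
- by rewrite (perm_uniq (s2 := x :: s ++ r)) // perm_cons.
by move=> a; rewrite (perm_mem pe).
Qed.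

(** The heads of three segments are neighbours of [x], so two are adjacent and their segments can be
    joined; [two_segments] finishes. *)
Lemma merge_segments n (ss : seq (seq T)) : size ss <= n -> 0 < size ss -> all segment ss ->
  uniq (x :: flatten ss) ->
  exists q, [/\ segment q, uniq (x :: q) & {subset flatten ss <= q}].
Proof.
elim: n ss => [|n IH] [|s1 [|s2 [|s3 ss]]] //= sz _.
- by rewrite cats0 andbT => ss1 us; exists s1; split.
- by rewrite cats0 => /and3P [ss1 ss2 _] us; apply: two_segments.
case/and4P => g1 g2 g3 gs us.
have us' : uniq (x :: s1 ++ s2 ++ s3 ++ flatten ss) by [].
have merge2 a b rest : segment a -> segment b -> all segment rest -> H (head x a) (head x b) ->
    size rest <= n.-1 -> 0 < n -> perm_eq (a ++ b ++ flatten rest) (s1 ++ s2 ++ s3 ++ flatten ss) ->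
    exists q, [/\ segment q, uniq (x :: q) & {subset s1 ++ s2 ++ s3 ++ flatten ss <= q}].
  move=> ga gb gr hab szr n0 pe.
  have jab : joinable a b by rewrite /joinable /meets hab.
  have [q gq pq] := join ga gb jab.
  have pe' : perm_eq (flatten (q :: rest)) (s1 ++ s2 ++ s3 ++ flatten ss).
    by apply: perm_trans pe; rewrite /= catA perm_cat2r.
  have u' : uniq (x :: flatten (q :: rest)).
    by rewrite (perm_uniq (s2 := x :: s1 ++ s2 ++ s3 ++ flatten ss)) // perm_cons.
  have z' : size (q :: rest) <= n by case: (n) n0 szr.
  have g' : all segment (q :: rest) by rewrite /= gq.
  have [q' [gq' uq' sq']] := IH _ z' isT g' u'.
  by exists q'; split=> // a'; rewrite -(perm_mem pe') => /sq'.
have n0 : 0 < n by case: (n) sz.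
have szs : size (s3 :: ss) <= n.-1 by case: (n) sz.
have neq a b u v w : perm_eq (a ++ b ++ w) (s1 ++ s2 ++ s3 ++ flatten ss) ->
    u \in a -> v \in b -> u != v.
  move=> pe ua vb; have /andP [_] := us; rewrite -(perm_uniq pe) catA cat_uniq.
  by case/andP => uab _; apply: cat_neq uab ua vb.
have p12 : perm_eq (s1 ++ s2 ++ (s3 ++ flatten ss)) (s1 ++ s2 ++ s3 ++ flatten ss) by [].
have p13 : perm_eq (s1 ++ s3 ++ (s2 ++ flatten ss)) (s1 ++ s2 ++ s3 ++ flatten ss).
  by rewrite perm_cat2l perm_catCA.
have p23 : perm_eq (s2 ++ s3 ++ (s1 ++ flatten ss)) (s1 ++ s2 ++ s3 ++ flatten ss).
  by rewrite [in X in perm_eq X _]catA perm_catCA -!catA.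
have := claw (seg_hd g1) (seg_hd g2) (seg_hd g3).
rewrite (neq _ _ _ _ _ p12 (seg_head g1) (seg_head g2)).
rewrite (neq _ _ _ _ _ p13 (seg_head g1) (seg_head g3)).
rewrite (neq _ _ _ _ _ p23 (seg_head g2) (seg_head g3)).
case/(_ isT isT isT)/or3P => h.
- by apply: (merge2 s1 s2 (s3 :: ss)) => //=; rewrite g3.
- by apply: (merge2 s1 s3 (s2 :: ss)) => //=; rewrite g2.
by apply: (merge2 s2 s3 (s1 :: ss)) => //=; rewrite g1.
Qed.

Definition complete_at : rel T :=
  [rel u v | H u v || [&& u != v, (u == x) || H x u & (v == x) || H x v]].

Lemma complete_out u v : complete_at u v -> ~~ H u v -> u != x -> v != x -> H x u /\ H x v.
Proof.
by rewrite /complete_at /= => /orP [-> //|/and3P [_ xu xv] _ /negbTE ux /negbTE vx];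
  move: xu xv; rewrite ux vx.
Qed.

Lemma complete_x v : complete_at x v -> H x v.
Proof.
rewrite /complete_at /= => /orP [//|/and3P [xv _]].
by rewrite eq_sym (negbTE xv).
Qed.

Lemma complete_sym : symmetric complete_at.
Proof. by move=> u v; rewrite /complete_at /= Hsym eq_sym [X in _ && X]andbC. Qed.

(** The induction is on a bound for the length, since passing [x] consumes two vertices at once. The
    vertices next to [x] on the path are old neighbours, as completion adds no edge at [x]. *)
Lemma split_path m a s : size s <= m -> path complete_at a s -> uniq (a :: s) -> a != x ->
  H x (last a s) ->
  exists s1 ss, [/\ path H a s1, H x (last a s1), all segment ss &
    (a :: s1) ++ flatten ss = [seq y <- a :: s | y != x]].
Proof.
elim: m a s => [|m IH] a [|b s] //= sz.
  by move=> _ _ ax xa; exists [::], [::]; rewrite /= ax.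
  by move=> _ _ ax xa; exists [::], [::]; rewrite /= ax.
case/andP => ab bs us ax xl; rewrite ax.
have [bx|bx] := eqVneq b x; last first.
  have [|||||s1 [ss [p1 l1 gs fE]]] := IH b s => //; first by case/andP: us.
  have [hab|hab] := boolP (H a b).
    by exists (b :: s1), ss; rewrite /= hab; split=> //; move: fE; rewrite /= bx => -[->].
  have [xa xb] := complete_out ab hab ax bx.
  exists [::], ((b :: s1) :: ss); split => //=; last by move: fE; rewrite /= bx => -[->].
  by rewrite gs andbT; apply/and4P.
subst b; case: s bs us xl sz => [|d s] /=; first by rewrite Hirr.
case/andP => xd ds us xl sz.
have hxd := complete_x xd.
have dx : d != x by apply: contraTneq hxd => ->; rewrite Hirr.
have [|||||s1 [ss [p1 l1 gs fE]]] := IH d s => //.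
- exact: ltnW.
- by case/and3P: us.
exists [::], ((d :: s1) :: ss); split => //=.
- by apply: complete_x; rewrite complete_sym.
- by rewrite gs andbT; apply/and4P.
by move: fE; rewrite /= ?eqxx dx => -[->].
Qed.

Lemma path_break (e : rel T) a s : path e a s -> ~~ path H a s ->
  exists s1 b s2, [/\ s = s1 ++ b :: s2, e (last a s1) b & ~~ H (last a s1) b].
Proof.
elim: s a => //= b s IH a /andP [ab bs]; have [hab|hab] := boolP (H a b); last first.
  by move=> _; exists [::], b, s.
by move=> /= /(IH _ bs) [s1 [c [s2 [-> ? ?]]]]; exists (b :: s1), c, s2.
Qed.

Theorem lift_cycle c : uniq c -> 2 < size c -> cycle complete_at c ->
  exists c', [/\ uniq c', cycle H c' & {subset c <= c'}].
Proof.
case: c => // a s us sz cs.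
have [ch|nch] := boolP (cycle H (a :: s)); first by exists (a :: s); split.
have [s1 [b [s2 [sE eb nb]]]] := path_break cs nch.
(* The cycle is rotated so that an added edge leads from its last vertex to its first; the path in
   between then splits into segments. *)
have [w [r [pr lr pe]]] : exists w r, [/\ path complete_at w r,
    complete_at (last w r) w && ~~ H (last w r) w & perm_eq (w :: r) (a :: s)].
  case/lastP: s2 sE => [|s2 a'] sE.
    move: sE; rewrite cats1 => /rcons_inj [sE bE]; subst s1 b.
    exists a, s; split; [|by rewrite eb | by []].
    by move: cs; rewrite /= rcons_path => /andP [].
  move: sE; rewrite -rcons_cons -rcons_cat => /rcons_inj [sE aE]; subst a'.
  exists b, (s2 ++ a :: s1); split.
  - move: cs; rewrite /= sE rcons_path cat_path /= last_cat /=.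
    by case/andP => /and3P [p1 _ p2] la; rewrite cat_path p2 /= la.
  - by rewrite last_cat /= eb.
  - rewrite sE -[b :: _ ++ _]/((b :: s2) ++ (a :: s1)) perm_catC.
    by rewrite -[a :: s1 ++ _]/((a :: s1) ++ _).
have /andP [lw nlw] := lr.
have ur : uniq (w :: r) by rewrite (perm_uniq pe).
have lwn : last w r != w.
  apply: contraTneq lw => lE; rewrite lE in nlw *.
  by rewrite /complete_at /= (negbTE nlw) eqxx.
have wx : w != x.
  by apply: contraNneq nlw => wE; subst w; rewrite Hsym; apply: complete_x; rewrite complete_sym.
have lx : last w r != x.
  by apply: contraNneq nlw => lE; rewrite lE in lw *; apply: complete_x.
have [xl xw] := complete_out lw nlw lx wx.
have [s3 [ss [p3 l3 gs fE]]] := split_path (leqnn _) pr ur wx xl.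
have g3 : segment (w :: s3) by apply/and4P.
have uf : uniq (x :: flatten ((w :: s3) :: ss)).
  by rewrite [flatten _]fE cons_uniq mem_filter eqxx filter_uniq.
have [||q [gq uq sq]] := merge_segments (leqnn _) _ _ uf => //=; first by rewrite g3.
(* The merged segment is closed through [x]. *)
exists (x :: q); have sub : {subset a :: s <= x :: q}.
  move=> y; rewrite -(perm_mem pe) => yr; rewrite in_cons; have [//|yx /=] := eqVneq y x.
  by apply: sq; rewrite [flatten _]fE mem_filter yx.
split=> //; case: q gq uq sub {sq} => // d q /and4P [_ /= so hd lq] _ _ /=.
by rewrite hd rcons_path so Hsym.
Qed.

End Segments.

(** Two leaves in the closed neighbourhood [N] of [x] are adjacent. So if [v] is in [N], two leaves
    lie outside, their edges to [v] are old, and claw-freeness of [G] at [v] with [x] as third leaf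
    makes them adjacent. If [v] is not in [N], all its edges are old. *)
Lemma complete_no_claw (T : finType) (G : rel T) x :
  symmetric G -> irreflexive G -> no_claw G -> no_claw (complete_at G x).
Proof.
move=> Gsym Girr claw v a b c va vb vc ab ac bc.
pose N u := (u == x) || G x u.
have inN u w : u != w -> N u -> N w -> complete_at G x u w.
  by rewrite /complete_at /= /N => -> -> ->; rewrite orbT.
have old u w : complete_at G x u w -> ~~ (N u && N w) -> G u w.
  by rewrite /complete_at /= => /orP [//|/and3P [_ Nu Nw]]; rewrite /N Nu Nw.
have sub u w : G u w -> complete_at G x u w by rewrite /complete_at /= => ->.
have out u w : complete_at G x v u -> complete_at G x v w -> u != w ->
    ~~ N u -> ~~ N w -> N v -> complete_at G x u w.
  move=> vu vw uw nu nw Nv.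
  have Gvu : G v u by apply: old vu _; rewrite negb_and nu orbT.
  have Gvw : G v w by apply: old vw _; rewrite negb_and nw orbT.
  have vx : G x v.
    move: Nv; rewrite /N => /orP [/eqP vE|//]; subst v.
    by move: nu; rewrite /N Gvu orbT.
  move: nu nw; rewrite /N !negb_or => /andP [ux xu] /andP [wx xw].
  have vx' : G v x by rewrite Gsym.
  have := claw v x u w vx' Gvu Gvw; rewrite eq_sym ux eq_sym wx uw.
  by rewrite (negbTE xu) (negbTE xw) => /(_ isT isT isT) /sub.
have [Nv|Nv] := boolP (N v); last first.
  have Gv u : complete_at G x v u -> G v u by move=> vu; apply: old vu _; rewrite negb_and Nv.
  have := claw v a b c (Gv _ va) (Gv _ vb) (Gv _ vc) ab ac bc.
  by case/or3P => /sub ->; rewrite ?orbT.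
have [Na|Na] := boolP (N a); have [Nb|Nb] := boolP (N b).
- by rewrite inN.
- have [Nc|Nc] := boolP (N c); first by rewrite [complete_at G x a c]inN ?orbT.
  by rewrite (out b c) ?orbT.
- have [Nc|Nc] := boolP (N c); first by rewrite [complete_at G x b c]inN ?orbT.
  by rewrite (out a c) ?orbT.
by rewrite (out a b).
Qed.

Lemma k_connected_sub (T : finType) k (G G' : rel T) :
  subrel G G' -> k_connected k G -> k_connected k G'.
Proof.
move=> sub [kT con]; split=> // S Sk x y xS yS.
apply: connect_sub (con S Sk x y xS yS) => u v /and3P [uS vS uv].
by apply: connect1; rewrite /= uS vS sub.
Qed.

Theorem cycle_avoiding (T : finType) (G : rel T) (z : T) (X : {set T}) :
  symmetric G -> irreflexive G -> k_connected 3 G -> no_claw G ->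
  z \notin X -> 2 < #|X| -> #|X| <= 5 ->
  exists s, [/\ uniq s, cycle (del G z) s & {subset X <= s}].
Proof.
move=> Gsym Girr conn claw zX X3 X5.
(* The measure is the number of non-adjacent pairs; completing at a diamond joins its pair [a],
   [b]. *)
have [n] := ubnP #|[set p : T * T | ~~ G p.1 p.2]|.
elim: n G Gsym Girr conn claw => // n IH G Gsym Girr conn claw lt_n.
have [|nodia] := boolP [exists u, [exists v, [exists a, [exists b,
    [&& del G z u v, del G z u a, del G z u b, del G z v a, del G z v b, a != b & ~~ del G z a b]]]]];
  last first.
  apply: diamond_cycle => // u v a b uv ua ub va vb ab; apply/negPn/negP => nab.
  case/negP: nodia; apply/existsP; exists u; apply/existsP; exists v.
  by apply/existsP; exists a; apply/existsP; exists b; apply/and5P; split; rewrite // vb ab.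
case/existsP => u /existsP [v /existsP [a /existsP [b]]].
case/and5P => uv ua ub va /and3P [vb ab nab].
set H := del G z in uv ua ub va vb nab *.
have Hsym : symmetric H := del_sym z Gsym.
have Hirr : irreflexive H := del_irr z Girr.
have Hclaw : no_claw H := del_claw (z := z) claw.
have uz : u != z by case/and3P: uv.
have G's : symmetric (complete_at G u).
  exact: complete_sym.
have G'i : irreflexive (complete_at G u).
  by move=> w; rewrite /complete_at /= Girr eqxx.
have sub : subrel G (complete_at G u) by move=> w w' ww'; rewrite /complete_at /= ww'.
have nGab : ~~ G a b.
  by apply: contra nab => Gab; case/and3P: ua => _ az _; case/and3P: ub => _ bz _; rewrite /H /del /= az bz.
have lt' : #|[set p : T * T | ~~ complete_at G u p.1 p.2]| < n.
  rewrite ltnS in lt_n; apply: leq_trans lt_n; apply: proper_card; apply/properP; split.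
    by apply/subsetP => p; rewrite !inE; apply: contra; apply: sub.
  exists (a, b); rewrite inE //= /complete_at /= ab negbK.
  by case/and3P: ua => _ _ ->; case/and3P: ub => _ _ ->; rewrite !orbT.
have [c [uc cc Xc]] := IH _ G's G'i (k_connected_sub sub conn)
  (complete_no_claw (x := u) Gsym Girr claw) lt'.
have E : del (complete_at G u) z =2 complete_at H u.
  move=> w w'; rewrite /H /complete_at /del /= uz /=.
  have [->|wz] := eqVneq w z; first by rewrite [z == u]eq_sym (negbTE uz) /= ?andbF.
  by have [->|w'z] := eqVneq w' z; first by rewrite [z == u]eq_sym (negbTE uz) /= ?andbF.
rewrite (eq_cycle E) in cc.
(* By claw-freeness at [u] each further neighbour of [u] is adjacent to [a] or [b], and [v] is
   adjacent to both. *)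
have nconn (Y : {set T}) : (exists2 p, H u p & p \in Y) -> (exists2 q, H u q & q \notin Y) ->
    exists p q, [/\ H u p, H u q, p \in Y, q \notin Y & H p q].
  move=> [p up pY] [q uq qY].
  have near w : H u w -> w != a -> w != b -> H a w || H b w.
    move=> uw wa wb; have := Hclaw u a b w ua ub uw ab.
    by rewrite eq_sym wa eq_sym wb (negbTE nab) /=; apply.
  have [aY|aY] := boolP (a \in Y); have [bY|bY] := boolP (b \in Y).
  - have qa : q != a by apply: contraNneq qY => ->.
    have qb : q != b by apply: contraNneq qY => ->.
    by case/orP: (near q uq qa qb) => h; [exists a, q | exists b, q].
  - have [vY|vY] := boolP (v \in Y); first by exists v, b.
    by exists a, v; rewrite [H a v]Hsym.
  - have [vY|vY] := boolP (v \in Y); first by exists v, a.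
    by exists b, v; rewrite [H b v]Hsym.
  have pa : p != a by apply: contraNneq aY => <-.
  have pb : p != b by apply: contraNneq bY => <-.
  by case/orP: (near p up pa pb) => h; [exists p, a | exists p, b]; rewrite [H p _]Hsym.
have c3 : 2 < size c.
  apply: leq_trans X3 _; rewrite -(card_uniqP uc); apply/subset_leq_card/subsetP.
  exact: Xc.
have [c' [uc' cc' sc']] := lift_cycle Hsym Hirr Hclaw nconn uc c3 cc.
by exists c'; split=> // y /Xc /sc'.
Qed.

(** * Menger's theorem and fans *)

Lemma flatten_uniqP (T : eqType) (ps : seq (seq T)) : uniq (flatten ps) ->
  (forall p, p \in ps -> uniq p) /\
  (forall p q v, p \in ps -> q \in ps -> v \in p -> v \in q -> p = q).
Proof.
elim: ps => [|p ps IH] //=; rewrite cat_uniq => /and3P [up /hasPn dis /IH [us ds]].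
split=> [q|q r v]; first by rewrite inE => /predU1P [->|/us].
have out q' : q' \in ps -> v \in p -> v \in q' -> False.
  move=> q'ps vp vq'; have vf : v \in flatten ps by apply/flattenP; exists q'.
  by move: (dis v vf); rewrite /= vp.
rewrite !inE => /predU1P [->|qps] /predU1P [->|rps] // vq vr.
- by case: (out r).
- by case: (out q).
- exact: (ds q r v).
Qed.

Lemma uniq_flatten (T : eqType) (ps : seq (seq T)) :
  all (fun p => p != [::]) ps -> uniq (flatten ps) -> uniq ps.
Proof.
elim: ps => //= p ps IH /andP [pn ne]; rewrite cat_uniq => /and3P [_ /hasPn dis uf].
rewrite IH // andbT; apply/negP => pps; case: p pn pps dis => // a s _ pps dis.
have /dis : a \in flatten ps by apply/flattenP; exists (a :: s); rewrite ?mem_head.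
by rewrite /= mem_head.
Qed.

Lemma uniq_flatten_map (S T : eqType) (g : S -> seq T) (ps : seq S) : uniq ps ->
  (forall p, p \in ps -> uniq (g p)) ->
  (forall p q v, p \in ps -> q \in ps -> v \in g p -> v \in g q -> p = q) ->
  uniq (flatten (map g ps)).
Proof.
elim: ps => [|p ps IH] //= /andP [pps ups] ug dg; rewrite cat_uniq ug ?mem_head //=.
apply/andP; split; last first.
  apply: IH => // [q qps|q r v qps rps]; first by apply: ug; rewrite inE qps orbT.
  by apply: dg; rewrite inE ?qps ?rps orbT.
apply/hasPn => v /flattenP [_ /mapP [q qps ->] vq]; apply: contra pps => vp.
by rewrite (dg p q v) ?mem_head // inE qps orbT.
Qed.

Section Menger.
Variable T : finType.
Implicit Types (G : rel T) (A B S C : {set T}) (p q : seq T).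

Definition set_path G A B p :=
  if p is a :: s then [&& a \in A, path G a s & last a s \in B] else false.

Definition separates G A B S := forall p, set_path G A B p -> has [in S] p.

Definition linkage G A B ps := all (set_path G A B) ps && uniq (flatten ps).

Lemma set_path_cat G A B p1 v p2 : set_path G A B (p1 ++ v :: p2) ->
  set_path G A [set v] (rcons p1 v) /\ set_path G [set v] B (v :: p2).
Proof.
case: p1 => [|a p1] /=; first by rewrite !inE eqxx => /andP [-> ->].
rewrite cat_path last_cat rcons_path last_rcons /= !inE !eqxx.
by case/and3P => -> /and3P [-> -> ->] ->.
Qed.

Lemma set_path_glue G A B p1 v p2 : set_path G A [set v] (rcons p1 v) ->
  set_path G [set v] B (v :: p2) -> set_path G A B (p1 ++ v :: p2).
Proof.
case: p1 => [|a p1] /=; first by move=> /andP [-> _] /andP [_ ->].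
rewrite rcons_path last_rcons cat_path last_cat /=.
by case/and3P => -> /andP [-> ->] _ /and3P [_ -> ->].
Qed.

Lemma set_path_sub G A B C p : {subset B <= C} -> set_path G A B p -> set_path G A C p.
Proof. by move=> BC; case: p => //= a s /and3P [-> -> /BC ->]. Qed.

Lemma first_hit G A B C p : set_path G A B p -> has [in C] p ->
  exists p1 v p2, [/\ p = p1 ++ v :: p2, v \in C & ~~ has [in C] p1].
Proof. by move=> _ /split_find [v p1 p2 vC nC]; exists p1, v, p2; rewrite cat_rcons. Qed.

Lemma last_hit C p : has [in C] p ->
  exists p1 v p2, [/\ p = p1 ++ v :: p2, v \in C & ~~ has [in C] p2].
Proof.
rewrite -has_rev -{2}(revK p) => /split_find [v p1 p2 vC nC].
exists (rev p2), v, (rev p1); split=> //; last by rewrite has_rev.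
by rewrite rev_cat rev_rcons.
Qed.

Definition truncated C p := exists p1 v, [/\ p = rcons p1 v, v \in C & ~~ has [in C] p1].

Lemma linkage_truncate G A C ps : linkage G A C ps ->
  exists qs, [/\ linkage G A C qs, size qs = size ps & forall q, q \in qs -> truncated C q].
Proof.
case/andP => /allP pP up; pose f p := take (find [in C] p).+1 p.
have fP p : p \in ps -> set_path G A C (f p) /\ truncated C (f p).
  move=> /pP pC; have hC : has [in C] p.
    case: p pC => // a s /and3P [_ _ lC]; apply/hasP; exists (last a s) => //.
    exact: mem_last.
  have [p1 [v [p2 [pE vC nC]]]] := first_hit pC hC.
  have fE : f p = rcons p1 v.
    rewrite /f pE find_cat (negbTE nC) /= vC addn0 -cat_rcons.
    by rewrite -[in X in take X _](size_rcons p1 v) take_size_cat.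
  rewrite fE; split; last by exists p1, v.
  rewrite pE in pC; have [h _] := set_path_cat pC.
  by apply: set_path_sub h => w; rewrite inE => /eqP ->.
exists (map f ps); split; last 2 first.
- by rewrite size_map.
- by move=> _ /mapP [p /fP [_ h] ->].
apply/andP; split; first by apply/allP => _ /mapP [p /fP [h _] ->].
apply: subseq_uniq up; elim: (ps) => //= p ps' IH.
by apply: cat_subseq IH; apply: take_subseq.
Qed.

Definition reverse_rel G : rel T := [rel u v | G v u].

Lemma set_path_rev G A B p : set_path G A B p = set_path (reverse_rel G) B A (rev p).
Proof.
case/lastP: p => // p b; rewrite rev_rcons /=.
case: p => [|a p] /=; first by rewrite andbC.
rewrite last_rcons rev_cons last_rcons; have := rev_path (reverse_rel G) a (rcons p b).
rewrite last_rcons belast_rcons rev_cons => <-.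
by rewrite andbCA andbA andbC.
Qed.

Lemma linkage_rev G A B ps : linkage G A B ps -> linkage (reverse_rel G) B A (map rev ps).
Proof.
case/andP => /allP pP up; apply/andP; split.
  by apply/allP => _ /mapP [p /pP h ->]; rewrite -set_path_rev.
rewrite (perm_uniq (s2 := flatten ps)) //.
by elim: (ps) => //= p ps' IH; rewrite perm_cat // perm_rev.
Qed.

(** Disjoint paths have distinct last vertices, and there are as many of them as elements of [C]. *)
Lemma linkage_ends G A C ps : linkage G A C ps -> size ps = #|C| ->
  forall c, c \in C -> exists2 p, p \in ps & last c p = c.
Proof.
case/andP => /allP pP up szp c cC.
have [us ds] := flatten_uniqP up.
have lP p d : p \in ps -> last d p \in C /\ last d p \in p.
  by move/pP; case: p => //= a s /and3P [_ _ lC]; rewrite lC mem_last.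
have ups : uniq ps by apply: uniq_flatten up; apply/allP => p /pP; case: p.
have ul : uniq (map (last c) ps).
  rewrite map_inj_in_uniq // => p q pps qps lpq.
  by apply: (ds p q (last c p)) => //; [case: (lP p c) | rewrite lpq; case: (lP q c)].
have sub : {subset map (last c) ps <= enum C}.
  by move=> _ /mapP [p /(lP p c) [lC _] ->]; rewrite mem_enum.
have /(_ c) : map (last c) ps =i enum C.
  apply: (uniq_min_size ul sub _).2; by rewrite size_map szp cardE.
by rewrite mem_enum cC => /mapP [p pps cE]; exists p.
Qed.

(* Goering's proof: delete an edge [xy]. If [S] separates with fewer than [n]
   vertices afterwards, then [x |: S] and [y |: S] are minimum separators of the
   original graph, and the paths to the former continue with those from the
   latter. *)
Lemma menger G A B n : (forall S, separates G A B S -> n <= #|S|) ->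
  exists ps, linkage G A B ps /\ size ps = n.
Proof.
have [m] := ubnP #|[set p : T * T | G p.1 p.2]|.
elim: m G A B n => // m IH G A B n lt_m sepn.
have [/existsP [[x y] /= xy]|noedge] := boolP [exists p : T * T, G p.1 p.2]; last first.
  have nG u v : G u v = false.
    by apply: contraNF noedge => uv; apply/existsP; exists (u, v).
  have /sepn nAB : separates G A B (A :&: B).
    case=> [|a [|b s]] //=; first by rewrite inE orbF => /andP [-> ->].
    by rewrite nG /= andbF.
  exists (map (fun v => [:: v]) (take n (enum (A :&: B)))); split.
    apply/andP; split.
      by apply/allP => _ /mapP [v /mem_take + ->]; rewrite mem_enum inE => /andP [/= -> ->].
    rewrite (_ : flatten _ = take n (enum (A :&: B))) ?take_uniq ?enum_uniq //.
    by elim: (take _ _) => //= v s ->.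
  by rewrite size_map size_takel // -cardE.
pose G' : rel T := [rel u v | G u v && ~~ ((u == x) && (v == y))].
have G'E u v : G' u v = G u v && ~~ ((u == x) && (v == y)) by [].
have sub : subrel G' G by move=> u v /andP [].
have lt_m' : #|[set p : T * T | G' p.1 p.2]| < m.
  rewrite ltnS in lt_m; apply: leq_trans lt_m; apply: proper_card; apply/properP; split.
    by apply/subsetP => p; rewrite !inE => /andP [].
  by exists (x, y); rewrite !inE //= /G' /= !eqxx andbF.
have subp C D p : set_path G' C D p -> set_path G C D p.
  by case: p => //= a s /and3P [-> /(sub_path sub) -> ->].
have keepx C D p v : set_path G C D (rcons p v) -> x \notin p -> set_path G' C D (rcons p v).
  case: p => [|a p] //=; rewrite last_rcons => /and3P [-> + ->] xp; rewrite andbT /=.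
  elim: p a xp => [|b p IHp] a /=.
    by rewrite inE !andbT [x == a]eq_sym => /negbTE xa; rewrite G'E xa => ->.
  rewrite inE negb_or => /andP [xa xp] /andP [ab bp].
  by rewrite G'E ab [a == x]eq_sym (negbTE xa) IHp.
have keepy C D a p : set_path G C D (a :: p) -> y \notin p -> set_path G' C D (a :: p).
  move=> /= /and3P [-> + ->] yp; rewrite andbT /=.
  elim: p a yp => //= b p IHp a; rewrite inE negb_or => /andP [yb yp] /andP [ab bp].
  by rewrite G'E ab [b == y]eq_sym (negbTE yb) andbF IHp.
have [/forallP sepn'|] := boolP [forall S : {set T}, (#|S| < n) ==>
    [exists v in A, exists w in B, connect (avoid G' S) v w && (v \notin S)]].
  have [|ps [lps szp]] := IH G' A B n lt_m'.
    move=> S sepS; rewrite leqNgt; apply/negP => Sn.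
    have /implyP/(_ Sn)/exists_inP [v vA /exists_inP [w wB /andP [/connectP [s vs wE] vS]]] := sepn' S.
    have : has [in S] (v :: s).
      apply: sepS; rewrite /= vA -wE wB andbT /=.
      by apply: sub_path vs => a b /and3P [].
    rewrite /= (negbTE vS) /= => /hasP [u us uS].
    move: vs; case/splitPr: us => s1 s2; rewrite cat_path /=.
    by case/and3P => _ /and3P [_ /negP].
  exists ps; split=> //; case/andP: lps => /allP pP up; rewrite /linkage up andbT.
  by apply/allP => p /pP; apply: subp.
case/forallPn => S; rewrite negb_imply => /andP [Sn nconn].
have sepS : separates G' A B S.
  move=> p pAB; apply/negPn/negP => nS; case/negP: nconn.
  case: p pAB nS => //= a s /and3P [aA as_ lB]; rewrite negb_or => /andP [aS sS].
  apply/exists_inP; exists a => //; apply/exists_inP; exists (last a s) => //.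
  rewrite aS andbT; apply/connectP; exists s => //.
  elim: s a aS {aA lB} as_ sS => //= b s IHs a aS /andP [ab bs]; rewrite negb_or => /andP [bS sS].
  by rewrite /avoid /= aS bS IHs // andbT; exact: ab.
have sepU u : (u == x) || (u == y) -> separates G A B (u |: S).
  move=> uxy p pAB; have [up|up] := boolP (u \in p).
    by apply/hasP; exists u; rewrite // !inE eqxx.
  have /hasP [v vp vS] : has [in S] p.
    apply: sepS; case/orP: uxy up => /eqP ->.
      case/lastP: p pAB => // p v pAB; rewrite mem_rcons inE negb_or => /andP [_].
      exact: keepx.
    by case: p pAB => // a p pAB; rewrite inE negb_or => /andP [_]; exact: keepy.
  by apply/hasP; exists v; rewrite // !inE vS orbT.
have cardU u : (u == x) || (u == y) -> u \notin S /\ #|u |: S| = n.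
  move=> /sepU /sepn; rewrite cardsU1; case: (u \in S) => /=; first by rewrite add0n leqNgt Sn.
  by rewrite add1n => le; split=> //; apply/eqP; rewrite eqn_leq le Sn.
have [xS cx] : x \notin S /\ #|x |: S| = n by apply: cardU; rewrite eqxx.
have [yS cy] : y \notin S /\ #|y |: S| = n by apply: cardU; rewrite eqxx orbT.
have [ps [lps szp tps]] : exists ps, [/\ linkage G' A (x |: S) ps, size ps = n &
    forall p, p \in ps -> truncated (x |: S) p].
  have [|ps [lps szp]] := IH G' A (x |: S) n lt_m'.
    move=> R sepR; apply: sepn => p pAB.
    have hp : has [in x |: S] p by apply: sepU pAB; rewrite eqxx.
    have [p1 [v [p2 [pE vC nC]]]] := first_hit pAB hp; rewrite pE in pAB *.
    have [h _] := set_path_cat pAB.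
    have : has [in R] (rcons p1 v).
      apply: sepR; apply: (set_path_sub (B := [set v])); first by move=> w; rewrite inE => /eqP ->.
      apply: keepx h _; apply: contra nC => xp1.
      by apply/hasP; exists x; rewrite // !inE eqxx.
    by rewrite -cat_rcons has_cat => ->.
  have [qs [lqs szq tqs]] := linkage_truncate lps.
  by exists qs; rewrite szq.
have [qs [lqs szq tqs]] : exists qs, [/\ linkage G' (y |: S) B qs, size qs = n &
    forall q, q \in qs -> truncated (y |: S) (rev q)].
  have [|qs [lqs szq]] := IH G' (y |: S) B n lt_m'.
    move=> R sepR; apply: sepn => p pAB.
    have hp : has [in y |: S] p by apply: sepU pAB; rewrite eqxx orbT.
    have [p1 [v [p2 [pE vC nC]]]] := last_hit hp; rewrite pE in pAB.
    have [_ h] := set_path_cat pAB.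
    have : has [in R] (v :: p2).
      apply: sepR; have h' : set_path G (y |: S) B (v :: p2).
        by move: h => /= /and3P [_ -> ->]; rewrite vC.
      apply: keepy h' _; apply: contra nC => yp2.
      by apply/hasP; exists y; rewrite // !inE eqxx.
    by rewrite pE has_cat => ->; rewrite orbT.
  have [rs [lrs szr trs]] := linkage_truncate (linkage_rev lqs).
  exists (map rev rs); split; first exact: (linkage_rev lrs).
    by rewrite size_map szr size_map.
  by move=> _ /mapP [r /trs tr ->]; rewrite revK.
have [/allP pP up] := andP lps; have [/allP qP uq] := andP lqs.
have [ups dps] := flatten_uniqP up; have [uqs dqs] := flatten_uniqP uq.
have qhead d : exists q, d \in y |: S -> d :: q \in qs.
  have [dS|dS] := boolP (d \in y |: S); last by exists [::].
  have szrq : size (map rev qs) = #|y |: S| by rewrite size_map szq cy.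
  have [_ /mapP [q qqs ->]] := linkage_ends (linkage_rev lqs) szrq dS.
  rewrite last_rev; have := qP q qqs; case: q qqs => // d' q qqs _ /= dE.
  by exists q; rewrite -dE.
have [Q QP] := fin_all_exists qhead.
(* A common vertex outside [S] would give a path from [A] to [B] in [G'] that avoids [S], because
   truncation keeps the rest of both paths off [S]. *)
have cross p q v : p \in ps -> q \in qs -> v \in p -> v \in q ->
    [/\ v \in S, last x p = v & head x q = v].
  move=> pps qqs vp vq.
  have [p1 [c [pE cS np]]] := tps p pps; have [q1 [d [qE dS nq]]] := tqs q qqs.
  have qE' : q = d :: rev q1 by rewrite -[q]revK qE rev_rcons.
  have p1S u : u \in p1 -> u \notin S.
    by move=> up1; apply: contra np => uS; apply/hasP; exists u; rewrite // !inE uS orbT.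
  have q1S u : u \in rev q1 -> u \notin S.
    rewrite mem_rev => uq1; apply: contra nq => uS; apply/hasP; exists u; rewrite // !inE uS.
    exact: orbT.
  have vS : v \in S.
    apply/negPn/negP => vS; have := pP p pps; have := qP q qqs.
    case: (splitPr vp) pE p1S => pa pb pE p1S; case: (splitPr vq) qE' => qa qb qE'.
    move=> /set_path_cat [_ hq] /set_path_cat [hp _].
    have hq' : set_path G' [set v] B (v :: qb) by [].
    have /hasP [u] := sepS _ (set_path_glue hp hq').
    rewrite mem_cat inE => /or3P [upa|/eqP ->|uqb]; last 2 first.
    - by rewrite /= (negbTE vS).
    - apply/negP/q1S; case: qa qE' => [|d' qa] [_ <-] //.
      by rewrite mem_cat inE uqb !orbT.
    apply/negP/p1S; case/lastP: pb pE => [|pb e] pE.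
      by move: pE; rewrite cats1 => /rcons_inj [<-].
    by move: pE; rewrite -rcons_cons -rcons_cat => /rcons_inj [<- _]; rewrite mem_cat upa.
  split=> //.
    move: vp; rewrite pE mem_rcons last_rcons inE => /predU1P [->|/p1S] //.
    by rewrite vS.
  by move: vq; rewrite qE' inE => /predU1P [->|/q1S] //; rewrite vS.
(* A path ending in [x] takes the deleted edge to [y]; every other one ends in [S] and continues
   from there. *)
pose tail c := if c == x then y :: Q y else Q c.
pose g p := p ++ tail (last x p).
have lastS p : p \in ps -> last x p \in x |: S.
  by move=> /tps [p1 [c [-> cS _]]]; rewrite last_rcons.
have yyS : y \in y |: S by rewrite !inE eqxx.
have tailP c v : c \in x |: S -> v \in tail c -> exists2 q, q \in qs &
    [/\ v \in q, head x q = (if c == x then y else c) & v \in S -> v != head x q].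
  rewrite /tail => cS; case: eqP => [_|/eqP cx'] vt.
    exists (y :: Q y); first exact: QP.
    by split=> // vS; apply: contraTneq vS => ->.
  have cS' : c \in y |: S by move: cS; rewrite !inE (negbTE cx') /= => ->; rewrite orbT.
  have cqs := QP c cS'; exists (c :: Q c) => //; split=> //; first by rewrite inE vt orbT.
  by move=> _ /=; apply: contraTneq vt => ->; have /andP [] := uqs _ cqs.
have noc p c v : p \in ps -> c \in x |: S -> v \in p -> v \in tail c -> False.
  move=> pps cS vp /(tailP _ _ cS) [q qqs [vq _ nv]].
  by have [vS _ hv] := cross p q v pps qqs vp vq; have := nv vS; rewrite hv eqxx.
have lastI p q : p \in ps -> q \in ps -> last x p = last x q -> p = q.
  have inp r : r \in ps -> last x r \in r.
    by move=> /tps [p1 [c [-> _ _]]]; rewrite last_rcons mem_rcons mem_head.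
  by move=> pps qps lE; apply: (dps p q (last x p)); rewrite ?inp // lE inp.
have uniq_ps : uniq ps by apply: uniq_flatten up; apply/allP => p /pP; case: p.
exists (map g ps); split; last by rewrite size_map.
apply/andP; split.
  apply/allP => _ /mapP [p pps ->]; have := lastS p pps; have pA := pP p pps.
  have [p1 [c [pE cS _]]] := tps p pps; rewrite /g pE last_rcons /tail => _.
  rewrite pE in pA; have := subp _ _ _ pA; case: eqP => [cE|/eqP cx'].
    subst c; have := subp _ _ _ (qP _ (QP y yyS)).
    case: (p1) => [|a p2] /=.
      by move=> /and3P [_ -> ->] /andP [-> _]; rewrite xy.
    by rewrite cat_path rcons_path !last_rcons last_cat /= => /and3P [_ -> ->] /and3P [-> /andP [-> ->] _]; rewrite xy.
  have cS' : c \in y |: S by move: cS; rewrite !inE (negbTE cx') /= => ->; rewrite orbT.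
  move=> hA; have := subp _ _ _ (qP _ (QP c cS')) => hB.
  rewrite cat_rcons; apply: set_path_glue.
    case: (p1) hA => [|a p2] /=; first by rewrite set11 => /andP [->].
    by rewrite last_rcons set11 => /and3P [-> ->].
  by move: hB => /= /and3P [_ -> ->]; rewrite inE eqxx.
apply: uniq_flatten_map => //.
  move=> p pps; rewrite cat_uniq ups //=; apply/andP; split.
    by apply/hasPn => v vt; apply/negP => vp; apply: noc pps (lastS p pps) vp vt.
  rewrite /tail; case: eqP => [_|/eqP cx']; first exact: (uqs _ (QP y yyS)).
  have cS' : last x p \in y |: S.
    by have := lastS p pps; rewrite !inE (negbTE cx') /= => ->; rewrite orbT.
  by have /andP [] := uqs _ (QP _ cS').
move=> p q v pps qps; rewrite !mem_cat => /orP [vp|vp] /orP [vq|vq].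
- exact: dps vp vq.
- by case: (noc p _ v pps (lastS q qps) vp vq).
- by case: (noc q _ v qps (lastS p pps) vq vp).
have [r rqs [vr hr _]] := tailP _ _ (lastS p pps) vp.
have [r' r'qs [vr' hr' _]] := tailP _ _ (lastS q qps) vq.
have rr' : r = r' by apply: (dqs r r' v).
apply: lastI => //; move: hr; rewrite rr' hr'.
have := lastS p pps; have := lastS q qps; rewrite !inE.
case: eqP => [->|_]; case: eqP => [->|_] //= qS pS E; first by move: pS; rewrite -E (negbTE yS).
by move: qS; rewrite E (negbTE yS).
Qed.

End Menger.

Lemma fan (T : finType) (G : rel T) (z : T) (c : {set T}) :
  symmetric G -> irreflexive G -> k_connected 3 G -> z \notin c -> 2 < #|c| ->
  exists ps, [/\ size ps = 3, uniq (flatten ps) &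
    forall p, p \in ps -> [/\ path G z p, z \notin p & truncated c p]].
Proof.
move=> Gsym Girr Gconn zc c3.
have [|ps [lps szp]] := @menger T (del G z) [set u | G z u] c 3.
  move=> S sepS; rewrite leqNgt; apply/negP => S3.
  have /subsetPn [d dc dS] : ~~ (c \subset S).
    by apply: contraL S3 => /subset_leq_card le; rewrite -leqNgt (leq_trans c3).
  (* [M] collects what [z] reaches outside [S], described by the first step so that the rest of the
     walk lies in [G - z]. As [S] may contain [z], the separator used below is [S :\ z]. *)
  pose M := [set u | (u == z) || [exists a,
    [&& G z a, a \notin S & connect (avoid (del G z) S) a u]]].
  have dz : d != z by apply: contraNneq zc => <-.
  have : d \in M.
    apply: (@connected_closed T G (S :\ z) M z d Gconn).
    - by apply: leq_trans S3; rewrite ltnS subset_leq_card // subD1set.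
    - move=> u v uM uS vS uv; rewrite inE; have [//|vz] := eqVneq v z.
      have vS' : v \notin S by move: vS; rewrite !inE vz.
      move: uM; rewrite inE => /orP [/eqP uz|/existsP [a /and3P [za aS au]]].
        by apply/existsP; exists v; rewrite -uz uv vS' connect0.
      have [uz|uz] := eqVneq u z; first by apply/existsP; exists v; rewrite -uz uv vS' connect0.
      apply/existsP; exists a; rewrite za aS; apply: connect_trans au (connect1 _).
      by move: uS; rewrite !inE uz /avoid /del /= uz vz vS' uv => ->.
    - by rewrite inE eqxx.
    - by rewrite !inE eqxx.
    - by rewrite !inE dz.
  rewrite inE (negbTE dz) => /existsP [a /and3P [za aS /connectP [s ps dE]]].
  have /hasP [v] : has [in S] (a :: s).
    apply: sepS; rewrite /= inE za -dE dc andbT.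
    by apply: sub_path ps => u v /and3P [].
  rewrite inE => /predU1P [->|vs vS]; first by rewrite (negbTE aS).
  by case/splitPr: vs ps => s1 s2; rewrite cat_path /= => /and3P [_ /and3P [_ /negP]].
have [qs [/andP [/allP qP uq] szq tq]] := linkage_truncate lps.
exists qs; split=> //; first by rewrite szq.
move=> q qqs; split; last exact: tq.
  have := qP q qqs; case: q {qqs} => // a s /and3P [+ ps' _]; rewrite inE /= => ->.
  by apply: sub_path ps' => u v /and3P [].
have := qP q qqs; case: q {qqs} => // a s /and3P [+ ps' _]; rewrite !inE => za.
rewrite negb_or; apply/andP; split; first by apply: contraTneq za => <-; rewrite Girr.
apply/negP => zs; move: ps'; case/splitPr: zs => s1 s2.
by rewrite cat_path /= /del /= eqxx !andbF.
Qed.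

(** * Wheels *)

Lemma path_rcons_rev (T : eqType) (G : rel T) x s y : symmetric G ->
  path G x (rcons s y) -> path G y (rcons (rev s) x).
Proof.
move=> Gsym h; have := rev_path G x (rcons s y).
rewrite last_rcons belast_rcons rev_cons => ->.
by rewrite (eq_path (e' := G)) // => u v; rewrite Gsym.
Qed.

(** With three or more rim vertices a rim edge determines its direction, so its link can be stored
    once and reversed when read backwards. *)
Lemma ordS_asym k (i j : 'I_k) : 2 < k -> ordS i = j -> ordS j <> i.
Proof.
move=> k3 /(congr1 val) /= ij /(congr1 val) /= ji; have := ltn_ord i.
have [lt|ge] := ltnP i.+1 k.
  move: ij; rewrite modn_small // => ij _; move: ji; rewrite -ij.
  have [lt'|ge'] := ltnP i.+2 k; first by rewrite modn_small //; lia.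
  have -> : i.+2 = k by lia.
  by rewrite modnn; lia.
move=> lt; have ik : i.+1 = k by lia.
by move: ij ji; rewrite ik modnn => <-; rewrite modn_small; lia.
Qed.

Lemma wheel_subdivision (T : finType) (G : rel T) z k (a : 'I_k -> T) (l m : 'I_k -> seq T) :
  symmetric G -> 2 < k -> injective a -> (forall i, a i != z) ->
  (forall i, path G (a i) (rcons (l i) (a (ordS i)))) ->
  (forall i, path G z (rcons (m i) (a i))) ->
  (forall i, uniq (l i)) -> (forall i, uniq (m i)) ->
  (forall i, z \notin l i) -> (forall i, z \notin m i) ->
  (forall i j, a j \notin l i) -> (forall i j, a j \notin m i) ->
  (forall i j v, v \in l i -> v \in l j -> i = j) ->
  (forall i j v, v \in m i -> v \in m j -> i = j) ->
  (forall i j v, v \in l i -> v \notin m j) ->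
  exists S : subdivision_in (wheel k) G,
    hub S = z /\ forall i v, v \in a i :: l i -> on_rim S v.
Proof.
move=> Gsym k3 ainj az pl pm ul um zl zm al am ll mm lm.
pose br (u : option 'I_k) := if u is Some i then a i else z.
pose lk (u v : option 'I_k) := match u, v with
  | Some i, Some j => if ordS i == j then l i else rev (l j)
  | None, Some i => m i
  | Some i, None => rev (m i)
  | None, None => [::] end.
have lkS i : lk (Some i) (Some (ordS i)) = l i by rewrite /lk eqxx.
have lkSr i : lk (Some (ordS i)) (Some i) = rev (l i).
  by rewrite /lk; case: eqP => // /(ordS_asym k3 (erefl _)).
pose spoke (u v : option 'I_k) (i : 'I_k) := (u = None /\ v = Some i) \/ (u = Some i /\ v = None).
pose rimE (u v : option 'I_k) (i : 'I_k) := (u = Some i /\ v = Some (ordS i)) \/ (u = Some (ordS i) /\ v = Some i).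
have cases u v : wheel k u v -> (exists i, spoke u v i) \/ (exists i, rimE u v i).
  case: u v => [i|] [j|] //=; last 2 first.
  - by left; exists i; right.
  - by left; exists j; left.
  by case/orP => /eqP <-; right; [exists i; left | exists j; right].
have memlk u v x : wheel k u v -> x \in lk u v ->
    (exists i, spoke u v i /\ x \in m i) \/ (exists i, rimE u v i /\ x \in l i).
  case/cases => -[i] [] [-> ->]; rewrite ?lkS ?lkSr /= ?mem_rev => xi.
  - by left; exists i; split=> //; left.
  - by left; exists i; split=> //; right.
  - by right; exists i; split=> //; left.
  - by right; exists i; split=> //; right.
have brinj : injective br.
  by move=> [i|] [j|] //= => [/ainj -> | /eqP | /esym /eqP] //; rewrite (negbTE (az _)).
have lkpath u v : wheel k u v -> path G (br u) (rcons (lk u v) (br v)).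
  case/cases => -[i] [] [-> ->]; rewrite ?lkS ?lkSr //=; exact: path_rcons_rev.
have lkuniq u v : wheel k u v -> uniq (lk u v).
  by case/cases => -[i] [] [-> ->]; rewrite ?lkS ?lkSr /= ?rev_uniq.
have lkrev u v : wheel k u v -> lk v u = rev (lk u v).
  by case/cases => -[i] [] [-> ->]; rewrite ?lkS ?lkSr /= ?revK.
have lkbr u v w : wheel k u v -> br w \notin lk u v.
  move=> uv; apply/negP => /(memlk _ _ _ uv) [] [i [_]]; apply/negP; case: w => [j|] //=.
have lkdis u v u' v' x : wheel k u v -> wheel k u' v' -> x \in lk u v -> x \in lk u' v' ->
    (u' = u /\ v' = v) \/ (u' = v /\ v' = u).
  move=> uv u'v' /(memlk _ _ _ uv) [] [i [uvi xi]] /(memlk _ _ _ u'v') [] [j [uvj xj]].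
  - rewrite -(mm _ _ _ xi xj) in uvj.
    by case: uvi uvj => [] [-> ->] [] [-> ->]; auto.
  - by move: (lm _ i _ xj); rewrite xi.
  - by move: (lm _ j _ xi); rewrite xj.
  rewrite -(ll _ _ _ xi xj) in uvj.
  by case: uvi uvj => [] [-> ->] [] [-> ->]; auto.
exists (Subdivision brinj lkpath lkuniq lkrev lkbr lkdis); split=> // i v.
by rewrite inE => /predU1P [->|vi]; exists i; [left | right; rewrite /link lkS].
Qed.

Lemma blocks (T : eqType) (P : pred T) (s : seq T) : exists pre bs,
  [/\ s = pre ++ flatten [seq p.1 :: p.2 | p <- bs], all (predC P) pre,
      map fst bs = filter P s & all (fun p => all (predC P) p.2) bs].
Proof.
elim: s => [|x s [pre [bs [sE npre fE nbs]]]]; first by exists [::], [::].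
have [xP|xP] := boolP (P x).
  by exists [::], ((x, pre) :: bs); rewrite /= xP fE npre nbs -sE.
by exists (x :: pre), bs; rewrite /= (negbTE xP) fE npre nbs sE.
Qed.

(** After a rotation block [i] comes first, and the head of the cyclically next block follows it. *)
Lemma cycle_blocks (T : eqType) (G : rel T) (bs : seq (T * seq T)) (i : 'I_(size bs)) d :
  1 < size bs -> cycle G (flatten [seq p.1 :: p.2 | p <- bs]) ->
  path G (nth d bs i).1 (rcons (nth d bs i).2 (nth d bs (ordS i)).1).
Proof.
move=> b2; set g := fun p => _; rewrite -(rot_cycle (size (flatten (map g (take i bs))))).
have -> : flatten (map g bs) = flatten (map g (take i bs)) ++ flatten (map g (drop i bs)).
  by rewrite -flatten_cat -map_cat cat_take_drop.
rewrite rot_size_cat -flatten_cat -map_cat.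
rewrite (drop_nth d) // cat_cons.
have [r ->] : exists r, drop i.+1 bs ++ take i bs = nth d bs (ordS i) :: r.
  have [lt|ge] := ltnP i.+1 (size bs).
    by rewrite (drop_nth d) //= modn_small //; eexists.
  have ik : i.+1 = size bs by have := ltn_ord i; lia.
  rewrite drop_oversize //= ik modnn.
  have : 0 < i by lia.
  case: (val i) => // n _; case: (bs) b2 => //= b bs' _; by eexists.
rewrite /= rcons_cat cat_path => /andP [pl /= /andP [e _]].
by rewrite rcons_path pl.
Qed.

(** [A] supplies the branch vertices of the rim, the other vertices of the cycle subdivide it, and
    [ms a] is the interior of the spoke to [a]. *)
Lemma wheel_of_cycle (T : finType) (G : rel T) z s (A : {set T}) (ms : T -> seq T) :
  symmetric G -> 2 < #|A| -> uniq s -> cycle G s -> z \notin s -> {subset A <= s} ->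
  (forall a, a \in A -> [/\ path G z (rcons (ms a) a), uniq (ms a), z \notin ms a &
    forall v, v \in ms a -> v \notin s]) ->
  (forall a b v, a \in A -> b \in A -> v \in ms a -> v \in ms b -> a = b) ->
  exists S : subdivision_in (wheel #|A|) G, hub S = z /\ forall v, v \in s -> on_rim S v.
Proof.
move=> Gsym A3 us cs zs As msP msD.
have [x0 x0A] : exists x, x \in A by apply/card_gt0P; lia.
(* Starting the cycle in [A] leaves no vertex before the first block. *)
have [i0 s0 rE] := rot_to (As _ x0A).
have ms0 : s =i x0 :: s0 by move=> v; rewrite -rE mem_rot.
have {}us : uniq (x0 :: s0) by rewrite -rE rot_uniq.
have {}cs : cycle G (x0 :: s0) by rewrite -rE rot_cycle.
have [pre [bs [sE npre fE nbs]]] := blocks [in A] (x0 :: s0).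
have pre0 : pre = [::].
  by case: pre sE npre => // x pre [<- _] /=; rewrite x0A.
rewrite {}pre0 /= in sE => {npre}.
have szA : #|A| = size bs.
  rewrite -(size_map fst) fE cardE; apply: perm_size; apply: uniq_perm.
  - exact: enum_uniq.
  - exact: filter_uniq.
  move=> v; rewrite mem_enum mem_filter; case: (boolP (v \in A)) => //= /As.
  by rewrite ms0 => ->.
rewrite szA in A3 *.
pose d := (x0, [::] : seq T); pose a (i : 'I_(size bs)) := (nth d bs i).1.
pose l (i : 'I_(size bs)) := (nth d bs i).2.
have bsi (i : 'I_(size bs)) : nth d bs i \in bs by apply: mem_nth.
have aE i : a i = nth x0 (map fst bs) i by rewrite (nth_map d).
have aA i : a i \in A.
  have : a i \in map fst bs by apply: map_f.
  by rewrite fE mem_filter => /andP [].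
have ainj : injective a.
  move=> i j; rewrite !aE => /eqP; rewrite nth_uniq ?size_map //; first by move/eqP/val_inj.
  by rewrite fE filter_uniq.
have uf := us; rewrite sE in uf; have [ub db] := flatten_uniqP uf.
have bm (i : 'I_(size bs)) : a i :: l i \in [seq p.1 :: p.2 | p <- bs] by exact: (map_f _ (bsi i)).
have ls i v : v \in a i :: l i -> v \in s.
  by move=> vi; rewrite ms0 sE; apply/flattenP; exists (a i :: l i).
have lnA i v : v \in l i -> v \notin A by move=> vi; have /allP/(_ _ (bsi i))/allP := nbs; apply.
have ll i j v : v \in l i -> v \in l j -> i = j.
  move=> vi vj; apply: ainj.
  have := db _ _ v (bm i) (bm j).
  by rewrite !inE vi vj !orbT => /(_ isT isT) [].
have [|||i|i|i|i|i j|i j|i j v|i j v|i j v|S [hS rS]] :=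
    @wheel_subdivision T G z _ a l (fun i => ms (a i)) Gsym A3 ainj.
- by move=> i; apply: contraNneq zs => <-; apply: As.
- by move=> i; apply: cycle_blocks; [lia | rewrite -sE].
- by move=> i; case: (msP _ (aA i)).
- by have /andP [] := ub _ (bm i).
- by case: (msP _ (aA i)).
- by apply: contra zs => zi; apply: (ls i); rewrite inE zi orbT.
- by case: (msP _ (aA i)).
- by apply/negP => /lnA; rewrite aA.
- by apply/negP; case: (msP _ (aA i)) => _ _ _ h /h; rewrite As.
- exact: ll.
- by move=> vi vj; apply: ainj; apply: msD vi vj; apply: aA.
- by move=> vi; apply/negP; case: (msP _ (aA j)) => _ _ _ h /h; rewrite (ls i) // inE vi orbT.
exists S; split=> // v; rewrite ms0 sE => /flattenP [_ /mapP [p /(nthP d) [i i_lt <-] ->] vp].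
exact: (rS (Ordinal i_lt)).
Qed.

Lemma claw_freeP (T : finType) (G : rel T) : symmetric G -> irreflexive G ->
  claw_free G -> no_claw G.
Proof.
move=> Gsym Girr cf v a b c va vb vc ab ac bc; apply/negPn/negP.
rewrite !negb_or => /and3P [nab nac nbc]; apply: cf.
pose f (u : option 'I_3) := if u is Some i then nth a [:: a; b; c] i else v.
have neq x y : G x y -> x != y by apply: contraTneq => ->; rewrite Girr.
exists f; split.
  have E (x y : T) : x != y -> (x == y = false) * (y == x = false).
    by move=> /negbTE xy; rewrite [y == x]eq_sym xy.
  pose simp := (E _ _ (neq _ _ va), E _ _ (neq _ _ vb), E _ _ (neq _ _ vc), E _ _ ab, E _ _ ac, E _ _ bc).
  move=> [[[|[|[|i]]] lti]|] [[[|[|[|j]]] ltj]|] //= /eqP; rewrite /= ?simp // => _;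
    by congr Some; apply: val_inj.
move=> [[[|[|[|i]]] lti]|] [[[|[|[|j]]] ltj]|] //=;
  rewrite ?Girr ?va ?vb ?vc ?(negbTE nab) ?(negbTE nac) ?(negbTE nbc) //;
  by rewrite Gsym ?va ?vb ?vc ?(negbTE nab) ?(negbTE nac) ?(negbTE nbc).
Qed.

Lemma cycle_del (T : finType) (G : rel T) z s : uniq s -> cycle (del G z) s ->
  z \notin s /\ cycle G s.
Proof.
move=> us cs; split.
  by apply/negP => /(next_cycle cs); rewrite /del /= eqxx.
by apply: sub_cycle cs => u v /and3P [].
Qed.

(** The first vertices of the spokes after the hub are distinct neighbours of it; the default of
    [head] is the rim vertex, for a spoke that is a single edge. *)
Lemma hub_degree (T : finType) (G : rel T) k (S : subdivision_in (wheel k) G) :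
  k <= degree G (hub S).
Proof.
pose g i := head (branch S (Some i)) (link S None (Some i)).
have adj i : wheel k None (Some i) by [].
have gadj i : G (hub S) (g i).
  by have := link_path S (adj i); rewrite /g; case: (link S None (Some i)) => [|x p] /= /andP [].
have nb i j : branch S (Some j) \notin link S None (Some i) by apply: link_branch.
have ginj : injective g.
  move=> i j; have := nb i j; have := nb j i; have := @link_disjoint _ _ _ _ S _ _ _ _ _ (adj i) (adj j).
  rewrite /g; case: (link S None (Some i)) => [|x p]; case: (link S None (Some j)) => [|y q] dis ni nj /=.
  - by move/branch_inj => -[].
  - by move=> e; move: ni; rewrite e mem_head.
  - by move=> e; move: nj; rewrite -e mem_head.
  by move=> e; have := dis x; rewrite mem_head e mem_head => /(_ isT isT) [[_ [->]]|[]].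
rewrite -[X in X <= _](card_ord k) -cardsT -(card_imset _ ginj) subset_leq_card //.
by apply/subsetP => _ /imsetP [i _ ->]; rewrite inE.
Qed.

Lemma wheel_at (T : finType) (G : rel T) k z :
  symmetric G -> irreflexive G -> k_connected 3 G -> no_claw G ->
  3 <= k <= 5 -> k <= degree G z -> exists S : subdivision_in (wheel k) G, hub S = z.
Proof.
move=> Gsym Girr Gconn Gclaw /andP [k3 k5] kz.
pose X := [set x in take k (enum [set y | G z y])].
have cX : #|X| = k.
  rewrite cardsE (card_uniqP _) ?take_uniq ?enum_uniq // size_takel //.
  by rewrite -cardE.
have Xz x : x \in X -> G z x by rewrite inE => /mem_take; rewrite mem_enum inE.
have zX : z \notin X by apply/negP => /Xz; rewrite Girr.
have [||s [us cs Xs]] := cycle_avoiding Gsym Girr Gconn Gclaw zX; rewrite ?cX //.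
have [zs {}cs] := cycle_del us cs.
have [|||S [hS _]] := @wheel_of_cycle T G z s X (fun _ => [::]) Gsym _ us cs zs Xs.
- by rewrite cX.
- by move=> a /Xz za; split=> //=; rewrite za.
- by [].
by move: S hS; rewrite cX => S hS; exists S.
Qed.

(** The three ends of a fan from [z] serve as branch vertices, so the vertices of [X] lie on the rim
    without having to be branch vertices. *)
Lemma wheel3_at (T : finType) (G : rel T) (X : {set T}) z :
  symmetric G -> irreflexive G -> k_connected 3 G -> no_claw G ->
  z \notin X -> 2 < #|X| -> #|X| <= 5 -> exists S : subdivision_in (wheel 3) G,
    hub S = z /\ forall x, x \in X -> on_rim S x.
Proof.
move=> Gsym Girr Gconn Gclaw zX X3 X5.
have [s [us cs Xs]] := cycle_avoiding Gsym Girr Gconn Gclaw zX X3 X5.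
have [zs {}cs] := cycle_del us cs.
have [||ps [szp up psP]] := @fan T G z [set x in s] Gsym Girr Gconn.
- by rewrite inE.
- by apply: leq_trans X3 _; apply/subset_leq_card/subsetP => x /Xs; rewrite inE.
have [ups dps] := flatten_uniqP up.
have lastP p : p \in ps -> exists q a, [/\ p = rcons q a, a = last z p, a \in s & forall v, v \in q -> v \notin s].
  move=> /psP [_ _ [q [a [pE aS nq]]]]; exists q, a; split=> //.
  - by rewrite pE last_rcons.
  - by rewrite inE in aS.
  move=> v vq; apply: contra nq => vs; apply/hasP; exists v => //.
  by rewrite /= inE.
pose A := [set a in map (last z) ps].
have inA a : exists q, a \in A -> rcons q a \in ps /\ (forall v, v \in q -> v \notin s).
  have [|] := boolP (a \in A); last by exists [::].
  rewrite inE => /mapP [p pps ->]; have [q [a' [pE aE _ nq]]] := lastP p pps.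
  by exists q; rewrite -aE -pE.
have cA : #|A| = 3.
  rewrite cardsE (card_uniqP _) ?size_map //.
  have lp p : p \in ps -> last z p \in p.
    by move=> /lastP [q [a [-> _]]]; rewrite last_rcons mem_rcons mem_head.
  rewrite map_inj_in_uniq; last first.
    by move=> p q pps qps e; apply: (dps p q (last z p)); rewrite ?lp // e lp.
  by apply: uniq_flatten up; apply/allP => p /lastP [[|? ?] [? [->]]].
have [m mP] := fin_all_exists inA.
have [||||S [hS rS]] := @wheel_of_cycle T G z s A m Gsym _ us cs zs.
- by rewrite cA.
- by move=> a; rewrite inE => /mapP [p /lastP [q [b [_ <- bs _]]] ->].
- move=> a /mP [aps ns]; have [pz zp _] := psP _ aps; split=> //.
    by have := ups _ aps; rewrite rcons_uniq => /andP [].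
  by move: zp; rewrite mem_rcons inE negb_or => /andP [].
- move=> a b v /mP [aps _] /mP [bps _] va vb.
  have := dps _ _ v aps bps; rewrite !mem_rcons !inE va vb !orbT => /(_ isT isT).
  by move/rcons_inj => [].
move: S hS rS; rewrite cA => S hS rS; exists S; split=> // x /Xs; exact: rS.
Qed.

Theorem corollary1p4 (T : finType) (G : rel T)
    (Gsym : symmetric G) (Girr : irreflexive G)
    (Gconn : k_connected 3 G) (Gclaw : claw_free G) :
  [/\ forall k : nat, 3 <= k <= 5 ->
        (has_topological_minor (wheel k) G <-> exists v : T, k <= degree G v),
      forall (z : T) (k : nat), degree G z = k -> k <= 5 ->
        exists S : subdivision_in (wheel k) G, hub S = z
    & forall (X : {set T}) (z : T), #|X| = 6 -> z \in X ->
        exists S : subdivision_in (wheel 3) G,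
          hub S = z /\ forall x : T, x \in X :\ z -> on_rim S x].
Proof.
have nclaw := claw_freeP Gsym Girr Gclaw; split.
- move=> k k35; split=> [[S]|[v kv]]; first by exists (hub S); apply: hub_degree.
  by have [S _] := wheel_at Gsym Girr Gconn nclaw k35 kv; constructor.
(* 3-connectedness supplies the lower bound 3 on the degree. *)
- move=> z k zk k5; apply: wheel_at; rewrite // ?zk // k5 andbT -zk.
  exact: three_neighbours.
move=> X z X6 zX; have X5 : #|X :\ z| = 5 by move: X6; rewrite (cardsD1 z) zX => -[].
by apply: wheel3_at; rewrite ?X5 // !inE eqxx.
Qed.
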